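(* Let $h\in\mathbb{C}$. For $\rho\in\mathbb{C}$ let $e^h_{\mathfrak{I}_N}(\rho,\cdot)$ be the unique solution of $\mathbf{L}_{q,\mathfrak{I}_N}u=\rho^2u$ on $(0,b)$ satisfying $e^h_{\mathfrak{I}_N}(\rho,0)=1$, $(e^h_{\mathfrak{I}_N})'(\rho,0)=i\rho+h$. There exists a kernel $K^h_{\mathfrak{I}_N}(x,t)$, not depending on $\rho$, defined for $0<x\le b$, $|t|\le x$, such that $$e^h_{\mathfrak{I}_N}(\rho,x)=e^{i\rho x}+\int_{-x}^{x}K^h_{\mathfrak{I}_N}(x,t)e^{i\rho t}\,dt\qquad\text{for all }\rho\in\mathbb{C},\ 0<x\le b.$$ For any $0<x\le b$, $K^h_{\mathfrak{I}_N}(x,t)$ is piecewise absolutely continuous with respect to the variable $t\in[-x,x]$ and $K^h_{\mathfrak{I}_N}(x,\cdot)\in L_2(-x,x)$. Furthermore, $K^h_{\mathfrak{I}_N}\in L_\infty(\Omega)$, where $\Omega=\{(x,t)\in\mathbb{R}^2: 0<x<b,\ |t|<x\}$.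
   Context: Let $b>0$, let $q\in L_2(0,b)$ be complex valued, $N\in\mathbb{N}$, $0<x_1<\dots<x_N<b$, $\alpha_1,\dots,\alpha_N\in\mathbb{C}\setminus\{0\}$, $x_0=0$, $x_{N+1}=b$, $\mathfrak{I}_N=\{(x_j,\alpha_j)\}_{j=1}^N$. $\mathcal{D}_2(\mathbf{L}_{q,\mathfrak{I}_N})$ is the set of $u\in AC[0,b]$ such that $u|_{(x_k,x_{k+1})}\in H^2(x_k,x_{k+1})$ for $k=0,\dots,N$ and $u'(x_k+)-u'(x_k-)=\alpha_ku(x_k)$ for $k=1,\dots,N$. A solution of $\mathbf{L}_{q,\mathfrak{I}_N}u=\lambda u$ (formally $-u''+(q(x)+\sum_{k=1}^N\alpha_k\delta(x-x_k))u=\lambda u$ on $(0,b)$) is a function $u\in\mathcal{D}_2(\mathbf{L}_{q,\mathfrak{I}_N})$ satisfying $-u''+qu=\lambda u$ a.e. on each $(x_k,x_{k+1})$. *)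

(* Defs.v *)
(* MathComp-Analysis over an abstract [R : realType]; complex numbers are
   [R[i]] from mathcomp-real-closed. *)
From HB Require Import structures.
From mathcomp Require Import all_boot all_order all_algebra.
From mathcomp Require Import all_classical all_reals all_analysis.
From mathcomp Require Import complex.

Set Implicit Arguments.
Unset Strict Implicit.
Unset Printing Implicit Defensive.
Import Order.TTheory GRing.Theory Num.Theory.
Import numFieldNormedType.Exports.
Local Open Scope classical_set_scope.
Local Open Scope ring_scope.
Local Open Scope complex_scope.

(* Limits, derivatives and integrals of R[i]-valued functions are taken
   separately on the real and imaginary parts. *)

Definition expC (R : realType) (z : R[i]) : R[i] :=
  (expR (complex.Re z))%:C * (cos (complex.Im z) +i* sin (complex.Im z)).

Definition cvgC (R : realType) (f : R -> R[i]) (F : set_system R)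
    (l : R[i]) : Prop :=
  (complex.Re (f y) @[y --> F] --> complex.Re l) /\
  (complex.Im (f y) @[y --> F] --> complex.Im l).

Definition deriveC (R : realType) (u : R -> R[i]) : R -> R[i] :=
  fun y => derive1 (@complex.Re R \o u) y +i* derive1 (@complex.Im R \o u) y.

Definition integralC (R : realType) (D : set R) (f : R -> R[i]) : R[i] :=
  (\int[lebesgue_measure]_(y in D) complex.Re (f y)) +i*
  (\int[lebesgue_measure]_(y in D) complex.Im (f y)).

(* The space L_p(D, mu) of complex-valued functions. Measurability is with
   respect to the given sigma-algebra (Borel sets on R), i.e. elements of
   L_p are given by Borel representatives. *)
Definition in_Lp d (T : measurableType d) (R : realType)
    (mu : {measure set T -> \bar R}) (p : \bar R) (D : set T)
    (f : T -> R[i]) : Prop :=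
  [/\ measurable_fun D (@complex.Re R \o f),
      measurable_fun D (@complex.Im R \o f) &
      finite_norm mu p ((fun y => Normc.normc (f y)) \_ D)].

(* On a bounded open interval this is equivalent to having an absolutely
   continuous extension to the closed interval. *)
Definition abs_cont (R : realType) (A : set R) (f : R -> R[i]) : Prop :=
  forall eps : R, 0 < eps ->
  exists2 delta : R, 0 < delta &
    forall (n : nat) (s t : 'I_n -> R),
      (forall i, s i <= t i /\ `[s i, t i] `<=` A) ->
      classical_sets.trivIset setT (fun i => `]s i, t i[%classic) ->
      \sum_(i < n) (t i - s i) < delta ->
      \sum_(i < n) Normc.normc (f (t i) - f (s i)) < eps.

(* Values at the (finitely many) break points are unconstrained. *)
Definition piecewise_abs_cont (R : realType) (a b : R) (f : R -> R[i]) : Prop :=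
  exists (m : nat) (t : nat -> R),
    [/\ t 0%N = a, t m = b &
        forall i, (i < m)%N -> t i < t i.+1 /\ abs_cont `]t i, t i.+1[ f].

(* C_c^infty(a, b) *)
Definition test_function (R : realType) (a b : R) (phi : R -> R) : Prop :=
  (forall (n : nat) (y : R), derivable (derive1n n phi) y 1) /\
  exists c d : R, [/\ a < c, d < b & forall y, phi y != 0 -> c <= y <= d].

Definition weak_derivative (R : realType) (n : nat) (a b : R)
    (u v : R -> R[i]) : Prop :=
  forall phi : R -> R, test_function a b phi ->
    integralC `]a, b[ (fun y => u y * (derive1n n phi y)%:C) =
    (-1) ^+ n * integralC `]a, b[ (fun y => v y * (phi y)%:C).

Definition in_L2 (R : realType) (a b : R) (f : R -> R[i]) : Prop :=
  in_Lp lebesgue_measure 2%:E `]a, b[ f.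

(* The Sobolev space H^2(a, b) = W^{2,2}(a, b). *)
Definition in_H2 (R : realType) (a b : R) (u : R -> R[i]) : Prop :=
  in_L2 a b u /\
  exists u1 u2 : R -> R[i],
    [/\ in_L2 a b u1, in_L2 a b u2,
        weak_derivative 1 a b u u1 & weak_derivative 2 a b u u2].

(* The domain D_2. The nodes are x 0 < x 1 < ... < x N < x N.+1. A
   continuous function in H^2(x k, x k.+1) is C^1 there and its derivative
   has limits at both ends, so u'(x k +) and u'(x k -) are limits of the
   classical derivative. *)
Definition D2 (R : realType) (b : R) (N : nat) (x : nat -> R)
    (alpha : nat -> R[i]) (u : R -> R[i]) : Prop :=
  [/\ abs_cont `[0, b] u,
      (forall k, (k <= N)%N -> in_H2 (x k) (x k.+1) u) &
      (forall k, (0 < k <= N)%N -> exists dplus dminus : R[i],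
         [/\ cvgC (deriveC u) ((x k)^'+) dplus,
             cvgC (deriveC u) ((x k)^'-) dminus &
             dplus - dminus = alpha k * u (x k)])].

(* L_{q, I_N} u = lambda u on (0, b), with u2 = u'' the weak second
   derivative of u on (x k, x k.+1). *)
Definition is_solution (R : realType) (b : R) (q : R -> R[i]) (N : nat)
    (x : nat -> R) (alpha : nat -> R[i]) (lambda : R[i]) (u : R -> R[i]) : Prop :=
  D2 b N x alpha u /\
  forall k, (k <= N)%N -> exists u2 : R -> R[i],
    [/\ in_L2 (x k) (x k.+1) u2,
        weak_derivative 2 (x k) (x k.+1) u u2 &
        {ae lebesgue_measure, forall y : R, y \in `]x k, x k.+1[ ->
           - u2 y + q y * u y = lambda * u y}].

(* Main.v *)
Require Import Defs.
From HB Require Import structures.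
From mathcomp Require Import all_boot all_order all_algebra.
From mathcomp Require Import all_classical all_reals all_analysis.
From mathcomp Require Import measurable_realfun ess_sup_inf complex.
From mathcomp Require Import ring lra.

(** A solution of the equation is a solution of a Volterra equation in which
    the potential is a measure, and its representation is the exponential
    transform of the Volterra series of that equation.

    Put c = i rho, so that c^2 = - rho^2. Let m be Lebesgue measure plus a unit
    mass at each of x_0 = 0, x_1, ..., x_N, and let Q be the density equal to q
    on (0, b) off the nodes, to alpha_k at x_k and to h at x_0: the summand h of
    the initial slope acts as a point interaction at the origin. Two forms of
    the same Volterra equation are used,
      e(y) = exp(c y) + int_{s < y} S(y - s) Q(s) e(s) dm(s),
      e(y) = 1 + c y + int (y - s)_+ Q(s) e(s) dm(s)
               + c^2 int_0^y (y - r) e(r) dr,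
    where S(z) = sinh(c z) / c.

    Existence. For z > 0 one has S(z) = int W(z, t) exp(c t) dt, where W(z, .) is
    1/2 on (-z, z) and 0 elsewhere: this is d'Alembert's formula, and W does not
    involve rho. Hence exp(c y) + int K(y, t) exp(c t) dt solves the first form
    as soon as
      K(y, t) = int Q(s) [W(y - s, t - s)
                            + int W(y - s, t - u) K(s, u) du] dm(s).
    The right-hand side contracts by 1/2 a sup norm with weight w(y), where
    b int_{s < y} |Q| w dm <= w(y) / 2 ([weight_exists]). So there is a bounded
    measurable K supported in |t| < y ([kernel_exists]); its transform [eker]
    satisfies the first form ([eker_sinhq]) and, after two integrations, the
    second ([eker_ramp]).

    Uniqueness. The given solutions are only weak solutions between the nodes.
    Testing the weak second derivative against smoothed second differences of
    ramps shows that u and the double integral of (q - lambda) u have the same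
    second differences ([three_point]), hence differ by an affine function
    between consecutive nodes; the jump conditions make these affine pieces
    agree once the ramps alpha_k u(x_k) (y - x_k)_+ are subtracted
    ([ramp_representation]). So u satisfies the second form too
    ([solution_ramp]), and the difference of two bounded functions that satisfy
    it vanishes by the weighted contraction again ([gronwall],
    [solution_eq_eker]).

    Regularity. For fixed y the wave term of K(y, t) is half the integral of Q
    over s < (y + t) / 2, and the other term is Lipschitz in t. So K(y, .) can jump
    only where (y + t) / 2 is a node, and is absolutely continuous between such
    points because q is in L_2 ([kernel_piecewise_ac]). The remaining claims
    follow from the boundedness of K. *)

Set Implicit Arguments.
Unset Strict Implicit.
Unset Printing Implicit Defensive.
Import Order.TTheory GRing.Theory Num.Theory.
Import numFieldNormedType.Exports.
Local Open Scope classical_set_scope.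
Local Open Scope ring_scope.
Local Open Scope complex_scope.
Local Notation leb := (@lebesgue_measure _).

(** * Complex-valued measurable functions and their integrals *)

(** Equivalent to the modulus, and preferred to it because bounds on [norm1]
    pass through integrals part by part and it is submultiplicative, so
    estimates avoid square roots. *)
Definition norm1 (R : realType) (z : R[i]) : R :=
  `|complex.Re z| + `|complex.Im z|.

(** Functions are taken on the whole type, restricted by [if] where needed:
    integrals over varying intervals then become integrals over one domain,
    to which Fubini and domination apply directly. *)
Definition mfunC d (T : measurableType d) (R : realType) (f : T -> R[i]) :=
  measurable_fun setT (fun x => complex.Re (f x)) /\
  measurable_fun setT (fun x => complex.Im (f x)).

Notation itg mu r := (mu.-integrable setT (EFin \o r)).

Definition itgC d (T : measurableType d) (R : realType)
    (mu : {measure set T -> \bar R}) (f : T -> R[i]) :=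
  itg mu (fun x => complex.Re (f x)) /\ itg mu (fun x => complex.Im (f x)).

Definition intC d (T : measurableType d) (R : realType)
    (mu : {measure set T -> \bar R}) (f : T -> R[i]) : R[i] :=
  (\int[mu]_x complex.Re (f x)) +i* (\int[mu]_x complex.Im (f x)).

Section ComplexParts.
Variable R : realType.
Implicit Types (z w : R[i]) (r : R).

Lemma RecM z w : complex.Re (z * w) =
  complex.Re z * complex.Re w - complex.Im z * complex.Im w.
Proof. by case: z => a b; case: w. Qed.

Lemma ImcM z w : complex.Im (z * w) =
  complex.Re z * complex.Im w + complex.Im z * complex.Re w.
Proof. by case: z => a b; case: w. Qed.

Lemma RecD z w : complex.Re (z + w) = complex.Re z + complex.Re w.
Proof. by case: z => a b; case: w. Qed.

Lemma ImcD z w : complex.Im (z + w) = complex.Im z + complex.Im w.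
Proof. by case: z => a b; case: w. Qed.

Lemma RecN z : complex.Re (- z) = - complex.Re z.
Proof. by case: z. Qed.

Lemma ImcN z : complex.Im (- z) = - complex.Im z.
Proof. by case: z. Qed.

Lemma RecC r : complex.Re r%:C = r. Proof. by []. Qed.
Lemma ImcC r : complex.Im r%:C = 0. Proof. by []. Qed.

Definition reimE := (RecM, ImcM, RecD, ImcD, RecN, ImcN, RecC, ImcC).

Lemma complex_ext z w :
  complex.Re z = complex.Re w -> complex.Im z = complex.Im w -> z = w.
Proof. by case: z => a b; case: w => c d /= -> ->. Qed.

Lemma norm1_ge0 z : 0 <= norm1 z.
Proof. by rewrite addr_ge0. Qed.

Lemma norm1_0 : norm1 (0 : R[i]) = 0.
Proof. by rewrite /norm1 /= normr0 addr0. Qed.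

Lemma norm1_eq0 z : norm1 z <= 0 -> z = 0.
Proof.
rewrite /norm1 => h; apply: complex_ext => /=; apply/eqP; rewrite -normr_le0;
  by apply: le_trans h; rewrite ?lerDl ?lerDr.
Qed.

Lemma norm1D z w : norm1 (z + w) <= norm1 z + norm1 w.
Proof.
rewrite /norm1 !reimE.
have h1 := ler_normD (complex.Re z) (complex.Re w).
have h2 := ler_normD (complex.Im z) (complex.Im w).
by lra.
Qed.

Lemma norm1N z : norm1 (- z) = norm1 z.
Proof. by rewrite /norm1 !reimE !normrN. Qed.

Lemma norm1B z w : norm1 (z - w) <= norm1 z + norm1 w.
Proof. by rewrite (le_trans (norm1D _ _))// norm1N. Qed.

Lemma norm1M z w : norm1 (z * w) <= norm1 z * norm1 w.
Proof.
rewrite /norm1 !reimE.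
have h1 := ler_normB (complex.Re z * complex.Re w) (complex.Im z * complex.Im w).
have h2 := ler_normD (complex.Re z * complex.Im w) (complex.Im z * complex.Re w).
move: h1 h2; rewrite !normrM => h1 h2.
have -> : (`|complex.Re z| + `|complex.Im z|) * (`|complex.Re w| + `|complex.Im w|)
  = (`|complex.Re z| * `|complex.Re w| + `|complex.Im z| * `|complex.Im w|) +
    (`|complex.Re z| * `|complex.Im w| + `|complex.Im z| * `|complex.Re w|) by ring.
exact: lerD.
Qed.

Lemma norm1C r : norm1 r%:C = `|r|.
Proof. by rewrite /norm1 /= normr0 addr0. Qed.

Lemma norm1MC r z : norm1 (r%:C * z) = `|r| * norm1 z.
Proof. by rewrite /norm1 !reimE !mul0r subr0 addr0 !normrM mulrDr. Qed.

Lemma Re_norm1 z : `|complex.Re z| <= norm1 z.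
Proof. by rewrite lerDl. Qed.
Lemma Im_norm1 z : `|complex.Im z| <= norm1 z.
Proof. by rewrite lerDr. Qed.

Lemma normc_norm1 z : Normc.normc z <= norm1 z.
Proof.
case: z => a b; rewrite /norm1 /=.
have -> : `|a| + `|b| = Num.sqrt ((`|a| + `|b|) ^+ 2).
  by rewrite sqrtr_sqr [RHS]ger0_norm// addr_ge0.
apply: ler_wsqrtr.
rewrite -(real_normK (num_real a)) -(real_normK (num_real b)).
by have := normr_ge0 a; have := normr_ge0 b; nra.
Qed.

Lemma norm1_normc z : norm1 z <= 2 * Normc.normc z.
Proof.
case: z => a b; rewrite /norm1 /=.
have h (c d : R) : `|c| <= Num.sqrt (c ^+ 2 + d ^+ 2).
  by rewrite -sqrtr_sqr; apply: ler_wsqrtr; rewrite lerDl sqr_ge0.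
have h1 := h a b; have h2 := h b a; rewrite addrC in h2.
by lra.
Qed.

Lemma young (k a c : R) : 0 < k -> a * c <= k / 2 * a ^+ 2 + k^-1 / 2 * c ^+ 2.
Proof.
move=> k0; rewrite -subr_ge0.
have -> : k / 2 * a ^+ 2 + k^-1 / 2 * c ^+ 2 - a * c = k^-1 / 2 * (k * a - c) ^+ 2.
  by field; exact: lt0r_neq0.
by rewrite mulr_ge0 ?sqr_ge0// divr_ge0// invr_ge0 ltW.
Qed.

End ComplexParts.

Section MeasC.
Variable R : realType.
Section one.
Context d (T : measurableType d).
Implicit Types (f g : T -> R[i]).

Lemma mfunC_cst (z : R[i]) : mfunC (fun _ : T => z).
Proof. by split; exact: measurable_cst. Qed.

Lemma mfunCD f g : mfunC f -> mfunC g -> mfunC (fun x => f x + g x).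
Proof.
move=> [f1 f2] [g1 g2]; split; under eq_fun do rewrite !reimE;
  exact: measurable_funD.
Qed.

Lemma mfunCN f : mfunC f -> mfunC (fun x => - f x).
Proof.
move=> [f1 f2]; split; under eq_fun do rewrite !reimE; exact: measurableT_comp.
Qed.

Lemma mfunCB f g : mfunC f -> mfunC g -> mfunC (fun x => f x - g x).
Proof. by move=> mf mg; apply: mfunCD => //; exact: mfunCN. Qed.

Lemma mfunCM f g : mfunC f -> mfunC g -> mfunC (fun x => f x * g x).
Proof.
move=> [f1 f2] [g1 g2]; split; under eq_fun do rewrite !reimE.
  by apply: measurable_funB; exact: measurable_funM.
by apply: measurable_funD; exact: measurable_funM.
Qed.

Lemma mfunC_real (r : T -> R) : measurable_fun setT r ->
  mfunC (fun x => (r x)%:C).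
Proof. by move=> mr; split => //=; exact: measurable_cst. Qed.

Lemma mfunC_if (p : T -> bool) f g : measurable_fun setT p ->
  mfunC f -> mfunC g -> mfunC (fun x => if p x then f x else g x).
Proof.
move=> mp [f1 f2] [g1 g2]; split.
  rewrite (_ : (fun x => _) = (fun x => if p x then complex.Re (f x) else complex.Re (g x))).
    exact: measurable_fun_ifT.
  by apply/funext => x; case: (p x).
rewrite (_ : (fun x => _) = (fun x => if p x then complex.Im (f x) else complex.Im (g x))).
  exact: measurable_fun_ifT.
by apply/funext => x; case: (p x).
Qed.

Lemma mfunC_norm1 f : mfunC f -> measurable_fun setT (fun x => norm1 (f x)).
Proof.
by move=> [f1 f2]; apply: measurable_funD; exact: measurableT_comp.
Qed.
End one.

Lemma mfunC_comp d d' (T : measurableType d) (T' : measurableType d')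
    (f : T -> R[i]) (h : T' -> T) :
  mfunC f -> measurable_fun setT h -> mfunC (fun x => f (h x)).
Proof.
by move=> [f1 f2] mh; split; [exact: (measurableT_comp f1 mh)|
  exact: (measurableT_comp f2 mh)].
Qed.
End MeasC.

Section IntC.
Variable R : realType.
Context d (T : measurableType d) (mu : {measure set T -> \bar R}).
Implicit Types (f g : T -> R[i]) (r : T -> R).

Lemma le_itg r (s : T -> R) : measurable_fun setT r ->
  (forall x, `|r x| <= s x) -> itg mu s -> itg mu r.
Proof.
move=> mr rs; apply: le_integrable; first exact: measurableT.
  exact/measurable_EFinP.
by move=> x _; rewrite !abse_EFin lee_fin (le_trans (rs x))// ler_norm.
Qed.

Lemma itg_meas r : itg mu r -> measurable_fun setT r.
Proof. by move=> /integrableP[/measurable_EFinP]. Qed.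

Lemma itg_fin_num r : itg mu r -> (\int[mu]_x (r x)%:E)%E \is a fin_num.
Proof. by move=> h; have := integrable_fin_num measurableT h. Qed.

Lemma itgC_meas f : itgC mu f -> mfunC f.
Proof. by move=> [h1 h2]; split; exact: itg_meas. Qed.

Lemma itgD r (s : T -> R) : itg mu r -> itg mu s -> itg mu (fun x => r x + s x).
Proof. by move=> h1 h2; have := integrableD measurableT h1 h2. Qed.

Lemma itgB r (s : T -> R) : itg mu r -> itg mu s -> itg mu (fun x => r x - s x).
Proof. by move=> h1 h2; have := integrableB measurableT h1 h2. Qed.

Lemma itgZ (c : R) r : itg mu r -> itg mu (fun x => c * r x).
Proof. by move=> h; have := integrableZl measurableT c h. Qed.

Lemma itg_norm r : itg mu r -> itg mu (fun x => `|r x|).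
Proof. exact: integrable_norm. Qed.

Lemma itgC_dom f r : mfunC f -> itg mu r -> (forall x, norm1 (f x) <= r x) ->
  itgC mu f.
Proof.
move=> [f1 f2] ir h; split; apply: le_itg ir => // x;
  by rewrite (le_trans _ (h x))// ?Re_norm1 ?Im_norm1.
Qed.

Lemma itgC_norm1 f : itgC mu f -> itg mu (fun x => norm1 (f x)).
Proof. by move=> [h1 h2]; apply: itgD; exact: itg_norm. Qed.

Lemma itgCD f g : itgC mu f -> itgC mu g -> itgC mu (fun x => f x + g x).
Proof.
by move=> [f1 f2] [g1 g2]; split; under eq_fun do rewrite reimE /=;
  exact: itgD.
Qed.

Lemma itgCB f g : itgC mu f -> itgC mu g -> itgC mu (fun x => f x - g x).
Proof.
by move=> [f1 f2] [g1 g2]; split; under eq_fun do rewrite !reimE;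
  exact: itgB.
Qed.

Lemma itgCZ (c : R[i]) f : itgC mu f -> itgC mu (fun x => c * f x).
Proof.
move=> [f1 f2]; split; under eq_fun do rewrite reimE.
  by apply: itgB; exact: itgZ.
by apply: itgD; exact: itgZ.
Qed.

Lemma intCD f g : itgC mu f -> itgC mu g ->
  intC mu (fun x => f x + g x) = intC mu f + intC mu g.
Proof.
move=> [f1 f2] [g1 g2]; apply: complex_ext; rewrite !reimE /=.
  by under [LHS]eq_Rintegral do rewrite reimE; rewrite RintegralD.
by under [LHS]eq_Rintegral do rewrite reimE; rewrite RintegralD.
Qed.

Lemma intCZ (c : R[i]) f : itgC mu f ->
  intC mu (fun x => c * f x) = c * intC mu f.
Proof.
move=> [f1 f2]; apply: complex_ext; rewrite !reimE /=.
  under [LHS]eq_Rintegral do rewrite reimE.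
  by rewrite RintegralB ?RintegralZl//; exact: itgZ.
under [LHS]eq_Rintegral do rewrite reimE.
by rewrite RintegralD ?RintegralZl//; exact: itgZ.
Qed.

Lemma intCB f g : itgC mu f -> itgC mu g ->
  intC mu (fun x => f x - g x) = intC mu f - intC mu g.
Proof.
move=> [f1 f2] [g1 g2]; apply: complex_ext; rewrite !reimE /=.
  by under [LHS]eq_Rintegral do rewrite !reimE; rewrite RintegralB.
by under [LHS]eq_Rintegral do rewrite !reimE; rewrite RintegralB.
Qed.

Lemma intC0 : intC mu (fun _ => 0) = 0.
Proof. by rewrite /intC /Rintegral /= integral0. Qed.

(** The constant is 1 (and not 2) for a complex integral, because the
    [norm1] of the integrand splits as the sum of the two parts. *)
Lemma norm1_intC f r : itgC mu f -> itg mu r ->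
  (forall x, norm1 (f x) <= r x) -> norm1 (intC mu f) <= \int[mu]_x r x.
Proof.
move=> [f1 f2] ir h; rewrite /norm1 /intC /=.
have h1 := le_normr_Rintegral measurableT f1.
have h2 := le_normr_Rintegral measurableT f2.
apply: (le_trans (lerD h1 h2)).
rewrite -RintegralD//; try exact: itg_norm.
apply: le_Rintegral => [//||//|x _]; last exact: h.
by apply: itgD; exact: itg_norm.
Qed.
End IntC.

Section FubiniC.
Variable R : realType.
Context d1 d2 (T1 : measurableType d1) (T2 : measurableType d2).
Variables (m1 : {sigma_finite_measure set T1 -> \bar R})
  (m2 : {sigma_finite_measure set T2 -> \bar R}).

Lemma measurable_int_param (F : T1 * T2 -> R) : measurable_fun setT F ->
  measurable_fun setT (fun x => \int[m2]_y F (x, y)).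
Proof.
move=> mF; rewrite /Rintegral.
apply: (measurableT_comp (f := fine)) => //.
have mEF : measurable_fun setT (EFin \o F) by exact/measurable_EFinP.
have pF := @measurable_fun_fubini_tonelli_F _ _ _ _ _ m2 _ (measurable_funepos mEF)
  (funepos_ge0 _).
have nF := @measurable_fun_fubini_tonelli_F _ _ _ _ _ m2 _ (measurable_funeneg mEF)
  (funeneg_ge0 _).
move: (emeasurable_funB pF nF); congr (measurable_fun _ _).
apply/funext => x /=; rewrite integralE /fubini_F; congr (_ - _)%E;
  by apply: eq_integral => y _; rewrite ?funeposE ?funenegE.
Qed.

Lemma mfunC_intC (F : T1 * T2 -> R[i]) : mfunC F ->
  mfunC (fun x => intC m2 (fun y => F (x, y))).
Proof.
by move=> [F1 F2]; split; exact: (measurable_int_param (F := fun p => _ (F p))).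
Qed.

Lemma itg_prod (g1 : T1 -> R) (g2 : T2 -> R) :
  itg m1 g1 -> itg m2 g2 -> (forall x, 0 <= g1 x) -> (forall x, 0 <= g2 x) ->
  (m1 \x m2)%E.-integrable setT (fun p : T1 * T2 => (g1 p.1 * g2 p.2)%:E).
Proof.
move=> i1 i2 p1 p2.
apply/integrable12ltyP.
  apply/measurable_EFinP; apply: measurable_funM.
    exact: (measurableT_comp (itg_meas i1) measurable_fst).
  exact: (measurableT_comp (itg_meas i2) measurable_snd).
have -> : (\int[m1]_x \int[m2]_y `|(g1 x * g2 y)%:E| =
    \int[m1]_x ((g1 x)%:E * (\int[m2]_y g2 y)%R%:E))%E.
  apply: eq_integral => x _.
  rewrite /Rintegral fineK; last by have := itg_fin_num i2.
  rewrite -integralZl//; apply: eq_integral => y _ /=.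
  by rewrite ger0_norm ?EFinM// mulr_ge0.
rewrite integralZr// -(fineK (itg_fin_num i1)) -EFinM.
exact: ltry.
Qed.

(** A product majorant is what all uses provide: an integrable function of the
    potential variable times a bounded function of compact support. *)
Lemma Fubini_dom (F : T1 * T2 -> R) (g1 : T1 -> R) (g2 : T2 -> R) :
  measurable_fun setT F -> itg m1 g1 -> itg m2 g2 ->
  (forall x, 0 <= g1 x) -> (forall x, 0 <= g2 x) ->
  (forall x y, `|F (x, y)| <= g1 x * g2 y) ->
  \int[m1]_x (\int[m2]_y F (x, y)) = \int[m2]_y (\int[m1]_x F (x, y)).
Proof.
move=> mF i1 i2 p1 p2 h.
have iF : (m1 \x m2)%E.-integrable setT (fun p => (F p)%:E).
  apply: le_integrable (itg_prod i1 i2 p1 p2) => //.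
    exact/measurable_EFinP.
  by move=> [x y] _; rewrite !abse_EFin lee_fin (le_trans (h x y))// ler_norm.
have := Fubini iF.
rewrite /Rintegral => H.
congr fine.
rewrite (_ : (\int[m1]_x _)%E = (\int[m1]_x \int[m2]_y (F (x, y))%:E)%E).
  rewrite H; apply: eq_integral => y _; rewrite fineK//.
  apply: itg_fin_num.
  apply: (le_itg (s := fun x => g2 y * g1 x)).
  - exact: (measurableT_comp mF (pair2_measurable y)).
  - by move=> x; rewrite mulrC.
  - exact: itgZ.
apply: eq_integral => x _; rewrite fineK//.
apply: itg_fin_num.
apply: (le_itg (s := fun y => g1 x * g2 y)).
- exact: (measurableT_comp mF (pair1_measurable x)).
- by [].
- exact: itgZ.
Qed.

Lemma FubiniC (F : T1 * T2 -> R[i]) (g1 : T1 -> R) (g2 : T2 -> R) :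
  mfunC F -> itg m1 g1 -> itg m2 g2 ->
  (forall x, 0 <= g1 x) -> (forall x, 0 <= g2 x) ->
  (forall x y, norm1 (F (x, y)) <= g1 x * g2 y) ->
  intC m1 (fun x => intC m2 (fun y => F (x, y))) =
  intC m2 (fun y => intC m1 (fun x => F (x, y))).
Proof.
move=> [F1 F2] i1 i2 p1 p2 h; apply: complex_ext => /=.
  apply: (Fubini_dom F1 i1 i2) => // x y.
  by rewrite (le_trans (Re_norm1 _)).
apply: (Fubini_dom F2 i1 i2) => // x y.
by rewrite (le_trans (Im_norm1 _)).
Qed.
End FubiniC.

(** * The complex exponential and the fundamental theorem of calculus *)

Section expC.
Variable R : realType.
Implicit Types (c z w : R[i]) (t : R).

Definition isderC (F f : R -> R[i]) := forall t,
  is_derive t 1 (fun t => complex.Re (F t)) (complex.Re (f t)) /\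
  is_derive t 1 (fun t => complex.Im (F t)) (complex.Im (f t)).

Lemma expCD z w : expC (z + w) = expC z * expC w.
Proof.
apply: complex_ext; rewrite /expC !reimE expRD /= cosD sinD; ring.
Qed.

Lemma expC0 : expC (0 : R[i]) = 1.
Proof. by rewrite /expC /= expR0 cos0 sin0 mul1r. Qed.

Lemma is_derive_val (f : R -> R) t (a b : R) :
  is_derive t 1 f a -> a = b -> is_derive t 1 f b.
Proof. by move=> h <-. Qed.

Lemma is_derive_mul (f g : R -> R) t (f' g' : R) : is_derive t 1 f f' ->
  is_derive t 1 g g' -> is_derive t 1 (fun t => f t * g t) (f' * g t + f t * g').
Proof.
move=> hf hg; have := is_deriveM hf hg; move=> h; apply: is_derive_val h _.
by rewrite /GRing.scale /=; ring.
Qed.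

Lemma is_derive_add (f g : R -> R) t (f' g' : R) : is_derive t 1 f f' ->
  is_derive t 1 g g' -> is_derive t 1 (fun t => f t + g t) (f' + g').
Proof. by move=> hf hg; exact: is_deriveD. Qed.

Lemma is_derive_sub (f g : R -> R) t (f' g' : R) : is_derive t 1 f f' ->
  is_derive t 1 g g' -> is_derive t 1 (fun t => f t - g t) (f' - g').
Proof. by move=> hf hg; exact: is_deriveB. Qed.

Lemma is_derive_compR (f g : R -> R) t (f' g' : R) : is_derive t 1 g g' ->
  is_derive (g t) 1 f f' -> is_derive t 1 (fun t => f (g t)) (f' * g').
Proof. by move=> hg hf; exact: (@is_derive1_comp R f g t f' g'). Qed.

Lemma is_derive_aff (a d t : R) : is_derive t 1 (fun t => a * t + d) a.
Proof.
have h := is_derive_add (is_derive_mul (is_derive_cst a t 1) (is_derive_id t 1))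
  (is_derive_cst d t 1).
by apply: is_derive_val h _ => /=; rewrite mul0r mulr1 add0r addr0.
Qed.

Lemma is_derive_lin (a t : R) : is_derive t 1 (fun t => a * t) a.
Proof.
have h := is_derive_mul (is_derive_cst a t 1) (is_derive_id t 1).
by apply: is_derive_val h _ => /=; rewrite mul0r mulr1 add0r.
Qed.

Lemma isderC_expC c : isderC (fun t => expC (c * t%:C)) (fun t => c * expC (c * t%:C)).
Proof.
have ReE (a b t : R) : complex.Re (expC ((a +i* b) * t%:C)) =
    expR (a * t) * cos (b * t).
  by rewrite /expC !reimE /= !mulr0 !mul0r !subr0 add0r.
have ImE (a b t : R) : complex.Im (expC ((a +i* b) * t%:C)) =
    expR (a * t) * sin (b * t).
  by rewrite /expC !reimE /= !mulr0 !mul0r !subr0 add0r addr0.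
move=> t; case: c => a b; rewrite (RecM (a +i* b)) (ImcM (a +i* b)) !ReE !ImE.
have hE := is_derive_compR (is_derive_lin a t) (is_derive_expR (a * t)).
split.
  rewrite (_ : (fun t => _) = (fun t => expR (a * t) * cos (b * t))); last first.
    by apply/funext => s; rewrite ReE.
  have hC := is_derive_compR (is_derive_lin b t) (is_derive_cos (b * t)).
  by apply: is_derive_val (is_derive_mul hE hC) _ => /=; ring.
rewrite (_ : (fun t => _) = (fun t => expR (a * t) * sin (b * t))); last first.
  by apply/funext => s; rewrite ImE.
have hC := is_derive_compR (is_derive_lin b t) (is_derive_sin (b * t)).
by apply: is_derive_val (is_derive_mul hE hC) _ => /=; ring.
Qed.

Lemma isderC_affine (a d : R[i]) : isderC (fun t => a * t%:C + d) (fun _ => a).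
Proof.
move=> t; case: a => a1 a2; case: d => d1 d2 /=; split.
  rewrite (_ : (fun t => _) = (fun t => a1 * t + d1)); last first.
    by apply/funext => s /=; rewrite mulr0 subr0.
  exact: is_derive_aff.
rewrite (_ : (fun t => _) = (fun t => a2 * t + d2)); last first.
  by apply/funext => s /=; rewrite mulr0 add0r.
exact: is_derive_aff.
Qed.

Lemma isderC_mul F f G g : isderC F f -> isderC G g ->
  isderC (fun t => F t * G t) (fun t => f t * G t + F t * g t).
Proof.
move=> hF hG t; have [F1 F2] := hF t; have [G1 G2] := hG t; split.
  rewrite (_ : (fun t => _) = (fun t => complex.Re (F t) * complex.Re (G t) -
     complex.Im (F t) * complex.Im (G t))); last first.
    by apply/funext => s; rewrite !reimE.
  apply: is_derive_val (is_derive_sub (is_derive_mul F1 G1) (is_derive_mul F2 G2)) _.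
  rewrite !reimE; ring.
rewrite (_ : (fun t => _) = (fun t => complex.Re (F t) * complex.Im (G t) +
     complex.Im (F t) * complex.Re (G t))); last first.
  by apply/funext => s; rewrite !reimE.
apply: is_derive_val (is_derive_add (is_derive_mul F1 G2) (is_derive_mul F2 G1)) _.
rewrite !reimE; ring.
Qed.

Lemma is_derive_continuous (f f' : R -> R) :
  (forall t, is_derive t 1 f (f' t)) -> continuous f.
Proof.
move=> h t; apply: differentiable_continuous; apply/derivable1_diffP.
by have := h t; case.
Qed.

Lemma isderC_continuous F f : isderC F f ->
  continuous (fun t => complex.Re (F t)) /\ continuous (fun t => complex.Im (F t)).
Proof.
by move=> h; split; apply: is_derive_continuous => t; have [] := h t.
Qed.

Lemma isderC_meas F f : isderC F f -> mfunC F.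
Proof.
by move=> /isderC_continuous[h1 h2]; split; exact: continuous_measurable_fun.
Qed.

Lemma Rint_if (a b : R) (f : R -> R) :
  \int[leb]_t (if a < t < b then f t else 0) = \int[leb]_(t in `]a, b[) f t.
Proof.
rewrite [RHS]Rintegral_mkcond; apply: eq_Rintegral => t _.
by rewrite patchE mem_setE in_itv.
Qed.

Lemma integrable_if (a b : R) (f : R -> R) : continuous f ->
  itg leb (fun t => if a < t < b then f t else 0).
Proof.
move=> cf.
have h : leb.-integrable `[a, b] (EFin \o f).
  apply: continuous_compact_integrable; first exact: segment_compact.
  exact: continuous_subspaceT.
have h2 : leb.-integrable `]a, b[ (EFin \o f).
  apply: integrableS h => //; exact: subset_itv_oo_cc.
have := (@integrable_mkcond _ _ _ leb `]a, b[%classic (EFin \o f) (measurable_itv _)).1 h2.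
apply: eq_integrable => // t _.
by rewrite patchE mem_setE in_itv /=; case: ifP.
Qed.

(** Stated for an integrand extended by zero, and through everywhere
    differentiable primitives, so that the one-sided conditions at the ends of
    the interval disappear. *)
Lemma FTC2R (a b : R) (F f : R -> R) : a <= b ->
  (forall t, is_derive t 1 F (f t)) -> continuous f ->
  \int[leb]_t (if a < t < b then f t else 0) = F b - F a.
Proof.
rewrite le_eqVlt => /predU1P[->|ab] hF cf.
  rewrite subrr /Rintegral integral0_eq// => t _.
  by case: ifP => // /andP[h1 h2]; have := lt_trans h1 h2; rewrite ltxx.
have hi : leb.-integrable `[a, b] (EFin \o f).
  apply: continuous_compact_integrable; first exact: segment_compact.
  exact: continuous_subspaceT.
rewrite Rint_if Rintegral_itv_obnd_cbnd; last first.
  by apply: integrableS hi => // t /=; rewrite !in_itv /= => /andP[h1 h2];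
    rewrite ?(ltW h1) ?h1 ?(ltW h2).
rewrite Rintegral_itv_bndo_bndc; last first.
  by apply: integrableS hi => // t /=; rewrite !in_itv /= => /andP[h1 h2];
    rewrite ?(ltW h1) ?h1 ?(ltW h2).
rewrite /Rintegral (continuous_FTC2 (F := F))//=.
- exact: continuous_subspaceT.
- have cF := is_derive_continuous hF; split.
  + by move=> t _; have [] := hF t.
  + exact: cvg_at_right_filter (cF a).
  + exact: cvg_at_left_filter (cF b).
- by move=> t _; rewrite derive1E; have [_ ->] := hF t.
Qed.

Lemma FTC2C (a b : R) (F f f' : R -> R[i]) : a <= b -> isderC F f ->
  isderC f f' ->
  intC leb (fun t => if a < t < b then f t else 0) = F b - F a.
Proof.
move=> ab hF /isderC_continuous[c1 c2].
have /= G := FTC2R ab (fun t => (hF t).1) c1.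
have /= H := FTC2R ab (fun t => (hF t).2) c2.
apply: complex_ext; rewrite !reimE /=.
  by rewrite -G; apply: eq_Rintegral => t _; case: ifP.
by rewrite -H; apply: eq_Rintegral => t _; case: ifP.
Qed.
End expC.

(** * The wave kernel and its exponential transform *)

Section Sfun.
Variable R : realType.
Implicit Types (c : R[i]) (t z s y : R).

(** The kernel of d'Alembert's formula: the wave equation with velocity datum g
    and zero displacement is solved by the convolution of g with [wave z]. *)
Definition wave z t : R := if - z < t < z then 2^-1 else 0.

(** The solution sinh(c z) / c of the equation f'' = c^2 f with f(0) = 0 and
    f'(0) = 1, continued by 0 to z <= 0 and to its limit z at c = 0. *)
Definition sinhq c z : R[i] := if z <= 0 then 0 else if c == 0 then z%:C
  else (expC (c * z%:C) - expC (- (c * z%:C))) / (2 * c).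

Lemma realCB (a b : R) : (a - b)%:C = a%:C - b%:C.
Proof. by apply: complex_ext => /=; rewrite ?subr0. Qed.
Lemma realCD (a b : R) : (a + b)%:C = a%:C + b%:C.
Proof. by apply: complex_ext => /=; rewrite ?addr0. Qed.
Lemma realC0 : (0 : R)%:C = 0. Proof. by []. Qed.
Lemma isderC_ext (F f g : R -> R[i]) : f =1 g -> isderC F f -> isderC F g.
Proof. by move=> /funext ->. Qed.

Lemma isderC_cst (k : R[i]) : isderC (fun _ => k) (fun _ => 0).
Proof. by move=> t; split; exact: is_derive_cst. Qed.

Lemma isderC_mull (k : R[i]) F f : isderC F f ->
  isderC (fun t => k * F t) (fun t => k * f t).
Proof.
move=> hF; apply: isderC_ext (isderC_mul (isderC_cst k) hF) => t.
by rewrite mul0r add0r.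
Qed.

(** The identity that removes rho from the kernel: [sinhq], which depends on
    c, is the transform of [wave], which does not. The factor [expC (c * s%:C)]
    is the effect of translating by s. *)
Lemma wave_exp c z s :
  intC leb (fun t => (wave z (t - s))%:C * expC (c * t%:C)) =
  expC (c * s%:C) * sinhq c z.
Proof.
have -> : (fun t => (wave z (t - s))%:C * expC (c * t%:C)) =
   (fun t => if s - z < t < s + z then 2^-1%:C * expC (c * t%:C) else 0).
  apply/funext => t; rewrite /wave.
  have -> : (- z < t - s < z) = (s - z < t < s + z).
    by apply/andP/andP => -[h1 h2]; split; lra.
  by case: ifP => _ //; rewrite realC0 mul0r.
rewrite /sinhq; case: (leP z 0) => z0.
  rewrite mulr0 (_ : (fun t => _) = fun=> 0) ?intC0//.
  apply/funext => t; case: ifP => // /andP[h1 h2]; exfalso.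
  by have := lt_trans h1 h2; lra.
have sz : s - z <= s + z by lra.
case: eqVneq => [->|c0].
  have hd := isderC_affine (2^-1%:C : R[i]) 0.
  rewrite (_ : (fun t => _) = (fun t => if s - z < t < s + z then 2^-1%:C else 0)).
    rewrite (FTC2C sz hd (@isderC_cst _)) mul0r expC0 mul1r !addr0.
    by rewrite !(realCB, realCD); apply: complex_ext; rewrite !reimE /= ; lra.
  by apply/funext => t; rewrite mul0r expC0 mulr1.
have hE := isderC_expC c.
have hd : isderC (fun t => (2 * c)^-1 * expC (c * t%:C))
    (fun t => 2^-1%:C * expC (c * t%:C)).
  apply: isderC_ext (isderC_mull _ hE) => t.
  rewrite mulrA; congr (_ * _).
  rewrite invfM -mulrA mulVf// mulr1.
  by apply: complex_ext => /=; rewrite ?expr0n /= ?addr0 ?mul0r ?oppr0 //; field.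
rewrite (FTC2C sz hd (isderC_mull _ hE)).
rewrite realCB realCD mulrBr mulrDr expCD expCD; ring.
Qed.

(** Taylor's formula with integral remainder for the exponential: integrating
    twice against the ramp recovers it up to its affine part. *)
Lemma exp_ramp c s y : s <= y ->
  intC leb (fun r => if s < r < y then
     c ^+ 2 * ((y - r)%:C * expC (c * (r - s)%:C)) else 0) =
  expC (c * (y - s)%:C) - c * (y - s)%:C - 1.
Proof.
move=> sy; pose k := expC (- (c * s%:C)).
have hE := isderC_mull k (isderC_expC c).
have h1 := isderC_mul (isderC_affine (- c) (c * y%:C + 1)) hE.
have h2 := isderC_mul (isderC_affine (- c ^+ 2) (c ^+ 2 * y%:C)) hE.
have -> : (fun r => if s < r < y then
     c ^+ 2 * ((y - r)%:C * expC (c * (r - s)%:C)) else 0) =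
  (fun r => if s < r < y then
     (- c ^+ 2 * r%:C + c ^+ 2 * y%:C) * (k * expC (c * r%:C)) else 0).
  apply/funext => r; case: ifP => // _; rewrite /k !realCB mulrBr expCD; ring.
have h3 : isderC
    (fun t => (- c * t%:C + (c * y%:C + 1)) * (k * expC (c * t%:C)))
    (fun r => (- c ^+ 2 * r%:C + c ^+ 2 * y%:C) * (k * expC (c * r%:C))).
  apply: isderC_ext h1 => t; ring.
rewrite (FTC2C sy h3 h2).
have ek r : k * expC (c * r%:C) = expC (c * (r - s)%:C).
  by rewrite /k realCB mulrBr expCD mulrC.
rewrite !ek subrr mulr0 expC0 realCB; ring.
Qed.

(** Taylor's formula for [sinhq], from that of the two exponentials of which
    it is the difference. *)
Lemma sinhq_ramp c s y : s <= y ->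
  c ^+ 2 * intC leb (fun r => if s < r < y then (y - r)%:C * sinhq c (r - s) else 0) =
  sinhq c (y - s) - (y - s)%:C.
Proof.
move=> sy.
have [->|c0] := eqVneq c 0.
  rewrite expr0n mul0r /sinhq eqxx; case: leP => h.
    have -> : y - s = 0 by lra.
    by rewrite subrr.
  by rewrite subrr.
have ex d : isderC (fun r => (- d ^+ 2 * r%:C + d ^+ 2 * y%:C) * (expC (- (d * s%:C)) * expC (d * r%:C)))
  _ := isderC_mul (isderC_affine (- d ^+ 2) (d ^+ 2 * y%:C)) (isderC_mull _ (isderC_expC d)).
have it d : itgC leb (fun r => if s < r < y then
     d ^+ 2 * ((y - r)%:C * expC (d * (r - s)%:C)) else 0).
  have [c1 c2] := isderC_continuous (ex d).
  have fE r : - d ^+ 2 * r%:C + d ^+ 2 * y%:C = d ^+ 2 * (y - r)%:C.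
    by rewrite realCB; ring.
  have gE r : expC (- (d * s%:C)) * expC (d * r%:C) = expC (d * (r - s)%:C).
    by rewrite -expCD realCB; congr expC; ring.
  split; [have := integrable_if s y c1|have := integrable_if s y c2];
    apply: eq_integrable => // r _ /=; congr _%:E; case: ifP => // _;
    by rewrite fE gE mulrA.
(* The affine parts of the two Taylor formulas differ by 2 c (y - s). *)
have e1 := exp_ramp c sy; have e2 := exp_ramp (- c) sy.
rewrite sqrrN in e2.
have itm := it (- c); rewrite sqrrN in itm.
have := intCZ ((2 * c)^-1) (itgCB (it c) itm).
rewrite intCB// e1 e2 => H.
transitivity (intC leb (fun r => (2 * c)^-1 *
  ((if s < r < y then c ^+ 2 * ((y - r)%:C * expC (c * (r - s)%:C)) else 0) -
   (if s < r < y then c ^+ 2 * ((y - r)%:C * expC (- c * (r - s)%:C)) else 0)))).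
  have ic : itgC leb (fun r => if s < r < y then (y - r)%:C * sinhq c (r - s) else 0).
    have := itgCZ (c ^- 2 * (2 * c)^-1) (itgCB (it c) itm).
    congr itgC; apply/funext => r; case: ifP => [/andP[h1 h2]|_]; last by rewrite subr0 mulr0.
    rewrite /sinhq (negbTE c0) leNgt subr_gt0 h1 /= mulNr.
    field. exact: c0.
  rewrite -intCZ//; congr intC; apply/funext => r.
  case: ifP => [/andP[h1 h2]|_]; last by rewrite subr0 !mulr0.
  rewrite /sinhq (negbTE c0) leNgt subr_gt0 h1 /= mulNr.
  field. exact: c0.
rewrite H /sinhq (negbTE c0); case: leP => h.
  have -> : y - s = 0 by lra.
  by rewrite !mulr0 !expC0; field.
by rewrite mulNr; field.
Qed.

Lemma mfunC_expC c : mfunC (fun t => expC (c * t%:C)).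
Proof. exact: isderC_meas (isderC_expC c). Qed.

Lemma norm1_expC c t (B : R) : `|t| <= B ->
  norm1 (expC (c * t%:C)) <= 2 * expR (`|complex.Re c| * B).
Proof.
move=> tB; rewrite /norm1 /expC !reimE /= !mulr0 !mul0r !subr0 addr0 !normrM.
rewrite ?add0r -mulrDr [leLHS]mulrC; apply: ler_pM.
- by rewrite addr_ge0.
- by [].
- set x := (complex.Im c * t).
  have : `|cos x| <= 1 by rewrite ler_norml cos_geN1 cos_le1.
  have : `|sin x| <= 1 by rewrite ler_norml sin_geN1 sin_le1.
  by lra.
- rewrite ger0_norm ?expR_ge0// ler_expR.
  by rewrite (le_trans (ler_norm _))// normrM ler_wpM2l.
Qed.

Lemma mfunC_sinhq c : mfunC (sinhq c).
Proof.
apply: mfunC_if; first exact: measurable_fun_ler.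
  exact: mfunC_cst.
case: eqVneq => _.
  by apply: mfunC_real; exact: measurable_id.
apply: mfunCM; last exact: mfunC_cst.
apply: mfunCB; first exact: mfunC_expC.
by have := mfunC_expC (- c); congr mfunC; apply/funext => t; rewrite mulNr.
Qed.

Lemma norm1_sinhq c (B : R) : exists2 M : R, 0 <= M &
  forall z, z <= B -> norm1 (sinhq c z) <= M.
Proof.
pose e := 2 * expR (`|complex.Re c| * `|B|).
have e0 : 0 <= e by rewrite mulr_ge0// expR_ge0.
exists (`|B| + (e + e) * norm1 (2 * c)^-1).
  by rewrite addr_ge0// mulr_ge0 ?addr_ge0// norm1_ge0.
move=> z zB; rewrite /sinhq; case: (leP z 0) => z0.
  by rewrite norm1_0 addr_ge0// mulr_ge0 ?addr_ge0// norm1_ge0.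
have zB' : `|z| <= `|B| by rewrite gtr0_norm// (le_trans zB)// ler_norm.
case: eqVneq => _.
  by rewrite norm1C (le_trans zB')// lerDl mulr_ge0 ?addr_ge0// norm1_ge0.
apply: ler_wpDl => //.
have h1 := norm1_expC c zB'.
have := norm1_expC (- c) zB'; rewrite RecN normrN mulNr => h2.
apply: (le_trans (norm1M _ _)); apply: ler_wpM2r; first exact: norm1_ge0.
by apply: (le_trans (norm1B _ _)); exact: lerD.
Qed.
End Sfun.

(** * A fixed point theorem for a weighted sup norm *)

Section fixpoint.
Variable R : realType.

Lemma geometric_small (x c : R) : (forall n, x <= c * 2^-1 ^+ n) -> x <= 0.
Proof.
move=> h.
have : c * 2^-1 ^+ n @[n --> \oo] --> (c * 0 : R).
  by apply: cvgMr; apply: cvg_expr; rewrite ger0_norm; lra.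
rewrite mulr0 => hc; rewrite -(cvg_lim _ hc)//; apply: limr_ge.
  exact: (cvgP _ hc).
exact: nearW.
Qed.

Lemma geometric_cvg (u : nat -> R) (C : R) :
  (forall n, `|u n.+1 - u n| <= C * 2^-1 ^+ n) ->
  exists l, u n @[n --> \oo] --> l /\
    forall n, `|l - u n| <= 2 * C * 2^-1 ^+ n.
Proof.
move=> h.
have C0 : 0 <= C by have := le_trans (normr_ge0 _) (h 0%N); rewrite expr0 mulr1.
pose v n := u n + 2 * C * 2^-1 ^+ n.
have h0 n : 0 <= C * 2^-1 ^+ n :> R by rewrite mulr_ge0// exprn_ge0.
have bnd n k : `|u (n + k)%N - u n| <= 2 * C * 2^-1 ^+ n - 2 * C * 2^-1 ^+ (n + k).
  elim: k => [|k IH]; first by rewrite addn0 !subrr normr0.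
  have := h (n + k)%N; rewrite addnS exprS.
  move: IH; rewrite !ler_norml => /andP[a1 a2] /andP[b1 b2].
  by apply/andP; split; lra.
have vd : {homo v : n m / (n <= m)%N >-> m <= n}.
  move=> n m /subnK <-; rewrite addnC.
  by have := bnd n (m - n)%N; rewrite ler_norml /v => /andP[_]; lra.
have vlb : has_lbound (range v).
  exists (u 0%N - 2 * C) => _ [n _ <-].
  have := bnd 0%N n; rewrite add0n expr0 mulr1 ler_norml /v => /andP[+ _].
  by have := h0 n; lra.
have vc := nonincreasing_is_cvgn vd vlb.
have e0 : 2 * C * 2^-1 ^+ n @[n --> \oo] --> (2 * C * 0 : R).
  by apply: cvgMr; apply: cvg_expr; rewrite ger0_norm; lra.
exists (limn v).
have uc : u n @[n --> \oo] --> limn v.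
  have uE : u = v - (fun n => 2 * C * 2^-1 ^+ n).
    by apply/funext => n; rewrite /v !fctE; ring.
  by have := cvgB vc e0; rewrite mulr0 subr0 -uE; exact.
split => // n.
have uc' : u (n + k)%N @[k --> \oo] --> limn v.
  by rewrite (_ : (fun k => _) = (fun k => u (k + n)%N)) ?cvg_shiftn//;
    apply/funext => k; rewrite addnC.
have dc : `|u (n + k)%N - u n| @[k --> \oo] --> `|limn v - u n|.
  by apply: cvg_norm; exact: (cvgB uc' (cvg_cst (u n))).
rewrite -(cvg_lim _ dc)//; apply: limr_le; first exact: (cvgP _ dc).
apply: nearW => k.
by apply: (le_trans (bnd n k)); have := h0 (n + k)%N; lra.
Qed.

Context d (X : measurableType d).
Variables (w : X -> R) (T : (X -> R[i]) -> X -> R[i]).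

(** The ball of radius a of the weighted sup norm sup |K| / w; the weight may
    vanish, which then forces K to vanish at the same points. *)
Definition wclass a (K : X -> R[i]) :=
  mfunC K /\ forall x, norm1 (K x) <= a * w x.

(** Banach's theorem with contraction factor 1/2: the iterates from 0 converge
    pointwise at a geometric rate, so the limit is measurable and stays within
    twice the first step. Letting the weight vanish outside a set also yields
    the support of the fixed point. *)
Lemma weighted_fixpoint (C : R) : 0 <= C -> (forall x, 0 <= w x) ->
  (forall a K, 0 <= a -> wclass a K -> mfunC (T K)) ->
  (forall A K K' a, 0 <= A -> wclass A K -> wclass A K' -> 0 <= a ->
     (forall x, norm1 (K x - K' x) <= a * w x) ->
     forall x, norm1 (T K x - T K' x) <= a / 2 * w x) ->
  wclass C (T (fun _ => 0)) ->
  exists2 K, wclass (2 * C) K & T K = K.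
Proof.
move=> C0 w0 Tm Tc [T0m T0].
have z0 a : 0 <= a -> wclass a (fun _ => 0).
  by move=> a0; split => [|x]; [exact: mfunC_cst|rewrite norm1_0 mulr_ge0].
have C2 : 0 <= 2 * C by lra.
pose k n := iter n T (fun _ => 0).
(* The ball of radius 2 C is stable: T K lies within C of T 0, itself in the
   ball of radius C. *)
have kc n : wclass (2 * C) (k n).
  elim: n => [|n [IH1 IH2]]; first exact: z0.
  split; first exact: (Tm _ _ C2).
  move=> x; rewrite -[k n.+1]/(T (k n)).
  have h1 := Tc _ _ _ (2 * C) C2 (conj IH1 IH2) (z0 _ C2) C2 _ x.
  have h2 := T0 x.
  rewrite -[T (k n) x](subrK (T (fun=> 0) x)) (le_trans (norm1D _ _))//.
  have : norm1 (T (k n) x - T (fun=> 0) x) <= 2 * C / 2 * w x.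
    by apply: h1 => y; rewrite subr0; exact: IH2.
  by lra.
have kd n x : norm1 (k n.+1 x - k n x) <= C * 2^-1 ^+ n * w x.
  elim: n x => [|n IH] x; first by rewrite subr0 expr0 mulr1; exact: T0.
  rewrite (le_trans (Tc _ _ _ (C * 2^-1 ^+ n) C2 (kc n.+1) (kc n) _ IH x))//.
    by rewrite mulr_ge0// exprn_ge0.
  by rewrite exprSr mulrA.
have cR x := geometric_cvg (u := fun n => complex.Re (k n x)) (C := C * w x).
have cI x := geometric_cvg (u := fun n => complex.Im (k n x)) (C := C * w x).
have {}cR x : exists l, complex.Re (k n x) @[n --> \oo] --> l /\
    forall n, `|l - complex.Re (k n x)| <= 2 * (C * w x) * 2^-1 ^+ n.
  apply: cR => n; rewrite -RecN -RecD (le_trans (Re_norm1 _))// (le_trans (kd n x))//.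
  by rewrite mulrAC.
have {}cI x : exists l, complex.Im (k n x) @[n --> \oo] --> l /\
    forall n, `|l - complex.Im (k n x)| <= 2 * (C * w x) * 2^-1 ^+ n.
  apply: cI => n; rewrite -ImcN -ImcD (le_trans (Im_norm1 _))// (le_trans (kd n x))//.
  by rewrite mulrAC.
pose K x : R[i] := projT1 (cid (cR x)) +i* projT1 (cid (cI x)).
have KR x := projT2 (cid (cR x)).
have KI x := projT2 (cid (cI x)).
have Kk n x : norm1 (K x - k n x) <= 4 * C * 2^-1 ^+ n * w x.
  rewrite /norm1 !reimE /=.
  have h1 := (KR x).2 n; have h2 := (KI x).2 n.
  apply: (le_trans (lerD h1 h2)).
  by rewrite -[X in _ <= X]mulrAC; lra.
have mK : mfunC K.
  split.
    apply: (measurable_fun_cvg (h := fun n x => complex.Re (k n x))).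
      by move=> n; have [[]] := kc n.
    by move=> x _; exact: (KR x).1.
  apply: (measurable_fun_cvg (h := fun n x => complex.Im (k n x))).
    by move=> n; have [[]] := kc n.
  by move=> x _; exact: (KI x).1.
have Kb x : norm1 (K x) <= 2 * C * w x.
  rewrite -subr_le0; apply: (@geometric_small _ (4 * C * w x)) => n.
  have := Kk n x; have := (kc n).2 x.
  have := norm1D (K x - k n x) (k n x); rewrite subrK => h1 h2 h3.
  by rewrite [X in _ <= X]mulrAC; lra.
(* T K and K are both close to the iterates, of consecutive ranks. *)
exists K; first by split.
apply/funext => x; apply/eqP; rewrite -subr_eq0; apply/eqP.
apply: norm1_eq0; apply: (@geometric_small _ (4 * C * w x)) => n.
have h1 := Tc _ _ _ (4 * C * 2^-1 ^+ n) C2 (conj mK Kb) (kc n) _ (Kk n) x.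
have {}h1 : norm1 (T K x - k n.+1 x) <= 4 * C * 2^-1 ^+ n / 2 * w x.
  by apply: h1; rewrite !mulr_ge0// exprn_ge0.
have h2 := Kk n.+1 x; rewrite exprS in h2.
have := norm1B (T K x - k n.+1 x) (K x - k n.+1 x).
rewrite opprB addrA subrK => h3.
by rewrite [X in _ <= X]mulrAC; lra.
Qed.
End fixpoint.

(** * The integral equation of the kernel *)

Section Aux.
Variable R : realType.
Local Notation RT := (measurableTypeR R).

Lemma measurable_fst_comp d d1 d2 (T : measurableType d) (T1 : measurableType d1)
  (T2 : measurableType d2) (f : T -> T1 * T2) : measurable_fun setT f ->
  measurable_fun setT (fun x => (f x).1).
Proof. by move=> mf; exact: (measurableT_comp measurable_fst mf). Qed.

Lemma measurable_snd_comp d d1 d2 (T : measurableType d) (T1 : measurableType d1)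
  (T2 : measurableType d2) (f : T -> T1 * T2) : measurable_fun setT f ->
  measurable_fun setT (fun x => (f x).2).
Proof. by move=> mf; exact: (measurableT_comp measurable_snd mf). Qed.

Lemma measurable_wave d (T : measurableType d) (f g : T -> R) :
  measurable_fun setT f -> measurable_fun setT g ->
  measurable_fun setT (fun x => wave (f x) (g x)).
Proof.
move=> mf mg; apply: measurable_fun_ifT; last 2 first.
- exact: measurable_cst.
- exact: measurable_cst.
apply: measurable_and; apply: measurable_fun_ltr => //.
exact: measurableT_comp.
Qed.

Lemma wave_ge0 (z t : R) : 0 <= wave z t.
Proof. by rewrite /wave; case: ifP; lra. Qed.

Lemma wave_le (z t : R) : wave z t <= 1.
Proof. by rewrite /wave; case: ifP; lra. Qed.

Lemma waveN (z t : R) : wave z (- t) = wave z t.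
Proof.
rewrite /wave; congr (if _ then _ else _).
by apply/andP/andP => -[h1 h2]; split; lra.
Qed.

Lemma wave_out (z t : R) : z <= `|t| -> wave z t = 0.
Proof. by rewrite /wave -ltr_norml leNgt => /negbTE ->. Qed.

Lemma cont_cst (k : R) : continuous (fun _ : R => k).
Proof. by move=> x; exact: cvg_cst. Qed.

Lemma itg_wave (z t : R) : itg leb (fun u => wave z (t - u)).
Proof.
have := integrable_if (t - z) (t + z) (@cont_cst 2^-1).
apply: eq_integrable => // u _; rewrite /= -waveN /wave; congr (if _ then _ else _)%:E.
by apply/andP/andP => -[h1 h2]; split; lra.
Qed.

Lemma int_wave (z t : R) : \int[leb]_u wave z (t - u) = Num.max 0 z.
Proof.
have -> : \int[leb]_u wave z (t - u) =
    \int[leb]_u (if t - z < u < t + z then 2^-1 else 0).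
  apply: eq_Rintegral => u _; rewrite -waveN /wave; congr (if _ then _ else _).
  by apply/andP/andP => -[h1 h2]; split; lra.
case: (leP z 0) => z0.
  rewrite (_ : (fun u => _) = fun=> 0).
    by rewrite /Rintegral integral0.
  apply/funext => u; case: ifP => // /andP[h1 h2]; exfalso; lra.
have h : t - z <= t + z by lra.
rewrite (FTC2R h (fun u => is_derive_lin 2^-1 u) (@cont_cst _)); lra.
Qed.

(** Convolution with the wave kernel: d'Alembert's formula for a datum f. *)
Definition wconv (f : RT -> R[i]) (z t : R) : R[i] :=
  intC leb (fun u => (wave z (t - u))%:C * f u).

Lemma conv_bound (f : RT -> R[i]) z t a : mfunC f -> (forall u, norm1 (f u) <= a) ->
  itgC leb (fun u => (wave z (t - u))%:C * f u) /\
  norm1 (wconv f z t) <= a * Num.max 0 z.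
Proof.
move=> mf fa.
have hb u : norm1 ((wave z (t - u))%:C * f u) <= a * wave z (t - u).
  by rewrite norm1MC ger0_norm ?wave_ge0// mulrC ler_wpM2r ?wave_ge0.
have mw : mfunC (fun u : RT => (wave z (t - u))%:C * f u).
  apply: mfunCM => //; apply: mfunC_real; apply: measurable_wave => //.
  exact: measurable_funB.
have ia := itgZ a (itg_wave z t).
have ig := itgC_dom mw ia hb.
split=> //; have := norm1_intC ig ia hb.
by rewrite RintegralZl ?int_wave//; exact: itg_wave.
Qed.

Lemma convB (f g : RT -> R[i]) z t a a' : mfunC f -> (forall u, norm1 (f u) <= a) ->
  mfunC g -> (forall u, norm1 (g u) <= a') ->
  wconv f z t - wconv g z t = wconv (fun u => f u - g u) z t.
Proof.
move=> mf fa mg ga; rewrite /wconv.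
have [h1 _] := conv_bound z t mf fa.
have [h2 _] := conv_bound z t mg ga.
by rewrite -intCB//; congr intC; apply/funext => u; rewrite mulrBr.
Qed.

Definition ramp (z : R) : R := Num.max 0 z.
End Aux.

Ltac measurable_tac := repeat first [
    exact: measurable_id | exact: measurable_cst | exact: measurable_fst
  | exact: measurable_snd | assumption
  | apply: measurable_wave | apply: measurable_funB | apply: measurable_funD
  | apply: measurable_funM | apply: measurable_fun_pair | apply: measurable_fst_comp | apply: measurable_snd_comp
  | apply: measurable_and | apply: measurable_fun_ltr | apply: measurable_fun_ler ].

Section kernel.
Variable R : realType.
Local Notation RT := (measurableTypeR R).
Variables (b : R) (m : {sigma_finite_measure set RT -> \bar R}).
Variables (Q : RT -> R[i]) (w : RT -> R) (Wm : R).
Hypothesis b_ge0 : 0 <= b.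
Hypothesis Qi : itgC m Q.
Hypothesis Qsupp : forall s : R, ~~ (0 <= s < b) -> Q s = 0.
Hypothesis mw : measurable_fun setT w.
Hypothesis w1 : forall y, 1 <= w y.
Hypothesis wM : forall y, w y <= Wm.
Hypothesis wQ : forall y, y <= b ->
  b * \int[m]_s (if s < y then norm1 (Q s) * w s else 0) <= w y / 2.

Let w0 y : 0 <= w y. Proof. exact: le_trans (w1 y). Qed.
Let Wm0 : 0 <= Wm. Proof. exact: le_trans (w0 0) (wM 0). Qed.
Let Qm : mfunC Q. Proof. exact: itgC_meas Qi. Qed.
Let Qn : itg m (fun s => norm1 (Q s)). Proof. exact: itgC_norm1. Qed.

(** Zero off the light cone |t| < y <= b: a finite norm for this weight
    encodes both a bound and the support of the kernel. *)
Definition cone_weight (p : RT * RT) : R :=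
  if (`|p.2| < p.1) && (p.1 <= b) then w p.1 else 0.

Lemma cone_weight_ge0 p : 0 <= cone_weight p.
Proof. by rewrite /cone_weight; case: ifP. Qed.

Lemma cone_weight_le s t : cone_weight (s, t) <= w s.
Proof. by rewrite /cone_weight; case: ifP. Qed.

Lemma cone_weight_leM p : cone_weight p <= Wm.
Proof. by rewrite /cone_weight; case: ifP. Qed.

(** The influence at (y, t) of the potential at s, acting on the incoming
    signal delta_s + K(s, .) which [wave] then propagates for the time y - s. *)
Definition inner (K : RT * RT -> R[i]) (y t s : R) : R[i] :=
  (wave (y - s) (t - s))%:C + wconv (fun u => K (s, u)) (y - s) t.

Definition Kop (K : RT * RT -> R[i]) (p : RT * RT) : R[i] :=
  if p.1 <= b then intC m (fun s => Q s * inner K p.1 p.2 s) else 0.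

Lemma mfunC_sec (K : RT * RT -> R[i]) s : mfunC K -> mfunC (fun u => K (s, u)).
Proof. by move=> mK; apply: mfunC_comp mK _; measurable_tac. Qed.

Lemma mfunC_inner (K : RT * RT -> R[i]) : mfunC K ->
  mfunC (fun q : (RT * RT) * RT => inner K q.1.1 q.1.2 q.2).
Proof.
move=> mK; apply: mfunCD; first by apply: mfunC_real; measurable_tac.
apply: (mfunC_intC leb (F := fun q : ((RT * RT) * RT) * RT =>
  (wave (q.1.1.1 - q.1.2) (q.1.1.2 - q.2))%:C * K (q.1.2, q.2))).
apply: mfunCM; first by apply: mfunC_real; measurable_tac.
by apply: mfunC_comp mK _; measurable_tac.
Qed.

Lemma mfunC_Kop (K : RT * RT -> R[i]) : mfunC K -> mfunC (Kop K).
Proof.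
move=> mK; apply: mfunC_if.
- by apply: measurable_fun_ler; measurable_tac.
- apply: (mfunC_intC m (F := fun q => Q q.2 * inner K q.1.1 q.1.2 q.2)).
  apply: mfunCM; last exact: mfunC_inner.
  by apply: mfunC_comp Qm _; measurable_tac.
- exact: mfunC_cst.
Qed.

Lemma mfunC_inner_s K y t : mfunC K -> mfunC (fun s => inner K y t s).
Proof.
move=> mK; apply: (mfunC_comp (h := fun s => ((y, t), s)) (mfunC_inner mK)).
by measurable_tac.
Qed.

(** Finite propagation speed: |t - u| < y - s and |u| < s give |t| < y. *)
Lemma inner_out K y t s : (forall s u, s <= `|u| -> K (s, u) = 0) ->
  0 <= s -> y <= `|t| -> inner K y t s = 0.
Proof.
move=> sK s0 yt; rewrite /inner wave_out; last first.
  by move: yt; case: ler0P => ?; case: ler0P => ?; lra.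
rewrite add0r /wconv (_ : (fun u => _) = fun=> 0) ?intC0//.
apply/funext => u.
have [h|h] := ltP `|t - u| (y - s); last by rewrite wave_out// realC0 mul0r.
rewrite sK ?mulr0//.
by have := ler_normD (t - u) u; rewrite subrK; lra.
Qed.

Lemma inner_bound K M y t s : 0 <= M -> mfunC K -> (forall p, norm1 (K p) <= M) ->
  0 <= s -> y <= b -> norm1 (inner K y t s) <= 1 + M * b.
Proof.
move=> M0 mK MK s0 yb.
rewrite (le_trans (norm1D _ _))// lerD//.
  by rewrite norm1C ger0_norm ?wave_ge0// wave_le.
have [_ /le_trans] := conv_bound (y - s) t (mfunC_sec s mK) (fun u => MK (s, u)).
apply; rewrite ler_wpM2l// ge_max b_ge0 /=; lra.
Qed.

Lemma wclass_supp a K : wclass cone_weight a K -> forall s u, s <= `|u| -> K (s, u) = 0.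
Proof.
move=> [mK aK] s u su; apply: norm1_eq0; rewrite (le_trans (aK _))// /cone_weight /=.
by rewrite ltNge su /= mulr0.
Qed.

Lemma wclass_bd a K : 0 <= a -> wclass cone_weight a K -> forall p, norm1 (K p) <= a * Wm.
Proof.
by move=> a0 [_ aK] p; rewrite (le_trans (aK _))// ler_wpM2l// cone_weight_leM.
Qed.

(** Estimates involving Q are only needed where Q may be nonzero. *)
Lemma Q_out (s : R) (z : R[i]) (P : R -> Prop) :
  (0 <= s < b -> P (norm1 (Q s * z))) -> P 0 -> P (norm1 (Q s * z)).
Proof.
move=> h p0; have [/h//|/Qsupp ->] := boolP (0 <= s < b).
by rewrite mul0r norm1_0.
Qed.

Lemma itgC_Qinner K M y t : 0 <= M -> mfunC K -> (forall p, norm1 (K p) <= M) ->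
  y <= b -> itgC m (fun s => Q s * inner K y t s).
Proof.
move=> M0 mK MK yb.
apply: (itgC_dom (r := fun s => (1 + M * b) * norm1 (Q s))).
- by apply: mfunCM => //; apply: mfunC_inner_s.
- exact: itgZ.
- have k0 : 0 <= 1 + M * b by rewrite addr_ge0// !mulr_ge0.
  move=> s; apply: (Q_out (P := fun x => x <= _)).
    move=> /andP[s0 sb]; rewrite (le_trans (norm1M _ _))// mulrC.
    by rewrite ler_wpM2r ?norm1_ge0// inner_bound.
  by rewrite mulr_ge0 ?norm1_ge0.
Qed.

Lemma itg_Qw y : itg m (fun s => if s < y then norm1 (Q s) * w s else 0).
Proof.
apply: (le_itg (s := fun s => Wm * norm1 (Q s))).
- apply: measurable_fun_ifT; first by apply: measurable_fun_ltr; measurable_tac.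
    by apply: measurable_funM => //; exact: mfunC_norm1.
  exact: measurable_cst.
- move=> s; case: ifP => _; last by rewrite normr0 mulr_ge0 ?norm1_ge0.
  by rewrite ger0_norm ?mulr_ge0 ?norm1_ge0// mulrC ler_wpM2r ?norm1_ge0.
- exact: itgZ.
Qed.

(** The wave term cancels in the difference, and convolution over a window of
    length at most b costs a factor b; the hypothesis on the weight then
    supplies the factor 1/2. *)
Lemma Kop_contract A K K' a : 0 <= A -> wclass cone_weight A K -> wclass cone_weight A K' ->
  0 <= a -> (forall p, norm1 (K p - K' p) <= a * cone_weight p) ->
  forall p, norm1 (Kop K p - Kop K' p) <= a / 2 * cone_weight p.
Proof.
move=> A0 wK wK' a0 h [y t]; rewrite /Kop /=.
have [yb|yb] := leP y b; last first.
  by rewrite subrr norm1_0 mulr_ge0 ?cone_weight_ge0// divr_ge0.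
have AM : 0 <= A * Wm by rewrite mulr_ge0.
have iK := itgC_Qinner t AM wK.1 (wclass_bd A0 wK) yb.
have iK' := itgC_Qinner t AM wK'.1 (wclass_bd A0 wK') yb.
rewrite -intCB//.
have [ty|ty] := ltP `|t| y; last first.
  rewrite (_ : (fun s => _) = fun=> 0).
    by rewrite intC0 norm1_0 mulr_ge0 ?cone_weight_ge0// divr_ge0.
  apply/funext => s; rewrite -mulrBr.
  have [/andP[s0 sb]|/Qsupp ->] := boolP (0 <= s < b); last by rewrite mul0r.
  by rewrite (inner_out (wclass_supp wK))// (inner_out (wclass_supp wK'))// subrr mulr0.
rewrite /cone_weight /= ty yb /=.
have dom s : norm1 (Q s * inner K y t s - Q s * inner K' y t s) <=
    a * b * (if s < y then norm1 (Q s) * w s else 0).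
  rewrite -mulrBr; apply: (Q_out (P := fun x => x <= _)); last first.
    by rewrite !mulr_ge0//; case: ifP => // _; rewrite mulr_ge0 ?norm1_ge0.
  move=> /andP[s0 sb]; rewrite (le_trans (norm1M _ _))//.
  have -> : inner K y t s - inner K' y t s =
      wconv (fun u => K (s, u) - K' (s, u)) (y - s) t.
    rewrite /inner opprD addrACA subrr add0r.
    apply: (convB _ _ (a := A * Wm) (a' := A * Wm)).
    - exact: mfunC_sec wK.1.
    - by move=> u; rewrite (le_trans (wK.2 _))// ler_wpM2l// cone_weight_leM.
    - exact: mfunC_sec wK'.1.
    - by move=> u; rewrite (le_trans (wK'.2 _))// ler_wpM2l// cone_weight_leM.
  have hd : forall u, norm1 (K (s, u) - K' (s, u)) <= a * w s.
    by move=> u; rewrite (le_trans (h _))// ler_wpM2l// cone_weight_le.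
  have mD := mfunCB (mfunC_sec s wK.1) (mfunC_sec s wK'.1).
  have [_ cb] := conv_bound (y - s) t mD hd.
  case: ltP => sy.
    rewrite (_ : a * b * _ = norm1 (Q s) * (a * w s * b)); last by ring.
    rewrite ler_wpM2l ?norm1_ge0// (le_trans cb)// ler_wpM2l ?mulr_ge0//.
    by rewrite ge_max b_ge0 /=; lra.
  rewrite mulr0; rewrite max_l in cb; last by lra.
  by rewrite mulr0 in cb; rewrite (norm1_eq0 cb) norm1_0 mulr0.
have ig := itgZ (a * b) (itg_Qw y).
rewrite (le_trans (norm1_intC (itgCB iK iK') ig dom))//.
rewrite RintegralZl//; last exact: itg_Qw.
by have := ler_wpM2l a0 (wQ yb); lra.
Qed.

Lemma Kop0 : wclass cone_weight (\int[m]_s norm1 (Q s)) (Kop (fun _ => 0)).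
Proof.
have q0 : 0 <= \int[m]_s norm1 (Q s).
  by apply: Rintegral_ge0 => s _; exact: norm1_ge0.
split; first by apply: mfunC_Kop; exact: mfunC_cst.
move=> [y t]; rewrite /Kop /=.
have [yb|yb] := leP y b; last by rewrite norm1_0 mulr_ge0 ?cone_weight_ge0.
have [ty|ty] := ltP `|t| y; last first.
  rewrite (_ : (fun s => _) = fun=> 0) ?intC0 ?norm1_0 ?mulr_ge0 ?cone_weight_ge0//.
  apply/funext => s.
  have [/andP[s0 sb]|/Qsupp ->] := boolP (0 <= s < b); last by rewrite mul0r.
  by rewrite inner_out// mulr0.
rewrite /cone_weight /= ty yb /=.
have dom s : norm1 (Q s * inner (fun=> 0) y t s) <= norm1 (Q s).
  rewrite (le_trans (norm1M _ _))// ler_piMr ?norm1_ge0//.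
  rewrite /inner /wconv (_ : (fun u => _) = fun=> 0).
    by rewrite intC0 addr0 norm1C ger0_norm ?wave_ge0// wave_le.
  by apply/funext => u; rewrite mulr0.
have z1 : forall p : RT * RT, norm1 ((fun=> 0) p : R[i]) <= 1 by move=> p; rewrite norm1_0.
rewrite (le_trans (norm1_intC (itgC_Qinner t ler01 (mfunC_cst _ _) z1 yb) Qn dom))//.
by rewrite ler_peMr.
Qed.

Lemma kernel_exists : exists (M : R) (K : RT * RT -> R[i]), [/\ 0 <= M, mfunC K,
  forall p, norm1 (K p) <= M, (forall s u, s <= `|u| -> K (s, u) = 0) &
  forall y t, y <= b -> K (y, t) = intC m (fun s => Q s * inner K y t s)].
Proof.
have q0 : 0 <= \int[m]_s norm1 (Q s).
  by apply: Rintegral_ge0 => s _; exact: norm1_ge0.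
have Tm a K : 0 <= a -> wclass cone_weight a K -> mfunC (Kop K).
  by move=> _ [mK _]; exact: mfunC_Kop.
have [K wK KE] := weighted_fixpoint q0 cone_weight_ge0 Tm Kop_contract Kop0.
have q2 : 0 <= 2 * \int[m]_s norm1 (Q s) by rewrite mulr_ge0.
exists (2 * \int[m]_s norm1 (Q s) * Wm), K; split.
- by rewrite mulr_ge0.
- exact: wK.1.
- exact: wclass_bd.
- exact: wclass_supp wK.
- by move=> y t yb; rewrite -[LHS]/(K (y, t)) -[in LHS]KE /Kop /= yb.
Qed.
End kernel.

(** * The exponential transform of the kernel *)

Lemma itgC_wave_exp (R : realType) (c : R[i]) (z s : R) :
  itgC leb (fun t => (wave z (t - s))%:C * expC (c * t%:C)).
Proof.
have [c1 c2] := isderC_continuous (isderC_mull 2^-1%:C (isderC_expC c)).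
have wE t : wave z (t - s) = if s - z < t < s + z then 2^-1 else 0.
  by congr (if _ then _ else _); apply/andP/andP => -[h1 h2]; split; lra.
split; [have := integrable_if (s - z) (s + z) c1|
  have := integrable_if (s - z) (s + z) c2];
  apply: eq_integrable => // t _; congr _%:E; rewrite wE;
  by case: ifP => // _; rewrite realC0 mul0r.
Qed.

Section transform.
Variable R : realType.
Local Notation RT := (measurableTypeR R).
Variables (b : R) (m : {sigma_finite_measure set RT -> \bar R}).
Variables (Q : RT -> R[i]) (K : RT * RT -> R[i]) (M : R).
Hypothesis b_ge0 : 0 <= b.
Hypothesis Qi : itgC m Q.
Hypothesis Qsupp : forall s : R, ~~ (0 <= s < b) -> Q s = 0.
Hypothesis M0 : 0 <= M.
Hypothesis mK : mfunC K.
Hypothesis MK : forall p, norm1 (K p) <= M.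
Hypothesis sK : forall s u : R, s <= `|u| -> K (s, u) = 0.
Hypothesis KE : forall y t : R, y <= b ->
  K (y, t) = intC m (fun s => Q s * inner K y t s).
Variable c : R[i].

Let Qm : mfunC Q. Proof. exact: itgC_meas Qi. Qed.
Let Qn : itg m (fun s => norm1 (Q s)). Proof. exact: itgC_norm1. Qed.

(** The candidate solution. The integral runs over all t since K(y, .) vanishes
    outside (-y, y). *)
Definition eker (y : R) : R[i] :=
  expC (c * y%:C) + intC leb (fun t => K (y, t) * expC (c * t%:C)).

Let ec (t : RT) := expC (c * t%:C).
Let mec : mfunC ec. Proof. exact: mfunC_expC. Qed.

Let Me := 2 * expR (`|complex.Re c| * b).
Let Me0 : 0 <= Me. Proof. by rewrite mulr_ge0// expR_ge0. Qed.

(** Every integrand in t lives on (-b, b), where it is bounded; this majorant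
    is the common factor in the applications of Fubini. *)
Definition box (A : R) (t : RT) : R := if - b < t < b then A else 0.

Lemma box_ge0 A t : 0 <= A -> 0 <= box A t.
Proof. by rewrite /box; case: ifP. Qed.

Lemma itg_box A : itg leb (box A).
Proof. exact: integrable_if (@cont_cst _ A). Qed.

Lemma ec_box (z : R[i]) (A t : R) : 0 <= A -> norm1 z <= A ->
  (b <= `|t| -> z = 0) -> norm1 (z * ec t) <= box (A * Me) t.
Proof.
move=> A0 zA z0; rewrite /box -ltr_norml; case: ltP => tb.
  rewrite (le_trans (norm1M _ _))// ler_pM ?norm1_ge0//.
  by apply: norm1_expC; exact: ltW.
by rewrite z0// mul0r norm1_0.
Qed.

Lemma mfunC_eker : mfunC (eker : RT -> R[i]).
Proof.
apply: mfunCD; first exact: mec.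
apply: (mfunC_intC leb (F := fun q : RT * RT => K (q.1, q.2) * ec q.2)).
apply: mfunCM; first by apply: mfunC_comp mK _; measurable_tac.
by apply: mfunC_comp mec _; measurable_tac.
Qed.

Lemma K_exp_box y t : y <= b -> norm1 (K (y, t) * ec t) <= box (M * Me) t.
Proof.
move=> yb; apply: ec_box => // bt; apply: sK; exact: le_trans bt.
Qed.

Lemma itgC_K_exp y : y <= b -> itgC leb (fun t => K (y, t) * ec t).
Proof.
move=> yb; apply: (itgC_dom (r := box (M * Me))).
- apply: mfunCM mec; exact: mfunC_sec mK.
- exact: itg_box.
- by move=> t; exact: K_exp_box.
Qed.

Lemma eker_bound : exists2 B : R, 0 <= B &
  forall y, 0 <= y <= b -> norm1 (eker y) <= B.
Proof.
have I0 : 0 <= \int[leb]_t box (M * Me) t.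
  by apply: Rintegral_ge0 => t _; rewrite box_ge0// mulr_ge0.
exists (Me + \int[leb]_t box (M * Me) t); first by rewrite addr_ge0.
move=> y /andP[y0 yb]; rewrite (le_trans (norm1D _ _))// lerD//.
  by apply: norm1_expC; rewrite ger0_norm.
apply: norm1_intC; [exact: itgC_K_exp|exact: itg_box|].
by move=> t; exact: K_exp_box.
Qed.

(** The transform turns the convolution with [wave z] into multiplication by
    [sinhq c z]. *)
Lemma conv_exp (z s : R) : 0 <= s -> z + s <= b ->
  intC leb (fun t => wconv (fun u => K (s, u)) z t * ec t) =
  sinhq c z * intC leb (fun u => K (s, u) * ec u).
Proof.
move=> s0 zs.
have [z0|z0] := leP z 0.
  rewrite /sinhq z0 mul0r (_ : (fun t => _) = fun=> 0) ?intC0//.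
  apply/funext => t; rewrite /wconv (_ : (fun u => _) = fun=> 0) ?intC0 ?mul0r//.
  by apply/funext => u; rewrite wave_out ?mul0r// (le_trans z0).
have sb : s <= b by lra.
pose F (q : RT * RT) := (wave z (q.1 - q.2))%:C * K (s, q.2) * ec q.1.
have mF : mfunC F.
  apply: mfunCM; last by apply: mfunC_comp mec _; measurable_tac.
  apply: mfunCM; first by apply: mfunC_real; measurable_tac.
  by apply: mfunC_comp mK _; measurable_tac.
have Fb t u : norm1 (F (t, u)) <= box (M * Me) t * box 1 u.
  rewrite /F /=.
  have wM : norm1 ((wave z (t - u))%:C * K (s, u)) <= M.
    rewrite norm1MC ger0_norm ?wave_ge0// (le_trans _ (MK (s, u)))//.
    by rewrite ler_piMl ?norm1_ge0// wave_le.
  have [ub|ub] := ltP `|u| s; last first.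
    by rewrite sK// mulr0 mul0r norm1_0 mulr_ge0// box_ge0// mulr_ge0.
  rewrite [box 1 u]/box -ltr_norml (lt_le_trans ub sb) mulr1.
  apply: ec_box => // bt; rewrite wave_out ?mul0r//.
  by have := ler_normD (t - u) u; rewrite subrK; lra.
have H := FubiniC mF (itg_box (M * Me)) (itg_box 1)
  (fun t => @box_ge0 _ t (mulr_ge0 M0 Me0)) (fun u => @box_ge0 1 u (@ler01 R)) Fb.
transitivity (intC leb (fun t => intC leb (fun u => F (t, u)))).
  congr intC; apply/funext => t; rewrite /wconv mulrC -intCZ.
    by congr intC; apply/funext => u; rewrite /F mulrC.
  by have [] := conv_bound z t (mfunC_sec s mK) (fun u => MK (s, u)).
rewrite H -intCZ; last exact: itgC_K_exp.
congr intC; apply/funext => u.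
transitivity (K (s, u) * intC leb (fun t => (wave z (t - u))%:C * ec t)).
  rewrite -intCZ; last exact: itgC_wave_exp.
  by congr intC; apply/funext => t; rewrite /F /=; ring.
rewrite wave_exp /ec; ring.
Qed.

Lemma itgC_Qbd (f : RT -> R[i]) (A : R) : mfunC f -> 0 <= A ->
  (forall s : R, 0 <= s < b -> norm1 (f s) <= A) ->
  itgC m (fun s => Q s * f s).
Proof.
move=> mf A0 fA; apply: (itgC_dom (r := fun s : RT => A * norm1 (Q s))).
- exact: mfunCM.
- exact: itgZ.
- move=> s; apply: (Q_out Qsupp (P := fun x => x <= _)).
    move=> /fA fs; rewrite (le_trans (norm1M _ _))// mulrC.
    by rewrite ler_wpM2r ?norm1_ge0.
  by rewrite mulr_ge0 ?norm1_ge0.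
Qed.

(** The transform of the integral equation of K, by exchanging the integrals
    in t and s: [wave_exp] evaluates the first term of [inner], [conv_exp] the
    second, and together they give back [eker] at s. *)
Lemma eker_sinhq y : y <= b ->
  eker y = ec y + intC m (fun s => Q s * (sinhq c (y - s) * eker s)).
Proof.
move=> yb; congr (_ + _).
have A0 : 0 <= 1 + M * b by rewrite addr_ge0// mulr_ge0.
pose F (q : RT * RT) := Q q.2 * inner K y q.1 q.2 * ec q.1.
have mF : mfunC F.
  apply: mfunCM; last by apply: mfunC_comp mec _; measurable_tac.
  apply: mfunCM; first by apply: mfunC_comp Qm _; measurable_tac.
  apply: (mfunC_comp (h := fun q : RT * RT => ((y, q.1), q.2)) (mfunC_inner mK)).
  by measurable_tac.
have Fb t s : norm1 (F (t, s)) <= box ((1 + M * b) * Me) t * norm1 (Q s).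
  rewrite /F /= -mulrA; apply: (Q_out Qsupp (P := fun x => x <= _)); last first.
    by rewrite mulr_ge0 ?norm1_ge0// box_ge0// mulr_ge0.
  move=> /andP[s0 sb]; rewrite (le_trans (norm1M _ _))// mulrC.
  rewrite ler_wpM2r ?norm1_ge0//; apply: ec_box => //.
    exact: inner_bound.
  by move=> bt; apply: inner_out => //; exact: le_trans bt.
have H := FubiniC mF (itg_box ((1 + M * b) * Me)) Qn
  (fun t => @box_ge0 _ t (mulr_ge0 A0 Me0)) (fun s => norm1_ge0 (Q s)) Fb.
transitivity (intC leb (fun t => intC m (fun s => F (t, s)))).
  congr intC; apply/funext => t; rewrite KE// mulrC -intCZ.
    by congr intC; apply/funext => s; rewrite /F mulrC.
  exact: (itgC_Qinner b_ge0 Qi Qsupp t M0 mK MK yb).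
rewrite H; congr intC; apply/funext => s.
have [/andP[s0 sb]|/Qsupp Q0] := boolP (0 <= s < b); last first.
  rewrite Q0 mul0r (_ : (fun t => _) = fun=> 0) ?intC0//.
  by apply/funext => t; rewrite /F /= Q0 !mul0r.
have i1 := itgC_wave_exp c (y - s) s.
have mcv : mfunC (fun t : RT => wconv (fun u => K (s, u)) (y - s) t).
  apply: (mfunC_intC leb (F := fun q : RT * RT => (wave (y - s) (q.1 - q.2))%:C * K (s, q.2))).
  apply: mfunCM; first by apply: mfunC_real; measurable_tac.
  by apply: mfunC_comp mK _; measurable_tac.
have i2 : itgC leb (fun t => wconv (fun u => K (s, u)) (y - s) t * ec t).
  apply: (itgC_dom (r := box (M * b * Me))).
  - exact: mfunCM.
  - exact: itg_box.
  - move=> t; apply: ec_box; first by rewrite mulr_ge0.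
      have [_ /le_trans] := conv_bound (y - s) t (mfunC_sec s mK) (fun u => MK (s, u)).
      by apply; rewrite ler_wpM2l// ge_max b_ge0 /=; lra.
    move=> bt; have := inner_out (y := y) (t := t) sK s0 (le_trans yb bt).
    rewrite /inner wave_out ?add0r//.
    by have := ler_norm t; have := ler_norm (- t); rewrite normrN; have := ler_normB t s;
      rewrite (ger0_norm s0); have := ler_normD (t - s) s; rewrite subrK (ger0_norm s0); lra.
transitivity (Q s * intC leb (fun t => (wave (y - s) (t - s))%:C * ec t +
    wconv (fun u => K (s, u)) (y - s) t * ec t)).
  rewrite -intCZ; last exact: itgCD.
  by congr intC; apply/funext => t; rewrite /F /inner /=; ring.
rewrite intCD// wave_exp conv_exp//; last by lra.
rewrite /eker /ec; ring.
Qed.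

(** Integrating [eker_sinhq] twice. The double integral of c^2 eker replaces
    exp(c y) by its affine part ([exp_ramp]) and each [sinhq] by a ramp
    ([sinhq_ramp]). In this form the coefficients no longer oscillate, and it is
    the form that a weak solution is shown to satisfy. *)
Lemma eker_ramp y : 0 <= y <= b ->
  eker y = 1 + c * y%:C + intC m (fun s => Q s * ((ramp (y - s))%:C * eker s)) +
    c ^+ 2 * intC leb (fun r => if 0 < r < y then (y - r)%:C * eker r else 0).
Proof.
move=> /andP[y0 yb].
have [B B0 EB] := eker_bound.
have [S S0 SB] := norm1_sinhq c b.
have mS : mfunC (fun q : RT * RT => sinhq c (q.1 - q.2)).
  by apply: (mfunC_comp (T := R) (h := fun q : RT * RT => q.1 - q.2) (mfunC_sinhq c)); measurable_tac.
have mE := mfunC_eker.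
have mram : measurable_fun setT (fun s : RT => ramp (y - s)).
  by apply: measurable_maxr; measurable_tac.
have msE z : mfunC (fun s : RT => sinhq c (z - s) * eker s).
  apply: mfunCM => //.
  by apply: (mfunC_comp (h := fun s : RT => (z : RT, s)) mS); measurable_tac.
have sEb z s : z <= b -> 0 <= s < b -> norm1 (sinhq c (z - s) * eker s) <= S * B.
  move=> zb /andP[s0 sb]; rewrite (le_trans (norm1M _ _))//.
  by rewrite ler_pM ?norm1_ge0 ?SB ?EB ?s0 ?(ltW sb)//; lra.
have iS z : z <= b -> itgC m (fun s => Q s * (sinhq c (z - s) * eker s)).
  by move=> zb; apply: (itgC_Qbd (A := S * B)) => //; [exact: mulr_ge0|
    move=> s; exact: sEb].
have iR : itgC m (fun s => Q s * ((ramp (y - s))%:C * eker s)).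
  apply: (itgC_Qbd (A := b * B)); first by apply: mfunCM => //; exact: mfunC_real.
    exact: mulr_ge0.
  move=> s /andP[s0 sb]; rewrite norm1MC ler_pM ?norm1_ge0 ?EB ?s0 ?(ltW sb)//.
  by rewrite /ramp ger0_norm ?le_max ?lexx// ge_max b_ge0 /=; lra.
pose F (q : RT * RT) : R[i] := if 0 < q.1 < y then
  (y - q.1)%:C * (Q q.2 * (sinhq c (q.1 - q.2) * eker q.2)) else 0.
have mb : measurable_fun setT (fun q : RT * RT => 0 < q.1 < y).
  by measurable_tac.
have mF : mfunC F.
  apply: (mfunC_if mb _ (mfunC_cst _ _)).
  apply: mfunCM; first by apply: mfunC_real; measurable_tac.
  apply: mfunCM; first by apply: mfunC_comp Qm _; measurable_tac.
  by apply: mfunCM => //; apply: mfunC_comp mE _; measurable_tac.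
have Fb r s : norm1 (F (r, s)) <= (if 0 < r < y then b * (S * B) else 0) * norm1 (Q s).
  rewrite /F /=; case: ifP => [/andP[r0 ry]|_]; last by rewrite norm1_0 mul0r.
  rewrite norm1MC -mulrA; apply: ler_pM => //; first exact: norm1_ge0.
    by rewrite ger0_norm; lra.
  apply: (Q_out Qsupp (P := fun x => x <= _)); last by rewrite mulr_ge0 ?norm1_ge0 ?mulr_ge0.
  move=> s0; rewrite (le_trans (norm1M _ _))// mulrC.
  by rewrite ler_wpM2r ?norm1_ge0// sEb// (ltW (lt_le_trans ry yb)).
have ig1 := integrable_if 0 y (@cont_cst _ (b * (S * B))).
have H := FubiniC mF ig1 Qn _ (fun s => norm1_ge0 (Q s)) Fb.
have {}H : intC leb (fun x => intC m (fun y0 => F (x, y0))) =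
    intC m (fun y0 => intC leb (fun x => F (x, y0))).
  by apply: H => r; case: ifP => // _; rewrite mulr_ge0// mulr_ge0.
have iy (z : R[i]) : itgC leb (fun r => if 0 < r < y then (y - r)%:C * expC (z * r%:C) else 0).
  have [c1 c2] := isderC_continuous (isderC_mul (isderC_affine (-1) y%:C) (isderC_expC z)).
  split; [have := integrable_if 0 y c1|have := integrable_if 0 y c2];
  apply: eq_integrable => // r _; congr _%:E;
  by case: ifP => // _; rewrite mulN1r addrC -realCB.
have rampE : c ^+ 2 * intC leb (fun r => if 0 < r < y then (y - r)%:C * expC (c * r%:C) else 0)
   = ec y - c * y%:C - 1.
  have := exp_ramp c y0; rewrite subr0 => <-.
  rewrite -intCZ//; congr intC; apply/funext => r; rewrite subr0.
  by case: ifP => // _; rewrite mulr0.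
(* Substitute [eker_sinhq] for eker in the double integral. *)
have splitE : intC leb (fun r => if 0 < r < y then (y - r)%:C * eker r else 0) =
  intC leb (fun r => if 0 < r < y then (y - r)%:C * expC (c * r%:C) else 0) +
  intC leb (fun r => intC m (fun s => F (r, s))).
  rewrite -intCD//; last first.
    apply: (itgC_dom (r := fun r : RT => (if 0 < r < y then b * (S * B) else 0) *
        \int[m]_s norm1 (Q s))).
    - exact: mfunC_intC.
    - have := itgZ (\int[m]_s norm1 (Q s)) ig1.
      by apply: eq_integrable => // r _; rewrite /= mulrC.
    - move=> r; rewrite -RintegralZl//.
      apply: norm1_intC; last exact: Fb.
        rewrite /F /=; have [/andP[r0 ry]|_] := boolP (0 < r < y).
          by apply: itgCZ; apply: iS; rewrite (ltW (lt_le_trans ry yb)).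
        by split => /=; exact: integrable0.
      exact: itgZ.
  congr intC; apply/funext => r; rewrite /F /=.
  have [/andP[r0 ry]|_] := boolP (0 < r < y); last first.
    by rewrite intC0 addr0.
  have rb : r <= b by rewrite (ltW (lt_le_trans ry yb)).
  by rewrite (intCZ _ (iS _ rb)) -mulrDr -eker_sinhq.
have iFr s : itgC leb (fun r => F (r, s)).
  apply: (itgC_dom (r := fun r : RT => norm1 (Q s) * (if 0 < r < y then b * (S * B) else 0))).
  - by apply: (mfunC_comp (h := fun r : RT => (r, s : RT)) mF); measurable_tac.
  - exact: itgZ.
  - by move=> r; rewrite mulrC.
(* After the exchange of the integrals the inner one is computed by
   [sinhq_ramp]. *)
have FE : c ^+ 2 * intC m (fun s => intC leb (fun r => F (r, s))) =
  intC m (fun s => Q s * (sinhq c (y - s) * eker s)) -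
  intC m (fun s => Q s * ((ramp (y - s))%:C * eker s)).
  rewrite -(intCB (iS _ yb) iR) -intCZ; last first.
    apply: (itgC_dom (r := fun s : RT => \int[leb]_r (if 0 < r < y then b * (S * B) else 0) * norm1 (Q s))).
    - apply: (mfunC_intC leb (F := fun q : RT * RT => F (q.2, q.1))).
      by apply: mfunC_comp mF _; measurable_tac.
    - exact: itgZ.
    - move=> s; rewrite mulrC -RintegralZl//.
      apply: norm1_intC; last by move=> r; rewrite mulrC; exact: Fb.
        exact: iFr.
      exact: itgZ.
  congr intC; apply/funext => s.
  have [/andP[s0 sb]|/Qsupp Q0] := boolP (0 <= s < b); last first.
    rewrite Q0 !mul0r subrr (_ : (fun r => _) = fun=> 0) ?intC0 ?mulr0//.
    by apply/funext => r; rewrite /F /= Q0 mul0r mulr0 if_same.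
  rewrite -mulrBr -mulrBl.
  have -> : sinhq c (y - s) - (ramp (y - s))%:C =
      c ^+ 2 * intC leb (fun r => if s < r < y then (y - r)%:C * sinhq c (r - s) else 0).
    have [sy|ys] := leP s y.
      by rewrite sinhq_ramp// /ramp max_r// subr_ge0.
    rewrite /sinhq /ramp max_l ?ifT; [|lra|lra].
    rewrite realC0 subrr (_ : (fun r => _) = fun=> 0) ?intC0 ?mulr0//.
    by apply/funext => r; case: ifP => // /andP[h1 h2]; have := lt_trans (lt_trans h1 h2) ys; rewrite ltxx.
  set I := intC leb (fun r => if s < r < y then _ else _).
  rewrite (_ : Q s * _ = c ^+ 2 * ((Q s * eker s) * I)); last by ring.
  congr (_ * _); rewrite /I -intCZ.
    congr intC; apply/funext => r; rewrite /F /=.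
    have [rs|sr] := leP r s.
      by rewrite /sinhq subr_le0 rs mul0r !mulr0 if_same.
    by rewrite (le_lt_trans s0 sr) /=; case: ifP => _; rewrite ?mulr0//; ring.
  apply: (itgC_dom (r := fun r : RT => if 0 < r < y then b * S else 0)).
  - apply: mfunC_if; last exact: mfunC_cst.
      by measurable_tac.
    apply: mfunCM; first by apply: mfunC_real; measurable_tac.
    by apply: (mfunC_comp (h := fun r : RT => (r, s : RT)) mS); measurable_tac.
  - exact: integrable_if (@cont_cst _ (b * S)).
  - move=> r; case: ifP => [/andP[sr ry]|_].
      rewrite (le_lt_trans s0 sr) ry /= norm1MC ler_pM ?norm1_ge0//.
        by rewrite ger0_norm; lra.
      by apply: SB; lra.
    by rewrite norm1_0; case: ifP => _ //; rewrite mulr_ge0.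
rewrite splitE mulrDr rampE H FE [LHS]eker_sinhq//; ring.
Qed.
End transform.

(** * Lebesgue measure with point masses at the nodes *)

Section node_measure.
Variable R : realType.
Local Notation RT := (measurableTypeR R).
Variables (N : nat) (x : nat -> R).

(** The interaction at x_k, for 0 < k <= N, is the unit mass at x_k; the mass
    at x_0 = 0 carries the parameter h of the initial slope. *)
Definition nodes_mass : set RT -> \bar R :=
  msum (fun k => \d_(x k : RT) : {measure set RT -> \bar R}) N.+1.
HB.instance Definition _ := Measure.on nodes_mass.

Definition nodem : set RT -> \bar R := measure_add leb nodes_mass.
HB.instance Definition _ := Measure.on nodem.

Lemma nodem_sigma_finite : sigma_finite setT nodem.
Proof.
have [F FT Fm] := @sigma_finiteT _ _ _ (@lebesgue_measure R).
exists F => // n; have [mF F_oo] := Fm n; split => //.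
have -> : nodem (F n) = (leb (F n) + nodes_mass (F n))%E by exact: measure_addE.
apply: lte_add_pinfty => //.
rewrite /nodes_mass /msum; apply: lte_sum_pinfty => k _.
by rewrite /= diracE ltry.
Qed.
HB.instance Definition _ :=
  @Measure_isSigmaFinite.Build _ _ _ nodem nodem_sigma_finite.

Lemma itg_nodes_mass (r : RT -> R) : measurable_fun setT r ->
  itg nodes_mass r /\ (\int[nodes_mass]_s (r s)%:E)%E = (\sum_(k < N.+1) r (x k))%:E.
Proof.
move=> mr.
have mr' : measurable_fun setT (EFin \o r) by exact/measurable_EFinP.
have ge0 (g : RT -> \bar R) : (forall s, 0 <= g s)%E -> measurable_fun setT g ->
  (\int[nodes_mass]_s g s = \sum_(k < N.+1) g (x k))%E.
  move=> g0 mg; rewrite ge0_integral_measure_sum//; apply: eq_bigr => k _.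
  by rewrite integral_dirac// diracT mul1e.
split.
  apply/integrableP; split => //.
  rewrite ge0//; last exact: measurableT_comp.
  by apply: lte_sum_pinfty => k _; rewrite /= ltry.
rewrite integralE ge0//; last exact: measurable_funepos.
rewrite ge0//; last exact: measurable_funeneg.
rewrite -[in RHS]sumEFin.
have -> : (\sum_(k < N.+1) (r (x k))%:E =
   \sum_(k < N.+1) ((EFin \o r)^\+ (x k) - (EFin \o r)^\- (x k)))%E.
  apply: eq_bigr => k _.
  exact: (congr1 (fun g => g (x k)) (funeposneg (EFin \o r))).
have pE k : (EFin \o r)^\+%E (x k) = (Num.max (r (x k)) 0)%:E.
  by rewrite funeposE /= EFin_max.
have nE k : (EFin \o r)^\-%E (x k) = (Num.max (- r (x k)) 0)%:E.
  by rewrite funenegE /= EFin_max.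
under eq_bigr do rewrite pE.
under [in X in (_ - X)%E]eq_bigr do rewrite nE.
under [RHS]eq_bigr do rewrite pE nE -EFinB.
by rewrite !sumEFin -EFinB sumrB.
Qed.

Hypothesis x_incr : forall i j, (i < j <= N)%N -> x i < x j.

Lemma node_neq (i j : 'I_N.+1) : i != j -> x i != x j.
Proof.
move=> ij; apply/eqP => xij; have [ij'|ji] := ltnP i j.
  by have := @x_incr i j; rewrite ij' -ltnS ltn_ord xij ltxx => /(_ isT).
have ji' : (j < i)%N by rewrite ltn_neqAle ji andbT eq_sym.
by have := @x_incr j i; rewrite ji' -ltnS ltn_ord xij ltxx => /(_ isT).
Qed.

Definition isnode (s : R) := [exists k : 'I_N.+1, s == x k].

Lemma itg_point (a c : R) : itg leb (fun s => if s == a then c else 0) /\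
  \int[leb]_s (if s == a then c else 0) = 0.
Proof.
have mA : measurable [set (a : RT)] by exact: measurable_set1.
have l0 : (leb : {measure set RT -> \bar R}) [set (a : RT)] = 0%E :=
   lebesgue_measure_set1 a.
have E : (fun s => if s == a then c else 0) = (fun s => c * \1_[set (a : RT)] s).
  apply/funext => s; rewrite indicE.
  have [->|/eqP sa] := eqVneq s a; first by rewrite mem_set// mulr1.
  by rewrite memNset// mulr0.
have i1 : itg leb (\1_[set (a : RT)] : RT -> R).
  apply/integrableP; split.
    by apply/measurable_EFinP; exact: measurable_indic.
  rewrite (eq_integral (fun s => (\1_[set (a : RT)] s)%:E)); last first.
    by move=> s _; rewrite gee0_abs// lee_fin.
  by rewrite integral_indic// setIT l0 ltry.
rewrite E; split; first exact: itgZ.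
by rewrite RintegralZl// /Rintegral integral_indic// setIT l0 mulr0.
Qed.

(** An integrand prescribed separately at the nodes: r0 is what Lebesgue
    measure sees, while the masses see the values of r. *)
Lemma itg_nodem (r r0 : RT -> R) :
  (forall s, ~~ isnode s -> r s = r0 s) -> itg leb r0 ->
  itg nodem r /\ \int[nodem]_s r s = \int[leb]_s r0 s + \sum_(k < N.+1) r (x k).
Proof.
move=> rr0 i0.
pose dk (k : 'I_N.+1) s := if s == x k then r (x k) - r0 (x k) else 0.
have rE : r = fun s => r0 s + \sum_(k < N.+1) dk k s.
  apply/funext => s; have [/existsP[k /eqP ->]|ns] := boolP (isnode s).
    rewrite (bigD1 k)//= big1 ?addr0; last first.
      move=> j jk; rewrite /dk ifF//; apply/negbTE.
      by rewrite eq_sym; exact: node_neq.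
    by rewrite /dk eqxx addrC subrK.
  rewrite rr0// big1 ?addr0// => k _; rewrite /dk ifF//; apply/negbTE.
  by move: ns; rewrite negb_exists => /forallP.
have [iS IS] : itg leb (fun s => \sum_(k < N.+1) dk k s) /\
    \int[leb]_s (\sum_(k < N.+1) dk k s) = 0.
  elim: (index_enum _) => [|k l [h1 h2]].
    under eq_fun do rewrite big_nil.
    by split; [exact: integrable0|rewrite /Rintegral integral0].
  have [p1 p2] := itg_point (x k) (r (x k) - r0 (x k)).
  under eq_fun do rewrite big_cons.
  by split; [exact: itgD|rewrite RintegralD// h2 p2 addr0].
have il : itg leb r by rewrite rE; exact: itgD.
have Il : \int[leb]_s r s = \int[leb]_s r0 s.
  by rewrite rE RintegralD// IS addr0.
have mr := itg_meas il.
have [in_ In] := itg_nodes_mass mr.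
split.
  apply/integrableP; split; first exact/measurable_EFinP.
  rewrite ge0_integral_measure_add//; last first.
    by apply: measurableT_comp => //; exact/measurable_EFinP.
  by apply: lte_add_pinfty; [case/integrableP: il|case/integrableP: in_].
rewrite {1}/Rintegral integral_measure_add// In -Il.
by rewrite -[X in (X + _)%E]fineK ?itg_fin_num.
Qed.

Lemma itgC_nodem (r r0 : RT -> R[i]) :
  (forall s, ~~ isnode s -> r s = r0 s) -> itgC leb r0 ->
  itgC nodem r /\ intC nodem r = intC leb r0 + \sum_(k < N.+1) r (x k).
Proof.
move=> h [i1 i2].
have [] := itg_nodem (r := fun s => complex.Re (r s)) _ i1.
  by move=> s /h ->.
move=> a1 b1.
have [] := itg_nodem (r := fun s => complex.Im (r s)) _ i2.
  by move=> s /h ->.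
move=> a2 b2; split => //.
apply: complex_ext; rewrite !reimE.
  rewrite [LHS]b1; congr (_ + _).
  by elim/big_rec2: _ => // i u v _ ->; rewrite reimE.
rewrite [LHS]b2; congr (_ + _).
by elim/big_rec2: _ => // i u v _ ->; rewrite reimE.
Qed.
End node_measure.

(** * Weights and the vanishing of homogeneous Volterra solutions *)

Section potential.
Variable R : realType.
Local Notation RT := (measurableTypeR R).
Variables (b : R) (N : nat) (x : nat -> R) (al : nat -> R[i]).
Variable q0 : RT -> R[i].
Hypothesis b_gt0 : 0 < b.
Hypothesis x_incr : forall i j, (i < j <= N)%N -> x i < x j.
Hypothesis xb : forall k, (k <= N)%N -> 0 <= x k < b.
Hypothesis mq : mfunC q0.
Hypothesis q2 : itg leb (fun s => norm1 (q0 s) ^+ 2).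
Hypothesis qsupp : forall s : R, ~~ (0 < s < b) -> q0 s = 0.

(** The density of the potential with respect to [nodem]: al at the nodes, q0
    elsewhere. Since the nodes are Lebesgue null, redefining q0 there costs
    nothing, and one density serves both parts of the measure. *)
Definition nodeQ (s : RT) : R[i] :=
  if isnode N x s then \sum_(k < N.+1) (if s == x k then al k else 0) else q0 s.

Lemma nodeQ_node (k : 'I_N.+1) : nodeQ (x k) = al k.
Proof.
rewrite /nodeQ ifT; last by apply/existsP; exists k.
rewrite (bigD1 k)//= eqxx big1 ?addr0// => j jk.
by rewrite ifF//; apply/negbTE; rewrite eq_sym; exact: (node_neq x_incr).
Qed.

Lemma nodeQ_off s : ~~ isnode N x s -> nodeQ s = q0 s.
Proof. by rewrite /nodeQ => /negbTE ->. Qed.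

Lemma nodeQ_supp (s : R) : ~~ (0 <= s < b) -> nodeQ s = 0.
Proof.
move=> sb; rewrite nodeQ_off; last first.
  apply: contra sb => /existsP[k /eqP ->]; apply: xb.
  by rewrite -ltnS.
apply: qsupp; apply: contra sb => /andP[s0 ->].
by rewrite (ltW s0).
Qed.

(** Square integrable on a bounded interval, hence integrable, by
    n <= 1 + n^2. *)
Lemma itg_q : itg leb (fun s => norm1 (q0 s)).
Proof.
have i1 := integrable_if 0 b (@cont_cst _ 1).
apply: le_itg (itgD i1 q2); first exact: mfunC_norm1.
move=> s; rewrite ger0_norm ?norm1_ge0//=.
have [sb|/qsupp ->] := boolP (0 < s < b); last by rewrite norm1_0 expr0n addr0.
by have := sqr_ge0 (norm1 (q0 s) - 1); rewrite sqrrB expr1n mulr1;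
  have := norm1_ge0 (q0 s); lra.
Qed.

Lemma itgC_q : itgC leb q0.
Proof. exact: itgC_dom mq itg_q _. Qed.

Lemma itgC_qbd (f : RT -> R[i]) (A : R) : mfunC f -> 0 <= A ->
  (forall s : R, 0 < s < b -> norm1 (f s) <= A) -> itgC leb (fun s => q0 s * f s).
Proof.
move=> mf A0 fA; apply: (itgC_dom (r := fun s : RT => A * norm1 (q0 s))).
- exact: mfunCM.
- exact: itgZ itg_q.
- move=> s; have [/fA h|/qsupp ->] := boolP (0 < s < b).
    by rewrite (le_trans (norm1M _ _))// mulrC ler_wpM2r// norm1_ge0.
  by rewrite mul0r norm1_0 mulr0.
Qed.

Lemma itgC_nodeQ : itgC (nodem N x) nodeQ.
Proof. by have [] := itgC_nodem x_incr nodeQ_off itgC_q. Qed.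

Lemma int_nodeQ (f : RT -> R[i]) : itgC leb (fun s => q0 s * f s) ->
  intC (nodem N x) (fun s => nodeQ s * f s) =
  intC leb (fun s => q0 s * f s) + \sum_(k < N.+1) al k * f (x k).
Proof.
move=> iqf.
have [|_ ->] := itgC_nodem (r := fun s => nodeQ s * f s) x_incr _ iqf.
  by move=> s ns; rewrite nodeQ_off.
by congr (_ + _); apply: eq_bigr => k _; rewrite nodeQ_node.
Qed.

Section weight.
Variables (ga Mm : R).
Hypothesis ga0 : 0 <= ga.
Hypothesis Mm1 : 1 <= Mm.

(** A factor gained on passing each node absorbs the point masses. *)
Definition jumps (y : R) : R := \prod_(k < N.+1) (if x k < y then Mm else 1).
Definition clamp (y : R) : R := Num.max 0 (Num.min y b).
(** The exponential handles the absolutely continuous part and [jumps] the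
    masses; clamping the argument keeps the weight bounded on the line. *)
Definition weight (y : RT) : R := expR (ga * clamp y) * jumps y.

Lemma clamp_bd y : 0 <= clamp y <= b.
Proof.
by rewrite /clamp le_max lexx /= ge_max (ltW b_gt0) ge_min lexx orbT.
Qed.

Lemma clampE y : 0 <= y <= b -> clamp y = y.
Proof. by move=> /andP[y0 yb]; rewrite /clamp min_l// max_r. Qed.

Lemma jumps_ge1 y : 1 <= jumps y.
Proof.
rewrite /jumps; elim/big_ind: _ => [//|u v u1 v1|k _].
  exact: mulr_ege1.
by case: ifP.
Qed.

Lemma jumps_gt0 y : 0 < jumps y.
Proof. exact: lt_le_trans ltr01 (jumps_ge1 y). Qed.

Lemma jumps_mono s y : s <= y -> jumps s <= jumps y.
Proof.
move=> sy; apply: ler_prod => k _; apply/andP; split.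
  by case: ifP => // _; exact: le_trans Mm1.
case: ifP => xs; last by case: ifP.
by rewrite (lt_le_trans xs sy).
Qed.

Lemma jumps_node (k : 'I_N.+1) y : x k < y -> jumps (x k) * Mm <= jumps y.
Proof.
move=> xy; rewrite /jumps (bigD1 k)//= ltxx mul1r mulrC [leRHS](bigD1 k)//= xy.
rewrite ler_wpM2l//; first exact: le_trans Mm1.
apply: ler_prod => j _; apply/andP; split.
  by case: ifP => // _; exact: le_trans Mm1.
case: ifP => xs; last by case: ifP.
by rewrite (lt_trans xs xy).
Qed.

Lemma jumps_le y : jumps y <= Mm ^+ N.+1.
Proof.
rewrite -[X in Mm ^+ X]card_ord -prodr_const; apply: ler_prod => k _.
by case: ifP => _; rewrite ?lexx ?Mm1 ?ler01 ?(le_trans ler01 Mm1).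
Qed.

Lemma weight_ge1 y : 1 <= weight y.
Proof.
rewrite /weight -[leLHS]mul1r ler_pM// ?jumps_ge1//.
rewrite -expR0 ler_expR mulr_ge0//.
by have /andP[] := clamp_bd y.
Qed.

Lemma weight_le y : weight y <= expR (ga * b) * Mm ^+ N.+1.
Proof.
rewrite /weight ler_pM ?expR_ge0 ?jumps_le ?(ltW (jumps_gt0 _))//.
by rewrite ler_expR ler_wpM2l//; have /andP[] := clamp_bd y.
Qed.

Lemma measurable_weight : measurable_fun setT weight.
Proof.
apply: measurable_funM.
  apply: (measurableT_comp (f := expR)) => //.
  apply: measurable_funM; first exact: measurable_cst.
  apply: measurable_maxr; first exact: measurable_cst.
  by apply: measurable_minr; measurable_tac.
apply: measurable_prod => k _; apply: measurable_fun_ifT; try exact: measurable_cst.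
by apply: measurable_fun_ltr; measurable_tac.
Qed.

(** Gains a factor 1 / (2 ga): a steep exponential makes the integral over the
    past of y small relative to its value at y. *)
Lemma int_exp_le y : 0 < ga -> 0 <= y ->
  \int[leb]_s (if 0 < s < y then expR (2 * ga * s - 2 * ga * y) else 0) <= (2 * ga)^-1.
Proof.
move=> g0 y0.
have hd (t : R) : is_derive t (1 : R) (fun s : R => (2 * ga)^-1 * expR (2 * ga * s + - (2 * ga * y)))
    (expR (2 * ga * t - 2 * ga * y)).
  have h := is_derive_compR (is_derive_aff (2 * ga) (- (2 * ga * y)) t)
    (is_derive_expR (2 * ga * t + - (2 * ga * y))).
  have h2 := is_derive_compR h (is_derive_lin (2 * ga)^-1 _).
  apply: is_derive_val h2 _; rewrite mulrCA mulVf ?mulr1//.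
  by rewrite mulf_neq0 ?lt0r_neq0.
have cf : continuous (fun s => expR (2 * ga * s - 2 * ga * y)).
  have hc t := is_derive_compR (is_derive_aff (2 * ga) (- (2 * ga * y)) t)
    (is_derive_expR (2 * ga * t + - (2 * ga * y))).
  exact: is_derive_continuous hc.
rewrite (FTC2R y0 hd cf) subrr expR0 mulr1 gerBl mulr_ge0 ?expR_ge0// invr_ge0.
by rewrite mulr_ge0.
Qed.

End weight.

(** By the inequality 2 n E <= ep n^2 + E^2 / ep with n = |q0(s)| and
    E = exp(ga (s - y)), the continuous part is at most
    w(y) (ep / 2 |q0|_2^2 + 1 / (4 ep ga)), which is small for small ep and then
    large ga. At a node x_k < y the weight is at most w(y) / Mm, so the masses
    contribute at most A w(y) / Mm, small for large Mm. Neither bound asks that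
    the potential be small. *)
Lemma weight_exists (C : R) : 0 <= C -> exists (w : RT -> R) (Wm : R), [/\ measurable_fun setT w,
  forall y : RT, 1 <= w y, forall y : RT, w y <= Wm &
  forall y : R, y <= b ->
  C * \int[nodem N x]_s (if s < y then norm1 (nodeQ s) * w s else 0) <= w y / 2].
Proof.
move=> C0.
pose G := \int[leb]_s (norm1 (q0 s) ^+ 2).
have G0 : 0 <= G by apply: Rintegral_ge0 => s _; exact: sqr_ge0.
pose A := \sum_(k < N.+1) norm1 (al k).
have A0 : 0 <= A by apply: sumr_ge0 => k _; exact: norm1_ge0.
pose ep : R := (4 * (C + 1) * (G + 1))^-1.
pose ga : R := 2 * (C + 1) / ep.
pose Mm : R := 1 + 4 * C * A.
have ep0 : 0 < ep by rewrite invr_gt0 !mulr_gt0//; lra.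
have ga0 : 0 < ga by rewrite divr_gt0// mulr_gt0//; lra.
have Mm1 : 1 <= Mm by rewrite lerDl !mulr_ge0.
have Mm0 : 0 < Mm by lra.
exists (weight ga Mm), (expR (ga * b) * Mm ^+ N.+1).
have mw := measurable_weight ga Mm.
have w1 := weight_ge1 (ltW ga0) Mm1.
have wM := weight_le (ltW ga0) Mm1.
split => // y yb.
have w0 s : 0 <= weight ga Mm s by exact: le_trans (w1 s).
have [y0|y0] := leP y 0.
  rewrite (_ : (fun s => _) = fun=> 0).
    by rewrite /Rintegral integral0 mulr0 divr_ge0.
  apply/funext => s; case: ltP => // sy; rewrite nodeQ_supp ?norm1_0 ?mul0r//.
  by rewrite leNgt (lt_le_trans sy y0).
have yb' : 0 <= y <= b by rewrite (ltW y0).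
have wyE : weight ga Mm y = expR (ga * y) * jumps Mm y by rewrite /weight clampE.
have J0 : 0 < jumps Mm y := jumps_gt0 Mm1 y.
pose r0 s := if s < y then norm1 (q0 s) * weight ga Mm s else 0.
have ir0 : itg leb r0.
  apply: (le_itg (s := fun s : RT => expR (ga * b) * Mm ^+ N.+1 * norm1 (q0 s))).
  - apply: measurable_fun_ifT; last exact: measurable_cst.
      by apply: measurable_fun_ltr; measurable_tac.
    by apply: measurable_funM => //; exact: mfunC_norm1.
  - move=> s; rewrite /r0; case: ifP => _; last first.
      by rewrite normr0 !mulr_ge0 ?expR_ge0 ?norm1_ge0 ?exprn_ge0// ltW.
    rewrite ger0_norm; last exact: mulr_ge0 (norm1_ge0 _) (w0 s).
    by rewrite mulrC ler_wpM2r ?norm1_ge0.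
  - exact: itgZ itg_q.
have [|_ ->] := itg_nodem (r := fun s => if s < y then norm1 (nodeQ s) * weight ga Mm s else 0)
  x_incr _ ir0.
  by move=> s ns; rewrite nodeQ_off.
pose ex s := if 0 < s < y then expR (2 * ga * s - 2 * ga * y) else 0.
have iex : itg leb ex.
  apply: integrable_if.
  have hc t := is_derive_compR (is_derive_aff (2 * ga) (- (2 * ga * y)) t)
    (is_derive_expR (2 * ga * t + - (2 * ga * y))).
  exact: is_derive_continuous hc.
(* The part carried by Lebesgue measure. *)
have H1 : \int[leb]_s r0 s <= weight ga Mm y * (ep / 2 * G + ep^-1 / 2 * (2 * ga)^-1).
  pose ub s := weight ga Mm y * (ep / 2 * norm1 (q0 s) ^+ 2 + ep^-1 / 2 * ex s).
  have iub : itg leb ub by apply: itgZ; apply: itgD; exact: itgZ.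
  have -> : weight ga Mm y * (ep / 2 * G + ep^-1 / 2 * (2 * ga)^-1) =
     weight ga Mm y * (ep / 2 * G) + weight ga Mm y * (ep^-1 / 2 * (2 * ga)^-1) by ring.
  apply: (@le_trans _ _ (\int[leb]_s ub s)).
    apply: le_Rintegral => // s _; rewrite /r0 /ub /ex.
    have e0 := expR_ge0 (2 * ga * s - 2 * ga * y).
    have n0 := norm1_ge0 (q0 s).
    have q20 := sqr_ge0 (norm1 (q0 s)).
    case: ltP => sy; last first.
      by rewrite andbF mulr0 addr0 !mulr_ge0// ltW.
    have [s0|s0] := ltP 0 s; last first.
      rewrite qsupp; last by rewrite ltNge s0.
      by rewrite norm1_0 mul0r /= mulr0 addr0 expr0n mulr0 mulr0.
    have sb' : 0 <= s <= b by rewrite (ltW s0) (le_trans (ltW sy)).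
    rewrite /= {1}/weight (clampE sb') wyE.
    have Js := jumps_mono Mm1 (ltW sy).
    have Js0 := jumps_gt0 Mm1 s.
    have -> : expR (ga * s) = expR (ga * y) * expR (ga * s - ga * y).
      by rewrite -expRD addrC subrK.
    have -> : expR (2 * ga * s - 2 * ga * y) = expR (ga * s - ga * y) ^+ 2.
      by rewrite expr2 -expRD; congr expR; ring.
    set E := expR (ga * s - ga * y); set n := norm1 (q0 s).
    have E0 : 0 <= E := expR_ge0 _.
    have amgm := young n E ep0.
    have -> : n * (expR (ga * y) * E * jumps Mm s) = (expR (ga * y) * jumps Mm s) * (n * E) by ring.
    by rewrite ler_pM ?mulr_ge0 ?expR_ge0// ?ler_wpM2l ?expR_ge0// ltW.
  rewrite RintegralZl//; last by apply: itgD; exact: itgZ.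
  rewrite RintegralD//; [|exact: itgZ|exact: itgZ].
  rewrite !RintegralZl// -/G -mulrDr ler_wpM2l// lerD2l ler_wpM2l//.
    by rewrite divr_ge0// invr_ge0 ltW.
  by apply: int_exp_le => //; exact: ltW.
(* The part carried by the masses. *)
have H2 : \sum_(k < N.+1) (if x k < y then norm1 (nodeQ (x k)) * weight ga Mm (x k) else 0)
    <= A * (weight ga Mm y / Mm).
  rewrite /A mulr_suml; apply: ler_sum => k _; case: ifP => xy; last first.
    by rewrite mulr_ge0 ?norm1_ge0// divr_ge0// ltW.
  rewrite nodeQ_node ler_wpM2l ?norm1_ge0// ler_pdivlMr//.
  have kb : 0 <= x k <= b.
    have /andP[h1 h2] : 0 <= x k < b by apply: xb; rewrite -ltnS.
    by rewrite h1 ltW.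
  rewrite {1}/weight (clampE kb) wyE -mulrA ler_pM ?expR_ge0//.
  - by apply: mulr_ge0; apply: ltW => //; exact: jumps_gt0.
  - by rewrite ler_expR ler_wpM2l ?(ltW ga0)// ltW.
  - exact: jumps_node.
set W := weight ga Mm y in H1 H2 *.
have W0 : 0 < W by exact: lt_le_trans (w1 y).
have C1n : C + 1 != 0 by apply: lt0r_neq0; lra.
have G1n : G + 1 != 0 by apply: lt0r_neq0; lra.
have epn : ep != 0 by exact: lt0r_neq0.
(* The choices of ep and ga make each of the two terms at most
   1 / (8 (C + 1)), and that of Mm makes the masses contribute 1 / 4. *)
have K1 : C * (ep / 2 * G + ep^-1 / 2 * (2 * ga)^-1) <= 1 / 4.
  have e1 : ep^-1 / 2 * (2 * ga)^-1 = (8 * (C + 1))^-1.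
    by rewrite /ga; field; rewrite ?C1n ?epn.
  have e2 : ep / 2 * G <= (8 * (C + 1))^-1.
    have -> : ep / 2 * G = (8 * (C + 1))^-1 * (G / (G + 1)).
      by rewrite /ep; field; apply/andP; split; apply: lt0r_neq0; lra.
    rewrite ler_piMr//; first by rewrite invr_ge0 mulr_ge0//; lra.
    by rewrite ler_pdivrMr; lra.
  rewrite e1; apply: (@le_trans _ _ (C * ((8 * (C + 1))^-1 + (8 * (C + 1))^-1))).
    by rewrite ler_wpM2l// lerD2r.
  have -> : C * ((8 * (C + 1))^-1 + (8 * (C + 1))^-1) = 4^-1 * (C / (C + 1)).
    by field; apply: lt0r_neq0; lra.
  rewrite div1r ler_piMr//.
  by rewrite ler_pdivrMr; lra.
have K2 : C * (A / Mm) <= 1 / 4.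
  have -> : C * (A / Mm) = (C * A) / Mm by ring.
  rewrite ler_pdivrMr// /Mm; lra.
rewrite mulrDr.
have := ler_wpM2l C0 H1; have := ler_wpM2l C0 H2.
have := ler_wpM2r (ltW W0) K1; have := ler_wpM2r (ltW W0) K2.
set u := \int[leb]_s r0 s; set v := \sum_(k < N.+1) _.
have -> : C * (A * (W / Mm)) = C * (A / Mm) * W by ring.
have -> : C * (W * (ep / 2 * G + ep^-1 / 2 * (2 * ga)^-1)) = C * (ep / 2 * G + ep^-1 / 2 * (2 * ga)^-1) * W by ring.
by lra.
Qed.

(** If |d| <= a w then the equation gives |d| <= (a / 2) w, so d = 0. *)
Lemma gronwall (d : RT -> R[i]) (A : R) : mfunC d -> 0 <= A ->
  (forall s : R, 0 <= s <= b -> norm1 (d s) <= A) ->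
  (forall y : R, 0 <= y <= b ->
     d y = intC (nodem N x) (fun s => nodeQ s * ((ramp (y - s))%:C * d s))) ->
  forall y : R, 0 <= y <= b -> d y = 0.
Proof.
move=> md A0 dA dE.
have [w [Wm [mw w1 wM wC]]] := weight_exists (ltW b_gt0).
have w0 s : 0 <= w s by exact: le_trans (w1 s).
have Qi := itgC_nodeQ; have Qm := itgC_meas Qi.
have it y (yb : 0 <= y <= b) : itgC (nodem N x) (fun s => nodeQ s * ((ramp (y - s))%:C * d s)).
  apply: (itgC_Qbd Qi nodeQ_supp (A := b * A)) => //.
  - apply: mfunCM => //; apply: mfunC_real.
    by apply: measurable_maxr; measurable_tac.
  - by rewrite mulr_ge0// ltW.
  - move=> s /andP[s0 sb]; rewrite norm1MC ler_pM ?norm1_ge0 ?dA ?s0 ?(ltW sb)//.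
    move: yb => /andP[y0 yb].
    by rewrite /ramp ger0_norm ?le_max ?lexx// ge_max (ltW b_gt0) /=; lra.
have iw y : itg (nodem N x) (fun s => if s < y then norm1 (nodeQ s) * w s else 0).
  exact: (itg_Qw Qi mw w1 wM).
have step n : forall y : R, 0 <= y <= b -> norm1 (d y) <= A * 2^-1 ^+ n * w y.
  elim: n => [|n IH] y yb.
    by rewrite expr0 mulr1 (le_trans (dA _ yb))// ler_peMr.
  have a0 : 0 <= A * 2^-1 ^+ n by rewrite mulr_ge0// exprn_ge0.
  have dom s : norm1 (nodeQ s * ((ramp (y - s))%:C * d s)) <=
     (A * 2^-1 ^+ n * b) * (if s < y then norm1 (nodeQ s) * w s else 0).
    apply: (Q_out nodeQ_supp (P := fun z => z <= _)); last first.
      rewrite !mulr_ge0 ?exprn_ge0// ?(ltW b_gt0)//.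
      by case: ifP => // _; rewrite mulr_ge0 ?norm1_ge0.
    move=> /andP[s0 sb]; rewrite (le_trans (norm1M _ _))// norm1MC.
    case: ltP => sy; last first.
      by rewrite /ramp max_l ?normr0 ?mul0r ?mulr0//; lra.
    have -> : A * 2^-1 ^+ n * b * (norm1 (nodeQ s) * w s) =
      norm1 (nodeQ s) * (b * (A * 2^-1 ^+ n * w s)) by ring.
    rewrite ler_wpM2l ?norm1_ge0// ler_pM ?norm1_ge0 ?IH ?s0 ?(ltW sb)//.
    move: yb => /andP[y0 yb].
    by rewrite /ramp ger0_norm ?le_max ?lexx// ge_max (ltW b_gt0) /=; lra.
  rewrite dE// (le_trans (norm1_intC (it _ yb) (itgZ _ (iw y)) dom))//.
  rewrite RintegralZl// exprSr.
  have /andP[_ yb2] := yb.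
  by have := ler_wpM2l a0 (wC _ yb2); lra.
move=> y yb; apply: norm1_eq0; apply: (@geometric_small _ _ (A * w y)) => n.
by rewrite mulrAC; exact: step.
Qed.
End potential.

(** * Smoothed ramps *)

Section smooth.
Variable R : realType.

(** Differentiability from an explicit error bound, which is how derivatives
    of integrals are obtained here. *)
Lemma is_derive_modulus (f : R -> R) (x l : R) :
  (forall eps : R, 0 < eps -> exists2 dl : R, 0 < dl &
     forall h, `|h| < dl -> `|f (x + h) - f x - l * h| <= eps * `|h|) ->
  is_derive x 1 f l.
Proof.
move=> H.
have fl : (h^-1 *: ((f \o shift x) (h *: (1 : R)) - f x)) @[h --> 0^'] --> (l : R).
  apply/cvgrPdist_le => /= eps eps0.
  have [dl dl0 Hd] := H _ eps0.
  near=> h.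
  have h0 : h != 0 by near: h; exact: nbhs_dnbhs_neq.
  have hd : `|h| < dl.
    near: h; apply: dnbhs0_lt; exact: dl0.
  have := Hd _ hd; rewrite /shift /= /GRing.scale /= mulr1 => Hh.
  rewrite -(ler_pM2r (_ : 0 < `|h|)) ?normr_gt0//.
  apply: le_trans Hh; rewrite -normrM mulrBl mulrAC mulVf// mul1r.
  by rewrite distrC (addrC h x).
apply: DeriveDef; first exact: (cvgP _ fl).
by apply: cvg_lim => //.
Unshelve. all: by end_near. Qed.

(** The functions x^-n exp(-1/x), continued by zero. They are closed under
    differentiation up to linear combinations, and flat of infinite order at 0. *)
Definition flat (n : nat) (x : R) : R := if 0 < x then x^-1 ^+ n * expR (- x^-1) else 0.

(** One term of the exponential series: y^(n+2) <= (n+2)! exp y for y = 1/x. *)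
Lemma flat_bound n x : `|flat n x| <= n.+2`!%:R * x ^+ 2.
Proof.
rewrite /flat; case: ltP => x0; last first.
  by rewrite normr0 mulr_ge0// sqr_ge0.
have v0 : 0 < x^-1 by rewrite invr_gt0.
rewrite ger0_norm; last by rewrite mulr_ge0 ?expR_ge0// exprn_ge0// ltW.
rewrite expRN ler_pdivrMr ?expR_gt0//.
have := expR_ge1Dxn n.+1 (ltW v0) => h.
have f0 : 0 < (n.+2`!%:R : R) by rewrite ltr0n fact_gt0.
have {}h : x^-1 ^+ n.+2 / n.+2`!%:R <= expR x^-1 by lra.
apply: (@le_trans _ _ (n.+2`!%:R * x ^+ 2 * (x^-1 ^+ n.+2 / n.+2`!%:R))); last first.
  by rewrite ler_wpM2l// mulr_ge0 ?sqr_ge0// ltW.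
have -> : n.+2`!%:R * x ^+ 2 * (x^-1 ^+ n.+2 / n.+2`!%:R) = x^-1 ^+ n * (x * x^-1) ^+ 2.
  by rewrite !exprS expr0; field; rewrite !lt0r_neq0.
by rewrite mulfV ?lt0r_neq0// expr1n mulr1.
Qed.

Lemma is_derive_flat n (x : R) :
  is_derive x 1 (flat n) (flat n.+2 x - n%:R * flat n.+1 x).
Proof.
have [x0|x0|x0] := ltgtP 0 x.
- have hI : is_derive x 1 (fun y : R => y^-1) (- x ^- 2).
    have := is_deriveV (lt0r_neq0 x0) (is_derive_id x (1 : R)).
    by move=> h; apply: is_derive_val h _; rewrite /GRing.scale /= mulr1.
  have hE : is_derive x 1 (fun y : R => expR (- y^-1)) (expR (- x^-1) * x ^- 2).
    have h1 := is_derive_compR hI (is_derive_lin (-1) x^-1).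
    have h2 := is_derive_compR h1 (is_derive_expR (-1 * x^-1)).
    have : is_derive x 1 (fun y : R => expR (-1 * y^-1)) (expR (- x^-1) * x ^- 2).
      by apply: is_derive_val h2 _; rewrite !mulN1r opprK.
    by congr is_derive; apply/funext => y; rewrite mulN1r.
  have hP : is_derive x 1 (fun y : R => y^-1 ^+ n) (- n%:R * x^-1 ^+ n.+1).
    elim: (n) => [|k IH].
      rewrite (_ : (fun y => _) = fun=> 1); last by apply/funext => y; rewrite expr0.
      by rewrite oppr0 mul0r; exact: is_derive_cst.
    rewrite (_ : (fun y => _) = fun y => y^-1 * y^-1 ^+ k); last first.
      by apply/funext => y; rewrite exprS.
    apply: is_derive_val (is_derive_mul hI IH) _.
    by rewrite -exprVn -natr1 !exprS expr0; ring.
  apply: (@near_eq_is_derive _ _ _ (fun y : R => y^-1 ^+ n * expR (- y^-1))).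
    near=> y; rewrite /flat ifT//; near: y; exact: lt_nbhsr.
  apply: is_derive_val (is_derive_mul hP hE) _.
  by rewrite /flat x0 -exprVn !exprS expr0; ring.
- apply: (@near_eq_is_derive _ _ _ (fun y : R => 0)).
    near=> y; rewrite /flat ifF//; apply/negbTE; rewrite -leNgt ltW//.
    near: y; exact: lt_nbhsl.
  rewrite /flat ltNge (ltW x0) /= mulr0 subr0; exact: is_derive_cst.
- rewrite -x0 [flat n.+2 0]/flat [flat n.+1 0]/flat ltxx mulr0 subr0.
  apply: is_derive_modulus => eps e0.
  have f0 : 0 < (n.+2`!%:R : R) by rewrite ltr0n fact_gt0.
  exists (eps / n.+2`!%:R); first by rewrite divr_gt0.
  move=> h hd; rewrite add0r mul0r subr0 {2}/flat ltxx subr0.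
  rewrite (le_trans (flat_bound n h))// -real_normK ?num_real// expr2 mulrA.
  by rewrite ler_wpM2r// mulrC -ler_pdivlMr// ltW.
Unshelve. all: by end_near. Qed.

(** A class of functions closed under differentiation ([smooth_der]), so its
    members are infinitely differentiable without any computation of iterated
    derivatives. The constructors are those needed to build [sramp]. *)
Inductive smooth_fun : (R -> R) -> Prop :=
| smooth_flat n : smooth_fun (flat n)
| smooth_cst c : smooth_fun (fun _ => c)
| smooth_id : smooth_fun (fun s => s)
| smooth_add f g : smooth_fun f -> smooth_fun g -> smooth_fun (fun s => f s + g s)
| smooth_mul f g : smooth_fun f -> smooth_fun g -> smooth_fun (fun s => f s * g s)
| smooth_comp f a d : smooth_fun f -> smooth_fun (fun s => f (a * s + d))
| smooth_inv f : smooth_fun f -> (forall s, 0 < f s) -> smooth_fun (fun s => (f s)^-1).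

Lemma smooth_der f : smooth_fun f -> exists2 f', smooth_fun f' & forall s : R, is_derive s 1 f (f' s).
Proof.
elim=> {f} [n|c||f g sf [f' sf' Hf] sg [g' sg' Hg]|f g sf [f' sf' Hf] sg [g' sg' Hg]
  |f a d sf [f' sf' Hf]|f sf [f' sf' Hf] f0].
- exists (fun s => flat n.+2 s + (- n%:R) * flat n.+1 s).
    by apply: smooth_add (smooth_flat _) _; exact: smooth_mul (smooth_cst _) (smooth_flat _).
  by move=> s; rewrite mulNr; exact: is_derive_flat.
- by exists (fun=> 0); [exact: smooth_cst|move=> s; exact: is_derive_cst].
- by exists (fun=> 1); [exact: smooth_cst|move=> s; exact: is_derive_id].
- by exists (fun s => f' s + g' s); [exact: smooth_add|move=> s; exact: is_derive_add].
- exists (fun s => f' s * g s + f s * g' s); last by move=> s; exact: is_derive_mul.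
  by apply: smooth_add; exact: smooth_mul.
- exists (fun s => f' (a * s + d) * a).
    by apply: smooth_mul (smooth_cst _); exact: smooth_comp.
  by move=> s; exact: is_derive_compR (is_derive_aff a d s) (Hf _).
- exists (fun s => (- (1)) * (f' s * ((f s)^-1 * (f s)^-1))).
    apply: smooth_mul (smooth_cst _) _; apply: smooth_mul => //.
    by apply: smooth_mul; exact: smooth_inv.
  move=> s; have := is_deriveV (lt0r_neq0 (f0 s)) (Hf s).
  move=> h; apply: is_derive_val h _.
  by rewrite /GRing.scale /= mulN1r mulNr mulrC expr2 invfM.
Qed.

Lemma derive1_fun (f f' : R -> R) : (forall s : R, is_derive s 1 f (f' s)) -> derive1 f = f'.
Proof. by move=> h; apply/funext => s; rewrite derive1E; have [_ ->] := h s. Qed.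

Lemma smooth_derive1n f n : smooth_fun f -> smooth_fun (derive1n n f).
Proof.
move=> sf; elim: n => [|n IH] //; rewrite derive1nS.
by have [f' sf' /derive1_fun ->] := smooth_der IH.
Qed.

Lemma smooth_derivable f n (y : R) : smooth_fun f -> derivable (derive1n n f) y 1.
Proof. by move=> /smooth_derive1n-/(_ n)/smooth_der[f' _ /(_ y)[]]. Qed.

Lemma smooth_continuous f : smooth_fun f -> continuous f.
Proof. by move=> /smooth_der[f' _ h]; exact: is_derive_continuous h. Qed.

Lemma flat_pos s : 0 < s -> 0 < flat 0 s.
Proof. by move=> s0; rewrite /flat s0 expr0 mul1r expR_gt0. Qed.

Lemma flat0 s : s <= 0 -> flat 0 s = 0.
Proof. by move=> s0; rewrite /flat ltNge s0. Qed.

Lemma flat_ge0 s : 0 <= flat 0 s.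
Proof. by rewrite /flat; case: ifP => // _; rewrite expr0 mul1r expR_ge0. Qed.

Let den s := flat 0 (1 * s + 1) + flat 0 (-1 * s + 1).

Lemma den_gt0 s : 0 < den s.
Proof.
rewrite /den mul1r mulN1r; have := flat_ge0 (s + 1); have := flat_ge0 (- s + 1).
have [h|h] := ltP 0 (s + 1); first by have := flat_pos h; lra.
have : 0 < - s + 1 by lra.
by move=> /flat_pos; lra.
Qed.

(** A smooth step from 0 for s <= -1 to 1 for s >= 1: at each s at least one of
    the two terms of [den] is positive. *)
Definition step (s : R) : R := flat 0 (1 * s + 1) * (den s)^-1.
(** A smooth function equal to the ramp outside [-1, 1]. Its second derivative
    is therefore an approximate identity after rescaling. *)
Definition sramp (s : R) : R := s * step s.

Lemma smooth_sramp : smooth_fun sramp.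
Proof.
apply: smooth_mul; first exact: smooth_id.
apply: smooth_mul; first by apply: (smooth_comp 1 1); exact: smooth_flat.
apply: smooth_inv; last exact: den_gt0.
by apply: smooth_add; apply: smooth_comp; exact: smooth_flat.
Qed.

Lemma sramp_left s : s <= -1 -> sramp s = 0.
Proof. by move=> h; rewrite /sramp /step flat0 ?mul0r ?mulr0//; lra. Qed.

Lemma sramp_right s : 1 <= s -> sramp s = s.
Proof.
move=> h; have e0 : flat 0 (-1 * s + 1) = 0 by apply: flat0; lra.
rewrite /sramp /step /den e0 addr0 mulfV ?mulr1//.
by apply/lt0r_neq0/flat_pos; lra.
Qed.

Lemma step_bd s : 0 <= step s <= 1.
Proof.
have d0 := den_gt0 s; rewrite /step divr_ge0 ?flat_ge0 ?(ltW d0)//=.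
by rewrite ler_pdivrMr// [1 * den s]mul1r /den lerDl flat_ge0.
Qed.

Lemma sramp_dist s : `|sramp s - Num.max 0 s| <= 1.
Proof.
have [h1|h1] := leP s (-1).
  by rewrite sramp_left// max_l ?subrr ?normr0//; lra.
have [h2|h2] := leP 1 s.
  by rewrite sramp_right// max_r ?subrr ?normr0//; lra.
have /andP[s0 s1] := step_bd s; rewrite /sramp ler_norml.
by case: (leP 0 s) => h; apply/andP; split; nra.
Qed.

(** All that is used of the derivatives: the second one is bounded, supported
    in [-1, 1], and has integral b1 2 - b1 (-2) = 1. *)
Lemma sramp_derivs : exists (b1 b2 : R -> R) (B : R), [/\ 0 <= B,
  (forall s : R, is_derive s 1 sramp (b1 s)), (forall s : R, is_derive s 1 b1 (b2 s)),
  smooth_fun b1 /\ smooth_fun b2 & [/\ forall s, 1 < `|s| -> b2 s = 0, forall s, `|b2 s| <= B,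
  b1 (-2) = 0 & b1 2 = 1]].
Proof.
have [b1 sb1 h1] := smooth_der smooth_sramp.
have [b2 sb2 h2] := smooth_der sb1.
have b1l (s : R) : s < -1 -> b1 s = 0.
  move=> sl; have : is_derive s 1 sramp 0.
    apply: (@near_eq_is_derive _ _ _ (fun y : R => 0)).
      near=> y; rewrite sramp_left// ltW//; near: y; exact: lt_nbhsl.
  by move=> [_ <-]; have [_ ->] := h1 s.
have b1r (s : R) : 1 < s -> b1 s = 1.
  move=> sl; have : is_derive s 1 sramp 1.
    apply: (@near_eq_is_derive _ _ _ (fun y : R => y)).
      near=> y; rewrite sramp_right// ltW//; near: y; exact: lt_nbhsr.
  by move=> [_ <-]; have [_ ->] := h1 s.
have b2out (s : R) : 1 < `|s| -> b2 s = 0.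
  rewrite ltr_normr => /orP[sr|sl].
    have : is_derive s 1 b1 0.
      have c1 : is_derive s 1 (fun _ : R => 1 : R) 0 by exact: is_derive_cst.
      apply: near_eq_is_derive c1.
        near=> y; rewrite b1r//; near: y; exact: lt_nbhsr.
    by move=> [_ <-]; have [_ ->] := h2 s.
  have {}sl : s < -1 by lra.
  have : is_derive s 1 b1 0.
    apply: (@near_eq_is_derive _ _ _ (fun y : R => 0)).
      near=> y; rewrite b1l//; near: y; exact: lt_nbhsl.
  by move=> [_ <-]; have [_ ->] := h2 s.
have cn : continuous (fun s => `|b2 s|).
  by move=> s; apply: continuous_comp; [exact: smooth_continuous|exact: norm_continuous].
have m11 : -1 <= 1 :> R by lra.
have [z _ zB] := EVT_max m11 (continuous_subspaceT cn).
exists b1, b2, `|b2 z|; split => //; split => //.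
- move=> s; have [s1|s1] := leP `|s| 1; last by rewrite b2out// normr0.
  by apply: zB; rewrite in_itv /= -ler_norml.
- by apply: b1l; lra.
- by apply: b1r; lra.
Unshelve. all: by end_near. Qed.
End smooth.

(** * Second differences of weak solutions *)

Section threepoint.
Variable R : realType.
Local Notation RT := (measurableTypeR R).

(** Rescaling by ep makes the error of the smoothed ramp at most ep. *)
Lemma ramp_dist (ep p s : R) : 0 < ep ->
  `|ep * sramp (ep^-1 * s + - (ep^-1 * p)) - ramp (s - p)| <= ep.
Proof.
move=> e0; have -> : ramp (s - p) = ep * Num.max 0 (ep^-1 * s + - (ep^-1 * p)).
  rewrite maxr_pMr ?(ltW e0)// mulr0 /ramp; congr (Num.max _ _).
  by rewrite mulrDr mulrN !mulrA mulfV ?lt0r_neq0// !mul1r.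
rewrite -mulrBr normrM gtr0_norm// ler_piMr ?(ltW e0)//; exact: sramp_dist.
Qed.

Lemma three_point_le (th L A1 A2 A3 : R) : 0 <= th <= 1 -> `|A1| <= L -> `|A2| <= L ->
  `|A3| <= L -> `|th * A1 - A2 + (1 - th) * A3| <= 2 * L.
Proof.
move=> /andP[t0 t1] h1 h2 h3.
have k1 : `|th * A1| <= th * L by rewrite normrM ger0_norm// ler_wpM2l.
have t1' : 0 <= 1 - th by rewrite subr_ge0.
have k3 : `|(1 - th) * A3| <= (1 - th) * L by rewrite normrM ger0_norm// ler_wpM2l.
move: k1 h2 k3; rewrite !ler_norml => /andP[a1 a2] /andP[b1 b2] /andP[c1 c2].
by apply/andP; split; lra.
Qed.

Variables (l r : R) (u v : R -> R).
Hypothesis iu : itg leb (fun s => if l < s < r then u s else 0).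
Hypothesis iv : itg leb (fun s => if l < s < r then v s else 0).
Hypothesis cu : forall p eta : R, l < p < r -> 0 < eta -> exists2 dl : R, 0 < dl &
  forall s, `|s - p| < dl -> `|u s - u p| <= eta.
Hypothesis hw : forall phi, test_function l r phi ->
  \int[leb]_s (if l < s < r then u s * derive1n 2 phi s else 0) =
  \int[leb]_s (if l < s < r then v s * phi s else 0).

Lemma itg_in_mul (f g : R -> R) (B : R) :
  itg leb (fun s => if l < s < r then f s else 0) -> measurable_fun setT g ->
  (forall s, l < s < r -> `|g s| <= B) ->
  itg leb (fun s => if l < s < r then f s * g s else 0).
Proof.
move=> i_f mg gB; apply: (le_itg (s := fun s : RT => B * `|if l < s < r then f s else 0|)).
- rewrite (_ : (fun s => _) = (fun s : RT => (if l < s < r then f s else 0) * g s)); last first.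
    by apply/funext => s; case: ifP => // _; rewrite mul0r.
  by apply: measurable_funM => //; exact: itg_meas i_f.
- move=> s; case: ifP => h; last by rewrite normr0 mulr0.
  by rewrite normrM mulrC ler_wpM2r ?gB.
- by apply: itgZ; exact: itg_norm.
Qed.

Section derivs.
Variables (b1 b2 : R -> R) (B : R).
Hypothesis B0 : 0 <= B.
Hypothesis hb1 : forall s : R, is_derive s 1 (@sramp R) (b1 s).
Hypothesis hb2 : forall s : R, is_derive s 1 b1 (b2 s).
Hypothesis sb2 : smooth_fun b2.
Hypothesis b2out : forall s, 1 < `|s| -> b2 s = 0.
Hypothesis b2B : forall s, `|b2 s| <= B.
Hypothesis b1l : b1 (-2) = 0.
Hypothesis b1r : b1 2 = 1.

(** The second derivative of the smoothed ramp at p: a mollifier at p, not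
    necessarily of one sign. *)
Let kern (ep p s : R) := ep^-1 * b2 (ep^-1 * s + - (ep^-1 * p)).

Lemma kern_cont ep p : continuous (kern ep p).
Proof.
by apply: smooth_continuous; apply: smooth_mul (smooth_cst _) _; exact: smooth_comp.
Qed.

(** The mollifier has mass 1, is bounded by B / ep and lives on a window of
    length 4 ep, so it averages u near p up to 4 B times the oscillation of u
    there. *)
Lemma kern_approx (p eta : R) : l < p < r -> 0 < eta -> exists2 e0 : R, 0 < e0 &
  forall ep, 0 < ep < e0 ->
   `|\int[leb]_s (if l < s < r then u s * kern ep p s else 0) - u p| <= eta.
Proof.
move=> plr eta0; pose et : R := eta / (4 * B + 1).
have B41 : 0 < 4 * B + 1 by rewrite ltr_wpDl// mulr_ge0.
have et0 : 0 < et by rewrite divr_gt0.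
have [dl dl0 Hd] := cu plr et0; have /andP[lp pr] := plr.
(* The window of half-width 2 ep must fit in (l, r) and in the ball of
   radius dl where u varies by at most et. *)
pose e0 := Num.min (dl / 2) (Num.min ((p - l) / 2) ((r - p) / 2)).
exists e0; first by rewrite !lt_min !divr_gt0//; lra.
move=> ep /andP[ep0]; rewrite !lt_min => /and3P[ed el er].
have epn : ep != 0 by exact: lt0r_neq0.
pose win (s : R) := p - 2 * ep < s < p + 2 * ep.
have kout (s : R) : ~~ win s -> kern ep p s = 0.
  move=> ws; rewrite /kern b2out ?mulr0//.
  rewrite -mulrBr normrM gtr0_norm ?invr_gt0// mulrC ltr_pdivlMr// mul1r.
  apply: contraR ws; rewrite -leNgt ler_norml => /andP[h1 h2].
  by apply/andP; split; lra.
have h1 : \int[leb]_s (if l < s < r then u s * kern ep p s else 0) =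
    \int[leb]_s (if win s then u s * kern ep p s else 0).
  apply: eq_Rintegral => s _; have [ws|ws] := boolP (win s).
    by rewrite ifT//; move: ws => /andP[a1 a2]; apply/andP; split; lra.
  by rewrite kout// mulr0 if_same.
have kint : \int[leb]_s (if win s then kern ep p s else 0) = 1.
  have le : p - 2 * ep <= p + 2 * ep by lra.
  have hd (s : R) : is_derive s 1 (fun s => b1 (ep^-1 * s + - (ep^-1 * p))) (kern ep p s).
    apply: is_derive_val (is_derive_compR (is_derive_aff ep^-1 (- (ep^-1 * p)) s) (hb2 _)) _.
    by rewrite mulrC.
  have x1 : ep^-1 * (p + 2 * ep) + - (ep^-1 * p) = 2 by field.
  have x2 : ep^-1 * (p - 2 * ep) + - (ep^-1 * p) = -2 by field.
  by rewrite (FTC2R le hd (@kern_cont ep p)) x1 x2 b1l b1r subr0.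
have iw : itg leb (fun s => if win s then u s * kern ep p s else 0).
  have := itg_in_mul iu (continuous_measurable_fun (@kern_cont ep p)) (B := ep^-1 * B).
  have kb s : l < s < r -> `|kern ep p s| <= ep^-1 * B.
    by move=> _; rewrite /kern normrM gtr0_norm ?invr_gt0// ler_wpM2l// invr_ge0 ltW.
  move=> /(_ kb); apply: eq_integrable => // s _; congr _%:E.
  have [ws|ws] := boolP (win s).
    by rewrite ifT//; move: ws => /andP[a1 a2]; apply/andP; split; lra.
  by rewrite kout// mulr0 if_same.
have ik : itg leb (fun s => if win s then kern ep p s else 0).
  exact: integrable_if (@kern_cont ep p).
have -> : u p = \int[leb]_s (u p * (if win s then kern ep p s else 0)).
  by rewrite RintegralZl// kint mulr1.
rewrite h1 -RintegralB//; last exact: itgZ.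
have ic : itg leb (fun s => if win s then et * (ep^-1 * B) else 0).
  exact: integrable_if (@cont_cst _ _).
have id : itg leb (fun s => (if win s then u s * kern ep p s else 0) -
   u p * (if win s then kern ep p s else 0)) by apply: itgB => //; exact: itgZ.
apply: (le_trans (le_normr_Rintegral measurableT id)).
apply: (@le_trans _ _ (\int[leb]_s (if win s then et * (ep^-1 * B) else 0))).
  apply: le_Rintegral => //; first exact: itg_norm.
  move=> s _; case: ifP => ws; last by rewrite mulr0 subr0 normr0.
  rewrite -mulrBl normrM ler_pM//; last first.
    by rewrite /kern normrM gtr0_norm ?invr_gt0// ler_wpM2l// invr_ge0 ltW.
  apply: Hd; rewrite ltr_norml; move: ws => /andP[a1 a2]; apply/andP; split; lra.
have le : p - 2 * ep <= p + 2 * ep by lra.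
rewrite (FTC2R le (fun s => is_derive_lin (et * (ep^-1 * B)) s) (@cont_cst _ _)).
have -> : et * (ep^-1 * B) * (p + 2 * ep) - et * (ep^-1 * B) * (p - 2 * ep) = et * (4 * B).
  by field.
rewrite /et mulrAC ler_pdivrMr; last lra.
by rewrite ler_wpM2l; lra.
Qed.

Variables (a c th : R).
Hypothesis la : l < a.
Hypothesis ac : a < c.
Hypothesis cr : c < r.
Hypothesis th01 : 0 <= th <= 1.
Let mid := th * a + (1 - th) * c.

Let comb (f : R -> R) := th * f a - f mid + (1 - th) * f c.

(** The second difference of three smoothed ramps. Since mid is the mean of a
    and c with weights th and 1 - th, the affine parts cancel to the right of
    c, which makes it compactly supported. *)
Let phi (ep s : R) := th * (ep * sramp (ep^-1 * s + - (ep^-1 * a))) +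
  ((-1) * (ep * sramp (ep^-1 * s + - (ep^-1 * mid))) +
  (1 - th) * (ep * sramp (ep^-1 * s + - (ep^-1 * c)))).

Lemma mid_bd : a <= mid <= c.
Proof.
have /andP[t0 t1] := th01; have ca : 0 <= c - a by rewrite subr_ge0 ltW.
have h1 : 0 <= (1 - th) * (c - a) by rewrite mulr_ge0// subr_ge0.
have h2 : 0 <= th * (c - a) by rewrite mulr_ge0.
by rewrite /mid; apply/andP; split; lra.
Qed.

Lemma phi_test (ep : R) : 0 < ep -> ep < a - l -> ep < r - c -> test_function l r (phi ep).
Proof.
move=> e0 ea ec; split.
  move=> n y; apply: smooth_derivable.
  have s1 p : smooth_fun (fun s => ep * sramp (ep^-1 * s + - (ep^-1 * p))).
    by apply: smooth_mul (smooth_cst _) _; apply: smooth_comp; exact: smooth_sramp.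
  by apply: smooth_add; [|apply: smooth_add]; exact: smooth_mul (smooth_cst _) _.
have /andP[am mc] := mid_bd.
exists (a - ep), (c + ep); split; [lra|lra|].
have epn : ep != 0 by exact: lt0r_neq0.
move=> y; apply: contraR; rewrite negb_and -!ltNge => yo.
have out p : (y < p - ep -> ep * sramp (ep^-1 * y + - (ep^-1 * p)) = 0) /\
   (p + ep < y -> ep * sramp (ep^-1 * y + - (ep^-1 * p)) = y - p).
  have -> : ep^-1 * y + - (ep^-1 * p) = (y - p) / ep by field.
  split=> h.
    by rewrite sramp_left ?mulr0// ler_pdivrMr//; lra.
  rewrite sramp_right; first by rewrite mulrC divfK.
  by rewrite ler_pdivlMr//; lra.
apply/eqP; move: yo => /orP[ya|yc]; rewrite /phi.
  rewrite (out a).1//; rewrite (out mid).1; last lra.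
  by rewrite (out c).1; [rewrite !mulr0 !addr0|lra].
rewrite (out c).2//; rewrite (out mid).2; last lra.
rewrite (out a).2; last lra.
by rewrite /mid; ring.
Qed.

Lemma phi_derive2 (ep : R) : 0 < ep -> derive1n 2 (phi ep) =
  fun s => th * kern ep a s + ((-1) * kern ep mid s + (1 - th) * kern ep c s).
Proof.
move=> e0; have epn : ep != 0 by exact: lt0r_neq0.
have d1 p (s : R) : is_derive s 1 (fun s => ep * sramp (ep^-1 * s + - (ep^-1 * p)))
    (b1 (ep^-1 * s + - (ep^-1 * p))).
  have h := is_derive_compR (is_derive_aff ep^-1 (- (ep^-1 * p)) s) (hb1 _).
  apply: is_derive_val (is_derive_compR h (is_derive_lin ep _)) _.
  by rewrite mulrCA mulfV ?mulr1.
have d2 p (s : R) : is_derive s 1 (fun s => b1 (ep^-1 * s + - (ep^-1 * p))) (kern ep p s).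
  apply: is_derive_val (is_derive_compR (is_derive_aff ep^-1 (- (ep^-1 * p)) s) (hb2 _)) _.
  by rewrite mulrC.
have lin (f g : R -> R) (k s : R) : is_derive s 1 f (g s) -> is_derive s 1 (fun s => k * f s) (k * g s).
  by move=> h; exact: is_derive_compR h (is_derive_lin k _).
rewrite derive1nS derive1n1.
have -> : derive1 (phi ep) = (fun s => th * b1 (ep^-1 * s + - (ep^-1 * a)) +
  ((-1) * b1 (ep^-1 * s + - (ep^-1 * mid)) + (1 - th) * b1 (ep^-1 * s + - (ep^-1 * c)))).
  by apply: derive1_fun.
by apply: derive1_fun.
Qed.

(** The test function [phi ep] has as second derivative a combination of three
    mollifiers, and itself tends uniformly to the combination of ramps. *)
Lemma three_point_aux :
  comb u = \int[leb]_s (if l < s < r then v s * comb (fun p => ramp (s - p)) else 0).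
Proof.
have /andP[am mc] := mid_bd; have /andP[t0 t1] := th01.
have la' := la; have ac' := ac; have cr' := cr.
set I := \int[leb]_s _.
pose V := \int[leb]_s `|if l < s < r then v s else 0|.
have V0 : 0 <= V by apply: Rintegral_ge0.
have mramp p : measurable_fun setT (fun s : RT => ramp (s - p)).
  by apply: measurable_maxr; measurable_tac.
have rb (p s : R) : l < p < r -> l < s < r -> `|ramp (s - p)| <= r - l.
  move=> /andP[p1 p2] /andP[s1 s2].
  by rewrite ger0_norm ?le_max ?lexx// ge_max; apply/andP; split; lra.
have mcomb : measurable_fun setT (fun s : RT => comb (fun p => ramp (s - p))).
  rewrite /comb; apply: measurable_funD.
    apply: measurable_funB => //.
    by apply: measurable_funM => //; exact: measurable_cst.
  by apply: measurable_funM => //; exact: measurable_cst.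
have icomb : itg leb (fun s => if l < s < r then v s * comb (fun p => ramp (s - p)) else 0).
  apply: (itg_in_mul (B := 2 * (r - l)) iv mcomb) => s sr.
  have ra : `|ramp (s - a)| <= r - l by apply: rb => //; apply/andP; split; lra.
  have rm : `|ramp (s - mid)| <= r - l by apply: rb => //; apply/andP; split; lra.
  have rc : `|ramp (s - c)| <= r - l by apply: rb => //; apply/andP; split; lra.
  exact: three_point_le.
(* Each of the three mollifications and the smoothing of the ramps is made
   accurate to within eta. *)
have H (eta : R) : 0 < eta -> `|comb u - I| <= eta * (2 + 2 * V).
  move=> eta0.
  have [e1 e10 H1] : exists2 e0 : R, 0 < e0 & forall ep, 0 < ep < e0 ->
    `|\int[leb]_s (if l < s < r then u s * kern ep a s else 0) - u a| <= eta.
    by apply: kern_approx => //; apply/andP; split; lra.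
  have [e2 e20 H2] : exists2 e0 : R, 0 < e0 & forall ep, 0 < ep < e0 ->
    `|\int[leb]_s (if l < s < r then u s * kern ep mid s else 0) - u mid| <= eta.
    by apply: kern_approx => //; apply/andP; split; lra.
  have [e3 e30 H3] : exists2 e0 : R, 0 < e0 & forall ep, 0 < ep < e0 ->
    `|\int[leb]_s (if l < s < r then u s * kern ep c s else 0) - u c| <= eta.
    by apply: kern_approx => //; apply/andP; split; lra.
  pose e0 := Num.min (Num.min e1 (Num.min e2 e3)) (Num.min eta (Num.min (a - l) (r - c))).
  have e00 : 0 < e0 by rewrite !lt_min e10 e20 e30 eta0 /=; apply/andP; split; lra.
  pose ep : R := e0 / 2.
  have ep0 : 0 < ep by rewrite divr_gt0.
  have : ep < e0 by rewrite /ep; lra.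
  rewrite !lt_min => /andP[/and3P[l1 l2 l3] /and3P[l4 l5 l6]].
  have {}H1 := H1 ep; have {}H2 := H2 ep; have {}H3 := H3 ep.
  rewrite ep0 l1 in H1; rewrite ep0 l2 in H2; rewrite ep0 l3 in H3.
  have {}H1 := H1 isT; have {}H2 := H2 isT; have {}H3 := H3 isT.
  have := hw (phi_test ep0 l5 l6); rewrite phi_derive2//.
  have ik p : itg leb (fun s => if l < s < r then u s * kern ep p s else 0).
    apply: (itg_in_mul (B := ep^-1 * B) iu (continuous_measurable_fun (@kern_cont ep p))).
    by move=> s _; rewrite /kern normrM gtr0_norm ?invr_gt0// ler_wpM2l// invr_ge0 ltW.
  have -> : \int[leb]_s (if l < s < r then u s * (th * kern ep a s + ((-1) * kern ep mid s + (1 - th) * kern ep c s)) else 0)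
   = th * \int[leb]_s (if l < s < r then u s * kern ep a s else 0) +
     ((-1) * \int[leb]_s (if l < s < r then u s * kern ep mid s else 0) +
      (1 - th) * \int[leb]_s (if l < s < r then u s * kern ep c s else 0)).
    rewrite -!RintegralZl// -RintegralD//; [|exact: itgZ|exact: itgZ].
    rewrite -RintegralD//; [|exact: itgZ|by apply: itgD; exact: itgZ].
    by apply: eq_Rintegral => s _; case: ifP => _; ring.
  set A1 := \int[leb]_s _ in H1 *; set A2 := \int[leb]_s _ in H2 *.
  set A3 := \int[leb]_s _ in H3 *.
  move=> E.
  have iphi : itg leb (fun s => if l < s < r then v s * phi ep s else 0).
    have h0 (p s : R) : `|ep * sramp (ep^-1 * s + - (ep^-1 * p))| <= `|ramp (s - p)| + ep.
      by have := @ramp_dist ep p s ep0; have := ler_distD (ep * sramp (ep^-1 * s + - (ep^-1 * p)))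
        0 (ramp (s - p)); have := ler_dist_dist (ep * sramp (ep^-1 * s + - (ep^-1 * p))) (ramp (s - p));
        rewrite ler_norml => /andP[_]; lra.
    apply: (itg_in_mul (B := 2 * (r - l + ep)) iv).
      apply: continuous_measurable_fun; apply: smooth_continuous.
      have s1 p : smooth_fun (fun s => ep * sramp (ep^-1 * s + - (ep^-1 * p))).
        by apply: smooth_mul (smooth_cst _) _; apply: smooth_comp; exact: smooth_sramp.
      by apply: smooth_add; [|apply: smooth_add]; exact: smooth_mul (smooth_cst _) _.
    move=> s sr.
    have ra : `|ramp (s - a)| <= r - l by apply: rb => //; apply/andP; split; lra.
    have rm : `|ramp (s - mid)| <= r - l by apply: rb => //; apply/andP; split; lra.
    have rc : `|ramp (s - c)| <= r - l by apply: rb => //; apply/andP; split; lra.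
    have {}ra := le_trans (h0 a s) (lerD ra (lexx ep)).
    have {}rm := le_trans (h0 mid s) (lerD rm (lexx ep)).
    have {}rc := le_trans (h0 c s) (lerD rc (lexx ep)).
    by have := three_point_le th01 ra rm rc; congr (`|_| <= _); rewrite /phi; ring.
  have D : `|\int[leb]_s (if l < s < r then v s * phi ep s else 0) - I| <= 2 * ep * V.
    rewrite /I -RintegralB//.
    have i1 := itgB iphi icomb.
    apply: (le_trans (le_normr_Rintegral measurableT i1)).
    rewrite /V -RintegralZl//; last exact: itg_norm.
    apply: le_Rintegral => //; [exact: itg_norm|by apply: itgZ; exact: itg_norm|].
    move=> s _; case: ifP => _; last by rewrite subr0 normr0 mulr0.
    rewrite -mulrBr normrM mulrC ler_wpM2r//.
    have := three_point_le th01 (ramp_dist a s ep0) (ramp_dist mid s ep0) (ramp_dist c s ep0).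
    by congr (`|_| <= _); rewrite /phi /comb; ring.
  have epV : ep * V <= eta * V by rewrite ler_wpM2r// ltW.
  have := three_point_le th01 H1 H2 H3; move: D; rewrite -E /comb !ler_norml.
  by move=> /andP[d1 d2] /andP[c1 c2]; apply/andP; split; lra.
apply/eqP; rewrite -subr_eq0 -normr_le0; apply/ler_addgt0Pr => e e0.
rewrite add0r; have k0 : 0 < 2 + 2 * V by lra.
have := H (e / (2 + 2 * V)) (divr_gt0 e0 k0).
by rewrite divfK// lt0r_neq0.
Qed.
End derivs.

(** The du Bois-Reymond lemma of second order for u'' = v, in integrated form:
    the second differences of u are those of a double primitive of v. It is
    obtained without constructing that primitive. *)
Lemma three_point (a c th : R) : l < a -> a < c -> c < r -> 0 <= th <= 1 ->
  th * u a - u (th * a + (1 - th) * c) + (1 - th) * u c =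
  \int[leb]_s (if l < s < r then v s * (th * ramp (s - a) -
     ramp (s - (th * a + (1 - th) * c)) + (1 - th) * ramp (s - c)) else 0).
Proof.
have [b1 [b2 [B [B0 h1 h2 [_ sb2] [bo Bb e1 e2]]]]] := @sramp_derivs R.
exact: (three_point_aux B0 h1 h2 sb2 bo Bb e1 e2).
Qed.
End threepoint.

(** * Ramps, affine functions and short windows *)

Section rampprops.
Variable R : realType.

Lemma ramp_lip (a d : R) : `|ramp a - ramp d| <= `|a - d|.
Proof.
rewrite /ramp; case: (leP 0 a) => a0; case: (leP 0 d) => d0;
  rewrite ?subrr ?normr0 ?subr0 ?sub0r ?normrN// !ler_norml.
  by have := ler_norm (a - d); have := normr_ge0 (a - d) => h1 h2; apply/andP; split; lra.
by have := ler_norm (- (a - d)); rewrite normrN => h2; apply/andP; split; lra.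
Qed.

Lemma ramp_opp (a : R) : ramp a = a + ramp (- a).
Proof.
by rewrite /ramp; case: (leP 0 a) => a0; case: (leP 0 (- a)) => d0; lra.
Qed.

Lemma ramp_pos (a : R) : 0 <= a -> ramp a = a.
Proof. by move=> a0; rewrite /ramp max_r. Qed.
Lemma ramp_neg (a : R) : a <= 0 -> ramp a = 0.
Proof. by move=> a0; rewrite /ramp max_l. Qed.

(** The affine function is read off at two interior points a and c; a third
    point y is then related to them according to which of the three lies
    between the others. *)
Lemma affine_of_three (l r : R) (F : R -> R) : l < r ->
  (forall a c th : R, l < a -> a < c -> c < r -> 0 <= th <= 1 ->
     F (th * a + (1 - th) * c) = th * F a + (1 - th) * F c) ->
  exists A B : R, forall y, l < y < r -> F y = A + B * y.
Proof.
move=> lr H.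
pose a := (2 * l + r) / 3; pose c := (l + 2 * r) / 3.
have la : l < a by rewrite /a; lra.
have ac : a < c by rewrite /a /c; lra.
have cr : c < r by rewrite /c; lra.
pose B := (F c - F a) / (c - a).
have can : c - a != 0 by rewrite subr_eq0 gt_eqF.
have BE : F c - F a = B * (c - a) by rewrite /B divfK.
exists (F a - B * a), B => y /andP[ly yr].
have [ya|ay] := ltP y a.
  have cy : c - y != 0 by rewrite subr_eq0 gt_eqF// (lt_trans ya ac).
  have cy0 : 0 < c - y by rewrite subr_gt0 (lt_trans ya ac).
  pose th := (c - a) / (c - y).
  have th01 : 0 <= th <= 1.
    by apply/andP; split; [rewrite divr_ge0//; lra|rewrite ler_pdivrMr//; lra].
  have := H y c th ly (lt_trans ya ac) cr th01.
  have -> : th * y + (1 - th) * c = a by rewrite /th; field.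
  move=> E.
  have th0 : th != 0 by rewrite mulf_neq0// invr_neq0.
  apply: (mulfI th0).
  have -> : th * F y = F a - (1 - th) * F c by rewrite E; ring.
  have -> : F c = F a + B * (c - a) by rewrite -BE; ring.
  have E2 : B * (th * (c - y)) = B * (c - a) by rewrite /th divfK.
  by lra.
have [yc|cy] := leP y c.
  pose th := (c - y) / (c - a).
  have ca0 : 0 < c - a by rewrite subr_gt0.
  have th01 : 0 <= th <= 1.
    by apply/andP; split; [rewrite divr_ge0//; lra|rewrite ler_pdivrMr//; lra].
  have := H a c th la ac cr th01.
  have -> : th * a + (1 - th) * c = y by rewrite /th; field.
  move=> ->; have -> : F c = F a + B * (c - a) by rewrite -BE; ring.
  have E2 : B * (th * (c - a)) = B * (c - y) by rewrite /th divfK.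
  by lra.
have ya0 : 0 < y - a by rewrite subr_gt0 (lt_trans ac cy).
have yan : y - a != 0 by exact: lt0r_neq0.
pose th := (y - c) / (y - a).
have th01 : 0 <= th <= 1.
  by apply/andP; split; [rewrite divr_ge0//; lra|rewrite ler_pdivrMr//; lra].
have := H a y th la (lt_trans ac cy) yr th01.
have -> : th * a + (1 - th) * y = c by rewrite /th; field.
move=> E.
have th1 : 1 - th != 0.
  have -> : 1 - th = (c - a) / (y - a) by rewrite /th; field.
  by rewrite mulf_neq0// invr_neq0.
apply: (mulfI th1).
have -> : (1 - th) * F y = F c - th * F a by rewrite E; ring.
have -> : F c = F a + B * (c - a) by rewrite -BE; ring.
have E2 : B * (th * (y - a)) = B * (y - c) by rewrite /th divfK.
by lra.
Qed.

(** Uniform continuity on [l, r], with non-strict bounds. *)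
Definition modulus_on (l r : R) (F : R -> R) := forall eps : R, 0 < eps ->
  exists2 dl : R, 0 < dl & forall s t, l <= s <= r -> l <= t <= r ->
    `|s - t| < dl -> `|F s - F t| <= eps.

Lemma affine_closure (l r A B : R) (F : R -> R) : l < r -> modulus_on l r F ->
  (forall y, l < y < r -> F y = A + B * y) ->
  forall y, l <= y <= r -> F y = A + B * y.
Proof.
move=> lr HF HA y /andP[ly yr].
apply/eqP; rewrite -subr_eq0 -normr_le0; apply/ler_addgt0Pr => e e0.
rewrite add0r.
have e2 : 0 < e / 2 by rewrite divr_gt0.
have [dl dl0 Hd] := HF _ e2.
have B0 : 0 < `|B| + 1 by rewrite ltr_wpDl.
pose d0 := Num.min (dl / 2) (Num.min (e / 2 / (`|B| + 1)) ((r - l) / 4)).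
have d00 : 0 < d0 by rewrite !lt_min !divr_gt0//= ?subr_gt0.
have : d0 <= d0 by [].
rewrite {2}/d0 !le_min => /and3P[h1 h2 h3].
have [z [lz zr yz]] : exists z, [/\ l < z, z < r & `|y - z| <= d0].
  have [ym|my] := leP y ((l + r) / 2).
    by exists (y + d0); split; [lra|lra|rewrite opprD addrA subrr sub0r normrN gtr0_norm].
  by exists (y - d0); split; [lra|lra|rewrite opprB addrC subrK gtr0_norm].
have k1 : `|F y - F z| <= e / 2.
  apply: Hd; [exact/andP|by rewrite (ltW lz) (ltW zr)|].
  by apply: (le_lt_trans yz); lra.
have k2 : `|B * (y - z)| <= e / 2.
  rewrite normrM (le_trans (_ : _ <= (`|B| + 1) * d0))//.
    by apply: ler_pM => //; lra.
  by move: h2; rewrite ler_pdivlMr// mulrC.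
have -> : F y - (A + B * y) = (F y - F z) - B * (y - z).
  by rewrite (HA z) ?lz//; ring.
by have := ler_normB (F y - F z) (B * (y - z)); lra.
Qed.

(** A majorant of |G|, by 2 |G| k <= G^2 + k^2 with k = (J + 1) / eps:
    its first term integrates to at most eps / 2 whatever the window, its
    second one is constant. *)
Lemma small_integral (G : R -> R) (eps : R) :
  itg leb (fun s => G s ^+ 2) -> 0 < eps ->
  exists2 dl : R, 0 < dl & forall a c : R, a <= c -> c - a <= dl ->
    \int[leb]_s (if a < s < c then eps / (2 * (\int[leb]_s (G s ^+ 2) + 1)) * G s ^+ 2
      + (\int[leb]_s (G s ^+ 2) + 1) / eps else 0) <= eps.
Proof.
move=> iG e0; set J := \int[leb]_s _.
have J0 : 0 <= J by apply: Rintegral_ge0 => s _; exact: sqr_ge0.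
have J1 : 0 < J + 1 by rewrite ltr_wpDl.
exists (eps / 2 * (eps / (J + 1))); first by rewrite mulr_gt0// divr_gt0.
move=> a c ac cad.
set k := eps / (2 * (J + 1)); set k' := (J + 1) / eps.
have k0 : 0 <= k by rewrite divr_ge0 ?mulr_ge0// ltW.
have k'0 : 0 <= k' by rewrite divr_ge0// ltW.
have ic : itg leb (fun s => if a < s < c then k' else 0) by exact: integrable_if (@cont_cst _ k').
have i2 := itgZ k iG.
apply: (@le_trans _ _ (\int[leb]_s (k * G s ^+ 2 + (if a < s < c then k' else 0)))).
  apply: le_Rintegral => //; last 2 first.
  - exact: itgD.
  - move=> s _; case: ifP => // _.
    by rewrite addr0 mulr_ge0// sqr_ge0.
  apply: (le_itg (s := fun s : measurableTypeR R => k * G s ^+ 2 + (if a < s < c then k' else 0))); last exact: itgD.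
    apply: measurable_fun_ifT; last exact: measurable_cst.
      by measurable_tac.
    apply: measurable_funD; last exact: measurable_cst.
    exact: itg_meas i2.
  move=> s; case: ifP => _; last by rewrite normr0 addr0 mulr_ge0// sqr_ge0.
  have h : 0 <= k * G s ^+ 2 + k'.
    by apply: addr_ge0 => //; apply: mulr_ge0 => //; exact: sqr_ge0.
  by rewrite ger0_norm.
rewrite RintegralD// RintegralZl//.
rewrite (FTC2R ac (fun s => is_derive_lin k' s) (@cont_cst _ k')) -mulrBr -/J.
have h1 : k * J <= eps / 2.
  rewrite /k; have -> : eps / (2 * (J + 1)) * J = eps / 2 * (J / (J + 1)).
    by field; exact: lt0r_neq0.
  by rewrite ler_piMr ?divr_ge0 ?(ltW e0)// ler_pdivrMr// mul1r lerDl.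
have h2 : k' * (c - a) <= eps / 2.
  have -> : eps / 2 = k' * (eps / 2 * (eps / (J + 1))).
    by rewrite /k'; field; rewrite !lt0r_neq0.
  by rewrite ler_wpM2l// divr_ge0// ltW.
by lra.
Qed.

(** Absolute continuity of the integral of a square integrable function, with
    an explicit modulus. *)
Lemma small_window (G : R -> R) (eps : R) : itg leb G ->
  itg leb (fun s => G s ^+ 2) -> 0 < eps ->
  exists2 dl : R, 0 < dl & forall a c : R, a <= c -> c - a <= dl ->
    \int[leb]_s (if a < s < c then `|G s| else 0) <= eps.
Proof.
move=> i1 i2 e0; have [dl dl0 H] := small_integral i2 e0.
exists dl => // a c ac cad; apply: le_trans (H a c ac cad).
set J := \int[leb]_s (G s ^+ 2).
have J0 : 0 <= J by apply: Rintegral_ge0 => s _; exact: sqr_ge0.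
have J1 : 0 < J + 1 by rewrite ltr_wpDl.
have mif (f : R -> R) : measurable_fun setT f ->
  measurable_fun setT (fun s : measurableTypeR R => if a < s < c then f s else 0).
  move=> mf; apply: measurable_fun_ifT => //.
  by measurable_tac.
apply: le_Rintegral => //.
- apply: (le_itg (s := fun s : measurableTypeR R => `|G s|)); last exact: itg_norm.
    by apply: mif; apply: measurableT_comp => //; exact: itg_meas i1.
  by move=> s; case: ifP => _; rewrite ?normr_id ?normr0.
- have ic : itg leb (fun s => if a < s < c then (J + 1) / eps else 0) by exact: integrable_if (@cont_cst _ _).
  apply: (le_itg (s := fun s : measurableTypeR R => eps / (2 * (J + 1)) * G s ^+ 2 + (if a < s < c then (J + 1) / eps else 0))).
  + apply: mif; apply: measurable_funD; last exact: measurable_cst.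
    exact: itg_meas (itgZ _ i2).
  + have k0 : 0 <= eps / (2 * (J + 1)) by rewrite divr_ge0 ?mulr_ge0// ltW.
    have k1 : 0 <= (J + 1) / eps by rewrite divr_ge0// ltW.
    move=> s; have q0 : 0 <= eps / (2 * (J + 1)) * G s ^+ 2.
      by apply: mulr_ge0 => //; exact: sqr_ge0.
    case: ifP => _; last by rewrite normr0 addr0.
    by rewrite ger0_norm// addr_ge0.
  + by apply: itgD => //; exact: itgZ.
- move=> s _; case: ifP => // _.
  have n0 := normr_ge0 (G s).
  rewrite -(real_normK (num_real (G s))).
  set n := `|G s| in n0 *; set k := (J + 1) / eps.
  have k0 : 0 < k by rewrite divr_gt0.
  have -> : eps / (2 * (J + 1)) = k^-1 / 2.
    by rewrite /k; field; rewrite !lt0r_neq0.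
  have ki : 0 < k^-1 by rewrite invr_gt0.
  have := young n 1 ki; rewrite mulr1 expr1n mulr1 invrK; lra.
Qed.
End rampprops.

(** * Piecewise weak solutions as ramp potentials *)

Section ramp_potential.
Variable R : realType.
Local Notation RT := (measurableTypeR R).
Variables (b : R) (G : RT -> R).
Hypothesis iG : itg leb G.
Hypothesis iG2 : itg leb (fun s => G s ^+ 2).
Hypothesis Gsupp : forall s : R, ~~ (0 < s < b) -> G s = 0.

(** The double primitive of G that vanishes with its derivative at 0; [rpot']
    is that derivative. *)
Definition rpot (y : R) := \int[leb]_s (ramp (y - s) * G s).
Definition rpot' (y : R) := \int[leb]_s (if s < y then G s else 0).

Let aG := itg_norm iG.

Lemma mramp (y : R) : measurable_fun setT (fun s : RT => ramp (y - s)).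
Proof. by apply: measurable_maxr; measurable_tac. Qed.

Lemma itg_bdG (k : R -> R) (A : R) : measurable_fun setT (k : RT -> R) ->
  (forall s, 0 < s < b -> `|k s| <= A) -> itg leb (fun s => k s * G s).
Proof.
move=> mk kA; apply: (le_itg (s := fun s : RT => A * `|G s|)).
- by apply: measurable_funM => //; exact: itg_meas iG.
- move=> s; have [sb|/Gsupp ->] := boolP (0 < s < b); last by rewrite mulr0 normr0 mulr0.
  by rewrite normrM ler_wpM2r// kA.
- exact: itgZ.
Qed.

Lemma itg_rpot y : itg leb (fun s => ramp (y - s) * G s).
Proof.
apply: (itg_bdG (k := fun s => ramp (y - s)) (A := `|y| + b) (mramp y)) => s /andP[s0 sb].
by rewrite ger0_norm ?le_max ?lexx// ge_max; have := ler_norm y; have := normr_ge0 y => h1 h2;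
  apply/andP; split; lra.
Qed.

Lemma itg_rpot' y : itg leb (fun s => if s < y then G s else 0).
Proof.
have := @itg_bdG (fun s => if s < y then 1 else 0) 1 _ _.
rewrite (_ : (fun s => _ * _) = (fun s => if s < y then G s else 0)); last first.
  by apply/funext => s; case: ifP => _; rewrite ?mul1r ?mul0r.
apply.
  apply: measurable_fun_ifT; [|exact: measurable_cst|exact: measurable_cst].
  by apply: measurable_fun_ltr; measurable_tac.
by move=> s _; case: ifP => _; rewrite ?normr1 ?normr0.
Qed.

Lemma itg_window a c : itg leb (fun s => if a < s < c then `|G s| else 0).
Proof.
apply: (le_itg (s := fun s : RT => `|G s|)) => //.
- apply: measurable_fun_ifT; last exact: measurable_cst.
    by measurable_tac.
  by apply: measurableT_comp => //; exact: itg_meas iG.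
- by move=> s; case: ifP => _; rewrite ?normr_id ?normr0.
Qed.

Lemma rpot_lip y z : `|rpot y - rpot z| <= `|y - z| * \int[leb]_s `|G s|.
Proof.
rewrite /rpot -RintegralB//; [|exact: itg_rpot|exact: itg_rpot].
have i1 := itgB (itg_rpot y) (itg_rpot z).
apply: (le_trans (le_normr_Rintegral measurableT i1)).
rewrite -RintegralZl//; apply: le_Rintegral => //; [exact: itg_norm|exact: itgZ|].
move=> s _; rewrite -mulrBl normrM ler_wpM2r//.
by rewrite (le_trans (ramp_lip _ _))// opprB addrA subrK.
Qed.

(** The ramp is differentiable off 0, and its difference quotient is exact
    outside a window of size |h| about 0. *)
Lemma ramp_diff (y h s : R) :
  `|ramp (y + h - s) - ramp (y - s) - h * (if s < y then 1 else 0)| <=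
  `|h| * (if y - 2 * `|h| < s < y + 2 * `|h| then 1 else 0).
Proof.
have [h0|hn0] := eqVneq h 0.
  by rewrite h0 addr0 subrr mul0r subr0 normr0 mul0r.
have ha : 0 < `|h| by rewrite normr_gt0.
have hh : h <= `|h| := ler_norm h.
have hh' : - h <= `|h| by rewrite -normrN ler_norm.
have [/andP[w1 w2]|w] := boolP (y - 2 * `|h| < s < y + 2 * `|h|).
  rewrite mulr1 ler_norml; case: (ltP s y) => sy; rewrite /ramp.
    rewrite (max_r (_ : 0 <= y - s)); last by lra.
    case: (leP 0 (y + h - s)) => k; apply/andP; split; lra.
  rewrite (max_l (_ : y - s <= 0)); last by lra.
  case: (leP 0 (y + h - s)) => k; apply/andP; split; lra.
rewrite mulr0; move: w; rewrite negb_and -!leNgt => /orP[w|w].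
  have sy : s < y by lra.
  by rewrite sy !ramp_pos; [rewrite mulr1 (_ : _ - _ = 0) ?normr0//; ring|lra|lra].
have sy : y <= s by lra.
by rewrite ltNge sy !ramp_neg; [rewrite mulr0 !subr0 normr0|lra|lra].
Qed.

(** Differentiation under the integral. G need not be continuous, so the kink
    of the ramp at s = y is controlled by the smallness of the integral of |G|
    over short windows. *)
Lemma is_derive_rpot (y : R) : is_derive y 1 rpot (rpot' y).
Proof.
apply: is_derive_modulus => eps e0.
have [dl dl0 H] := small_window iG iG2 e0.
exists (dl / 4); first by rewrite divr_gt0.
move=> h hd.
have h0 := normr_ge0 h.
have w1 : y - 2 * `|h| <= y + 2 * `|h| by lra.
have w2 : y + 2 * `|h| - (y - 2 * `|h|) <= dl by lra.
have i0 := itg_rpot' y.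
have -> : rpot' y * h = \int[leb]_s (h * (if s < y then G s else 0)).
  by rewrite RintegralZl// mulrC.
apply: (@le_trans _ _ (\int[leb]_s (`|h| *
    (if y - 2 * `|h| < s < y + 2 * `|h| then `|G s| else 0)))); last first.
  rewrite RintegralZl//; last exact: itg_window.
  by rewrite [leRHS]mulrC ler_wpM2l// H.
rewrite /rpot.
have i1 := itgB (itg_rpot (y + h)) (itg_rpot y).
rewrite -RintegralB//; [|exact: itg_rpot|exact: itg_rpot].
rewrite -RintegralB//; [|exact: itgZ].
have i2 := itgB i1 (itgZ h i0).
apply: (le_trans (le_normr_Rintegral measurableT i2)).
apply: le_Rintegral => //; [exact: itg_norm|by apply: itgZ; exact: itg_window|].
move=> s _.
have -> : ramp (y + h - s) * G s - ramp (y - s) * G s - h * (if s < y then G s else 0) =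
  (ramp (y + h - s) - ramp (y - s) - h * (if s < y then 1 else 0)) * G s.
  by case: ifP => _; ring.
rewrite normrM (le_trans (ler_wpM2r _ (ramp_diff y h s)))//.
by case: ifP => _; rewrite ?mulr1 ?mulr0 ?mul0r.
Qed.

Lemma rpot'_cont : continuous rpot'.
Proof.
move=> y; apply/cvgrPdist_le => /= eps e0.
have [dl dl0 H] := small_window iG iG2 e0.
near=> z.
have zd : `|y - z| < dl / 4.
  near: z; apply: cvgr_dist_lt; last by rewrite divr_gt0.
  exact: cvg_id.
have h0 := normr_ge0 (y - z).
have [->|yz] := eqVneq y z; first by rewrite subrr normr0 ltW.
have hp : 0 < `|y - z| by rewrite normr_gt0 subr_eq0.
have w1 : y - 2 * `|y - z| <= y + 2 * `|y - z| by lra.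
have w2 : y + 2 * `|y - z| - (y - 2 * `|y - z|) <= dl by lra.
apply: le_trans (H _ _ w1 w2).
rewrite /rpot' -RintegralB//; [|exact: itg_rpot'|exact: itg_rpot'].
have i1 := itgB (itg_rpot' y) (itg_rpot' z).
apply: (le_trans (le_normr_Rintegral measurableT i1)).
apply: le_Rintegral => //; [exact: itg_norm|exact: itg_window|].
move=> s _; have a1 := ler_norm (y - z); have a2 := ler_norm (- (y - z)).
rewrite normrN in a2.
case: (ltP s y) => sy; case: (ltP s z) => sz.
- by rewrite subrr normr0; case: ifP.
- by rewrite subr0 ifT//; apply/andP; split; lra.
- by rewrite sub0r normrN ifT//; apply/andP; split; lra.
- by rewrite subrr normr0; case: ifP.
Unshelve. all: by end_near. Qed.

Lemma rpot0 : rpot 0 = 0.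
Proof.
rewrite /rpot (_ : (fun s => _) = fun=> 0); first by rewrite /Rintegral integral0.
apply/funext => s; case: (leP s 0) => s0; last by rewrite ramp_neg ?mul0r//; lra.
by rewrite Gsupp ?mulr0// ltNge s0.
Qed.

Lemma rpot'0 : rpot' 0 = 0.
Proof.
rewrite /rpot' (_ : (fun s => _) = fun=> 0); first by rewrite /Rintegral integral0.
apply/funext => s; case: ltP => // s0.
by rewrite Gsupp// ltNge (ltW s0).
Qed.

End ramp_potential.

Section representation.
Variable R : realType.
Local Notation RT := (measurableTypeR R).
Variables (b : R) (G : RT -> R) (N : nat) (x a : nat -> R) (U : R -> R) (u0 c0 : R).
Hypothesis iG : itg leb G.
Hypothesis iG2 : itg leb (fun s => G s ^+ 2).
Hypothesis Gsupp : forall s : R, ~~ (0 < s < b) -> G s = 0.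
Hypothesis x_0 : x 0%N = 0.
Hypothesis x_N1 : x N.+1 = b.
Hypothesis x_incr : forall i j, (i < j <= N.+1)%N -> x i < x j.
Hypothesis U_mod : modulus_on 0 b U.
Hypothesis U3 : forall k, (k <= N)%N -> forall p r th : R,
  x k < p -> p < r -> r < x k.+1 -> 0 <= th <= 1 ->
  th * U p - U (th * p + (1 - th) * r) + (1 - th) * U r =
  \int[leb]_s ((th * ramp (s - p) - ramp (s - (th * p + (1 - th) * r)) +
     (1 - th) * ramp (s - r)) * G s).
Hypothesis Ujump : forall k, (0 < k <= N)%N -> exists dp dm : R,
  [/\ derive1 U y @[y --> (x k)^'+] --> dp,
      derive1 U y @[y --> (x k)^'-] --> dm & dp - dm = a k].
Hypothesis U'0 : derive1 U y @[y --> 0^'+] --> c0 + a 0%N.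
Hypothesis U00 : U 0 = u0.

Let nodes (y : R) : R := \sum_(j < N.+1) ramp (y - x j) * a j.
(** What remains of U after the potential of G and the kinks at the nodes are
    subtracted. It is to be identified with the affine function u0 + c0 y. *)
Let F (y : R) : R := U y - rpot G y - nodes y.

Lemma node_le i j : (i <= j <= N.+1)%N -> x i <= x j.
Proof.
move=> /andP[ij jN]; move: ij; rewrite leq_eqVlt => /predU1P[->//|ij].
by rewrite ltW// x_incr// ij.
Qed.

Lemma nodes_on k y : (k <= N)%N -> x k <= y <= x k.+1 ->
  nodes y = \sum_(j < N.+1 | (j <= k)%N) (y - x j) * a j.
Proof.
move=> kN /andP[y1 y2]; rewrite /nodes [RHS]big_mkcond /=.
apply: eq_bigr => j _; case: leqP => jk.
  by rewrite ramp_pos// subr_ge0 (le_trans _ y1)// node_le// jk (leq_trans kN).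
rewrite ramp_neg ?mul0r// subr_le0 (le_trans y2)// node_le// jk.
by rewrite (leq_trans (ltnW (ltn_ord j))).
Qed.

Lemma F_mod : modulus_on 0 b F.
Proof.
move=> eps e0.
pose L := \int[leb]_s `|G s| + \sum_(j < N.+1) `|a j|.
have L0 : 0 <= \int[leb]_s `|G s| by apply: Rintegral_ge0.
have L1 : 0 <= \sum_(j < N.+1) `|a j| by apply: sumr_ge0.
have L2 : 0 < L + 1 by rewrite ltr_wpDl// addr_ge0.
have e2 : 0 < eps / 2 by rewrite divr_gt0.
have [d1 d10 H] := U_mod e2.
exists (Num.min d1 (eps / 2 / (L + 1))); first by rewrite lt_min d10 divr_gt0.
move=> s t s01 t01; rewrite lt_min => /andP[st1 st2].
have h1 := H s t s01 t01 st1.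
have h2 := rpot_lip iG Gsupp s t.
have h3 : `|nodes s - nodes t| <= `|s - t| * \sum_(j < N.+1) `|a j|.
  rewrite /nodes -sumrB mulr_sumr (le_trans (ler_norm_sum _ _ _))//.
  apply: ler_sum => j _; rewrite -mulrBl normrM ler_wpM2r//.
  by rewrite (le_trans (ramp_lip _ _))// opprB addrA subrK.
have h4 : `|s - t| * (L + 1) <= eps / 2 by rewrite -ler_pdivlMr// ltW.
have h5 : `|s - t| * L <= `|s - t| * (L + 1) by rewrite ler_wpM2l// lerDl.
have h6 : `|s - t| * L = `|s - t| * \int[leb]_s0 `|G s0| + `|s - t| * \sum_(j < N.+1) `|a j|.
  by rewrite mulrDr.
have -> : F s - F t = (U s - U t) - (rpot G s - rpot G t) - (nodes s - nodes t).
  by rewrite /F; ring.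
apply: (le_trans (ler_normB _ _)).
apply: (le_trans (lerD (ler_normB _ _) h3)).
apply: (le_trans (lerD (lerD h1 h2) (lexx _))).
rewrite -addrA -h6; apply: (le_trans (lerD (lexx _) (le_trans h5 h4))).
by rewrite -splitr.
Qed.

(** The ramps (s - p)_+ of the hypothesis and (p - s)_+ of [rpot] differ by
    affine functions of p ([ramp_opp]), which second differences annihilate. *)
Lemma F_three k : (k <= N)%N -> forall p r th : R,
  x k < p -> p < r -> r < x k.+1 -> 0 <= th <= 1 ->
  F (th * p + (1 - th) * r) = th * F p + (1 - th) * F r.
Proof.
move=> kN p r th xp pr rx th01.
set mid := th * p + (1 - th) * r.
have mid1 : p <= mid <= r.
  have /andP[t0 t1] := th01.
  have h1 : 0 <= (1 - th) * (r - p) by rewrite mulr_ge0// subr_ge0// ltW.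
  have h2 : 0 <= th * (r - p) by rewrite mulr_ge0// subr_ge0 ltW.
  by rewrite /mid; apply/andP; split; lra.
have /andP[pm mr] := mid1.
have E := U3 kN xp pr rx th01; rewrite -/mid in E.
have V : \int[leb]_s ((th * ramp (s - p) - ramp (s - mid) + (1 - th) * ramp (s - r)) * G s) =
   th * rpot G p - rpot G mid + (1 - th) * rpot G r.
  have ir y := itg_rpot iG Gsupp y.
  rewrite /rpot -!RintegralZl//.
  rewrite -RintegralB//; [|exact: itgZ].
  rewrite -RintegralD//; [|by apply: itgB => //; exact: itgZ|exact: itgZ].
  apply: eq_Rintegral => s _.
  rewrite (ramp_opp (s - p)) (ramp_opp (s - mid)) (ramp_opp (s - r)) !opprB.
  by rewrite /mid; ring.
have Nn : nodes mid = th * nodes p + (1 - th) * nodes r.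
  rewrite !(nodes_on kN); try (apply/andP; split; lra).
  rewrite !mulr_sumr -big_split /=; apply: eq_bigr => j _.
  by rewrite /mid; ring.
by rewrite /F Nn; rewrite V in E; lra.
Qed.

Lemma F_affine_k k : (k <= N)%N -> exists A B : R,
  forall y, x k <= y <= x k.+1 -> F y = A + B * y.
Proof.
move=> kN.
have lr : x k < x k.+1 by rewrite x_incr// ltnSn.
have [A [B H]] := affine_of_three lr (F_three kN).
exists A, B; apply: affine_closure lr _ H.
move=> eps e0; have [dl dl0 Hd] := F_mod e0; exists dl => // s t /andP[s1 s2] /andP[t1 t2].
have k0 : 0 <= x k by rewrite -x_0 node_le// (leq_trans kN).
have kb : x k.+1 <= b by rewrite -x_N1 node_le// ltnS kN leqnn.
by apply: Hd; apply/andP; split; lra.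
Qed.

Lemma derive1_U k A B : (k <= N)%N ->
  (forall y, x k <= y <= x k.+1 -> F y = A + B * y) ->
  forall y, x k < y < x k.+1 ->
  derive1 U y = B + rpot' G y + \sum_(j < N.+1 | (j <= k)%N) a j.
Proof.
move=> kN FE y /andP[y1 y2].
have h : is_derive y 1 (fun z => (A + B * z) + rpot G z +
    \sum_(j < N.+1 | (j <= k)%N) (z - x j) * a j)
    (B + rpot' G y + \sum_(j < N.+1 | (j <= k)%N) a j).
  apply: is_derive_add.
    apply: is_derive_add; last exact: is_derive_rpot iG iG2 Gsupp y.
    have := is_derive_aff B A y; congr is_derive; apply/funext => z; exact: addrC.
  pose S := \sum_(j < N.+1 | (j <= k)%N) a j.
  pose S2 := \sum_(j < N.+1 | (j <= k)%N) x j * a j.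
  have := is_derive_aff S (- S2) y; congr is_derive; apply/funext => z.
  rewrite /S /S2 mulr_suml -sumrB; apply: eq_bigr => j _; ring.
have : is_derive y 1 U (B + rpot' G y + \sum_(j < N.+1 | (j <= k)%N) a j).
  apply: near_eq_is_derive h; near=> z.
  have zk : x k <= z <= x k.+1.
    apply/andP; split; apply: ltW; near: z; [exact: lt_nbhsr|exact: lt_nbhsl].
  have := FE z zk; rewrite /F (nodes_on kN zk) => <-; ring.
by move=> [_ <-]; rewrite derive1E.
Unshelve. all: by end_near. Qed.

Lemma cvg_right k A B : (k <= N)%N ->
  (forall y, x k <= y <= x k.+1 -> F y = A + B * y) ->
  derive1 U y @[y --> (x k)^'+] -->
     B + rpot' G (x k) + \sum_(j < N.+1 | (j <= k)%N) a j.
Proof.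
move=> kN FE; have lr : x k < x k.+1 by rewrite x_incr// ltnSn.
have : (B + rpot' G y + \sum_(j < N.+1 | (j <= k)%N) a j) @[y --> (x k)^'+] -->
     B + rpot' G (x k) + \sum_(j < N.+1 | (j <= k)%N) a j.
  apply: cvgD; last exact: cvg_cst.
  apply: cvgD; first exact: cvg_cst.
  have rc : continuous (rpot' G) := rpot'_cont iG iG2 Gsupp.
  exact: cvg_at_right_filter (rc (x k)).
apply: cvg_trans; apply: near_eq_cvg; near=> y.
rewrite (derive1_U kN FE)//; apply/andP; split; near: y.
  exact: nbhs_right_gt.
exact: nbhs_right_lt.
Unshelve. all: by end_near. Qed.

Lemma cvg_left k A B : (k <= N)%N ->
  (forall y, x k <= y <= x k.+1 -> F y = A + B * y) ->
  derive1 U y @[y --> (x k.+1)^'-] -->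
     B + rpot' G (x k.+1) + \sum_(j < N.+1 | (j <= k)%N) a j.
Proof.
move=> kN FE; have lr : x k < x k.+1 by rewrite x_incr// ltnSn.
have : (B + rpot' G y + \sum_(j < N.+1 | (j <= k)%N) a j) @[y --> (x k.+1)^'-] -->
     B + rpot' G (x k.+1) + \sum_(j < N.+1 | (j <= k)%N) a j.
  apply: cvgD; last exact: cvg_cst.
  apply: cvgD; first exact: cvg_cst.
  have rc : continuous (rpot' G) := rpot'_cont iG iG2 Gsupp.
  exact: cvg_at_left_filter (rc (x k.+1)).
apply: cvg_trans; apply: near_eq_cvg; near=> y.
rewrite (derive1_U kN FE)//; apply/andP; split; near: y.
  exact: nbhs_left_gt.
exact: nbhs_left_lt.
Unshelve. all: by end_near. Qed.

(** Induction on the intervals. On the first one the data at 0 fix the affine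
    function; across x_(k+1) the value is continuous and the slope is too, as
    the jump of U' is exactly the slope of the subtracted ramp. *)
Lemma F_global k : (k <= N)%N -> forall y, x k <= y <= x k.+1 -> F y = u0 + c0 * y.
Proof.
elim: k => [|k IH] kN.
  have [A [B H]] := F_affine_k kN.
  have x01 : x 0%N <= 0 <= x 1%N by rewrite x_0 lexx -x_0 node_le.
  have n0 : nodes 0 = 0.
    rewrite /nodes big1// => j _; rewrite ramp_neg ?mul0r// sub0r oppr_le0 -x_0 node_le//=.
    exact: ltnW.
  have F0 : F 0 = u0 by rewrite /F U00 (rpot0 Gsupp) n0 !subr0.
  have AE : A = u0 by have := H 0 x01; rewrite F0 mulr0 addr0.
  have := cvg_right kN H; rewrite x_0 (rpot'0 Gsupp) => hc.
  have BE : B + 0 + \sum_(j < N.+1 | (j <= 0)%N) a j = c0 + a 0%N.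
    exact: cvg_unique hc U'0.
  have sE : \sum_(j < N.+1 | (j <= 0)%N) a j = a 0%N.
    by rewrite (big_pred1 ord0)// => j /=; rewrite leqn0.
  have {}BE : B = c0 by move: BE; rewrite addr0 sE => /addIr.
  by move=> y hy; rewrite (H y) ?x_0 ?AE ?BE.
have kN' := ltnW kN.
have [A [B H]] := F_affine_k kN.
have {}IH := IH kN'.
have [dp [dm [h1 h2 h3]]] : exists dp dm : R,
  [/\ derive1 U y @[y --> (x k.+1)^'+] --> dp,
      derive1 U y @[y --> (x k.+1)^'-] --> dm & dp - dm = a k.+1] by exact: Ujump.
have e1 : B + rpot' G (x k.+1) + \sum_(j < N.+1 | (j <= k.+1)%N) a j = dp.
  exact: cvg_unique (cvg_right kN H) h1.
have e2 : c0 + rpot' G (x k.+1) + \sum_(j < N.+1 | (j <= k)%N) a j = dm.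
  exact: cvg_unique (cvg_left kN' IH) h2.
have BE : B = c0.
  have sE : \sum_(j < N.+1 | (j <= k.+1)%N) a j =
      \sum_(j < N.+1 | (j <= k)%N) a j + a k.+1.
    have kO : (k.+1 < N.+1)%N by [].
    rewrite (bigD1 (Ordinal kO))//= addrC; congr (_ + _).
    by apply: eq_bigl => j; rewrite -val_eqE /= andbC -ltn_neqAle ltnS.
  rewrite -e1 -e2 sE in h3; lra.
have xk : x k <= x k.+1 <= x k.+1 by rewrite lexx node_le// leqnSn ltnW.
have xk1 : x k.+1 <= x k.+1 <= x k.+2 by rewrite lexx node_le// leqnSn.
have AE : u0 = A by have := H _ xk1; rewrite (IH _ xk) BE => /addIr.
by move=> y hy; rewrite (H y hy) AE BE.
Qed.

Lemma locate y : 0 <= y <= b -> exists2 k, (k <= N)%N & x k <= y <= x k.+1.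
Proof.
move=> /andP[y0 yb].
have ex : exists n, y <= x n.+1 by exists N; rewrite x_N1.
have nN : (ex_minn ex <= N)%N.
  by case: ex_minnP => n _; apply; rewrite x_N1.
exists (ex_minn ex) => //; move: nN; case: ex_minnP => -[|n] yn Hn nN.
  by rewrite x_0 y0 yn.
rewrite yn andbT; have [h|h] := leP (x n.+1) y; first by [].
by have := Hn n (ltW h); rewrite ltnn.
Qed.

(** Taylor's formula at 0 for a function with second derivative G between the
    nodes and slope jumps a k at the nodes. The initial slope is split as
    c0 + a 0, which treats the origin as one more node. *)
Lemma ramp_representation y : 0 <= y <= b ->
  U y = u0 + c0 * y + rpot G y + \sum_(j < N.+1) ramp (y - x j) * a j.
Proof.
by move=> /locate[k kN /(F_global kN)]; rewrite /F => <-; rewrite -/(nodes y); ring.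
Qed.
End representation.

(** * The ramp equation for one component of a solution *)

Section L2.
Variable R : realType.
Local Notation RT := (measurableTypeR R).

(** The values of q outside the open interval are arbitrary, even non
    measurable, and have to be erased. *)
Definition cutoff (b : R) (q : R -> R[i]) (s : RT) : R[i] := if 0 < s < b then q s else 0.

Lemma measurable_if_itv (l r : R) (f : R -> R) :
  measurable_fun (`]l, r[ : set RT) (f : RT -> R) ->
  measurable_fun setT (fun s : RT => if l < s < r then f s else 0).
Proof.
move=> mf.
have mI : measurable (`]l, r[%classic : set RT) by exact: measurable_itv.
have := (measurable_restrictT (f : RT -> R) mI).1 mf.
by congr measurable_fun; apply/funext => s; rewrite patchE mem_setE in_itv.
Qed.

Lemma measurable_normc d (T : measurableType d) (f : T -> R[i]) : mfunC f ->
  measurable_fun setT (fun s => Normc.normc (f s)).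
Proof.
move=> [f1 f2].
rewrite (_ : (fun s => _) = (fun s => Num.sqrt (complex.Re (f s) ^+ 2 + complex.Im (f s) ^+ 2))).
  apply: measurableT_comp; first exact: continuous_measurable_fun (@sqrt_continuous R).
  by apply: measurable_funD; apply: measurable_funX.
by apply/funext => s; case: (f s).
Qed.

Lemma in_L2_cutoff (b : R) (q : R -> R[i]) : in_L2 0 b q ->
  mfunC (cutoff b q) /\ itg leb (fun s => norm1 (cutoff b q s) ^+ 2).
Proof.
move=> [m1 m2 fn].
have mt : mfunC (cutoff b q).
  split.
    have := measurable_if_itv m1; congr measurable_fun; apply/funext => s.
    by rewrite /cutoff; case: ifP.
  have := measurable_if_itv m2; congr measurable_fun; apply/funext => s.
  by rewrite /cutoff; case: ifP.
split => //.
have mn : measurable_fun setT (fun s => Normc.normc (cutoff b q s)) by exact: measurable_normc.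
have nE : (fun y => Normc.normc (q y)) \_ `]0, b[ = (fun s : RT => Normc.normc (cutoff b q s)).
  apply/funext => s; rewrite patchE mem_setE in_itv /cutoff /=.
  by case: ifP => // _; rewrite Normc.normc0.
rewrite nE in fn.
have i2 : itg leb (fun s => Normc.normc (cutoff b q s) ^+ 2).
  apply: Lfun2_integrable_sqr.
  by rewrite inE /=; apply/andP; split; rewrite inE.
apply: le_itg (itgZ 4 i2).
  by apply: measurable_funX; exact: mfunC_norm1.
move=> s; rewrite ger0_norm ?sqr_ge0//.
have h := norm1_normc (cutoff b q s); have h0 := norm1_ge0 (cutoff b q s).
have -> : 4 * Normc.normc (cutoff b q s) ^+ 2 = (2 * Normc.normc (cutoff b q s)) ^+ 2.
  by rewrite exprMn; congr (_ * _); rewrite expr2; lra.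
by rewrite ler_pXn2r// nnegrE // (le_trans h0 h).
Qed.
End L2.

Section component.
Variable R : realType.
Local Notation RT := (measurableTypeR R).
Variable pr : R[i] -> R.
Hypothesis prD : forall z w, pr (z + w) = pr z + pr w.
Hypothesis prN : forall z, pr (- z) = - pr z.
Hypothesis prZ : forall z (r : R), pr (z * r%:C) = pr z * r.
Hypothesis pr_le : forall z, `|pr z| <= norm1 z.
Hypothesis pr_int : forall (D : set R) f, pr (integralC D f) = \int[leb]_(y in D) pr (f y).
Hypothesis pr_der : forall (u : R -> R[i]) y, pr (deriveC u y) = derive1 (pr \o u) y.
Hypothesis pr_cvg : forall (f : R -> R[i]) (F : set_system R) l, cvgC f F l ->
  pr (f y) @[y --> F] --> pr l.
Hypothesis pr_meas : forall d (T : measurableType d) (D : set T) (f : T -> R[i]),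
  measurable_fun D (@complex.Re R \o f) -> measurable_fun D (@complex.Im R \o f) ->
  measurable_fun D (fun x => pr (f x)).

Variables (b : R) (q : R -> R[i]) (N : nat) (x : nat -> R) (alpha : nat -> R[i])
  (lambda c h : R[i]) (u : R -> R[i]).
Hypothesis b_gt0 : 0 < b.
Hypothesis q_L2 : in_L2 0 b q.
Hypothesis x_0 : x 0%N = 0.
Hypothesis x_N1 : x N.+1 = b.
Hypothesis x_incr : forall i j, (i < j <= N.+1)%N -> x i < x j.
Hypothesis u_sol : is_solution b q N x alpha lambda u.
Hypothesis u_0 : u 0 = 1.
Hypothesis u_d0 : cvgC (deriveC u) (0^'+) (c + h).

Let p0 (s : RT) : R[i] := cutoff b (fun s => q s - lambda) s.
Let al (k : nat) : R[i] := if k is 0%N then h else alpha k.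
Let U (s : R) : R := pr (u s).

(** Absolute continuity for a single interval. *)
Lemma u_modulus (eps : R) : 0 < eps -> exists2 dl : R, 0 < dl &
  forall s t, 0 <= s <= b -> 0 <= t <= b -> `|s - t| < dl -> norm1 (u s - u t) <= eps.
Proof.
move=> e0; have [[uac _ _] _] := u_sol.
have e2 : 0 < eps / 2 by rewrite divr_gt0.
have [dl dl0 H] := uac _ e2; exists dl => //.
have main s t : 0 <= s -> t <= b -> s <= t -> t - s < dl -> norm1 (u t - u s) <= eps.
  move=> s0 tb st std.
  have := H 1%N (fun=> s) (fun=> t); rewrite !big_ord1 => Hs.
  apply: (le_trans (norm1_normc _)); rewrite -ler_pdivlMl// mulrC; apply: ltW; apply: Hs => //.
    by move=> _; split => // y /=; rewrite !in_itv /= => /andP[y1 y2];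
      rewrite (le_trans s0 y1) (le_trans y2 tb).
  by move=> i j _ _ _; rewrite (ord1 i) (ord1 j).
move=> s t /andP[s0 sb] /andP[t0 tb]; have [st|ts] := leP s t => d.
  rewrite -norm1N opprB; apply: main => //.
  by rewrite -(ger0_norm (_ : 0 <= t - s)) ?subr_ge0// distrC.
apply: main => //; first exact: ltW.
by rewrite -(ger0_norm (_ : 0 <= s - t))// subr_ge0 ltW.
Qed.

Lemma U_modulus : modulus_on 0 b U.
Proof.
move=> eps e0; have [dl dl0 H] := u_modulus e0; exists dl => // s t sb tb st.
by rewrite /U -prN -prD (le_trans (pr_le _))// H.
Qed.

Let ut (s : RT) : R[i] := u (clamp b s).

Lemma clamp_lip s t : `|clamp b s - clamp b t| <= `|s - t|.
Proof.
have h1 := ler_norm (s - t); have h2 := ler_norm (- (s - t)); rewrite normrN in h2.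
have b0 := b_gt0.
rewrite /clamp ler_norml.
case: (leP s b) => sb; case: (leP t b) => tb; case: (leP 0 s) => s0; case: (leP 0 t) => t0;
  rewrite ?(max_r (ltW b0)); apply/andP; split; lra.
Qed.

Lemma mfunC_ut : mfunC ut.
Proof.
have cont (f : R[i] -> R) : (forall z w, `|f z - f w| <= norm1 (z - w)) ->
    continuous (fun s => f (ut s)).
  move=> fl s; apply/cvgrPdist_le => /= eps e0.
  have [dl dl0 H] := u_modulus e0; near=> t.
  rewrite (le_trans (fl _ _))//; apply: H; [exact: clamp_bd|exact: clamp_bd|].
  apply: le_lt_trans (clamp_lip _ _) _.
  by near: t; apply: cvgr_dist_lt => //; exact: cvg_id.
split; apply: continuous_measurable_fun; apply: cont => z w.
  by rewrite -RecN -RecD Re_norm1.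
by rewrite -ImcN -ImcD Im_norm1.
Unshelve. all: by end_near. Qed.

(** Uniform continuity on a bounded interval gives boundedness by a chain of
    finitely many steps, in which u changes by at most 1. *)
Lemma ut_bounded : exists2 A : R, 0 <= A & forall s, norm1 (ut s) <= A.
Proof.
have [dl dl0 H] := u_modulus ltr01.
have [n nb] : exists n : nat, b < n%:R * (dl / 2).
  exists (Num.bound (b / (dl / 2))).
  rewrite -ltr_pdivrMr ?divr_gt0//; apply: archi_boundP.
  by rewrite divr_ge0 ?divr_ge0 ?ltW.
have step k : forall s, 0 <= s <= b -> s <= k%:R * (dl / 2) -> norm1 (u s) <= norm1 (u 0) + k%:R.
  elim: k => [|k IH] s /andP[s0 sb] sk.
    have -> : s = 0 by apply/eqP; rewrite eq_le s0 andbT; rewrite mul0r in sk.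
    by rewrite addr0.
  have [sd|ds] := leP s (k%:R * (dl / 2)).
    have := IH s _ sd; rewrite s0 sb => /(_ isT) h1.
    by rewrite (le_trans h1)// lerD2l ler_nat.
  pose t := k%:R * (dl / 2).
  have t0 : 0 <= t by apply: mulr_ge0 => //; apply: ltW; rewrite divr_gt0.
  have tb : t <= b by apply: ltW; exact: lt_le_trans ds sb.
  have := IH t; rewrite t0 tb lexx => /(_ isT isT) h1.
  have h2 : norm1 (u s - u t) <= 1.
    apply: H; rewrite ?s0 ?t0//= gtr0_norm ?subr_gt0//.
    by move: sk; rewrite -natr1 mulrDl mul1r -/t; lra.
  have := norm1D (u s - u t) (u t); rewrite subrK -natr1; lra.
exists (norm1 (u 0) + n%:R); first by rewrite addr_ge0 ?norm1_ge0.
move=> s; apply: step; first exact: clamp_bd.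
by have /andP[_ h1] := clamp_bd b_gt0 s; apply: ltW; exact: le_lt_trans h1 nb.
Qed.

Let Gc (s : RT) : R[i] := p0 s * u s.

Lemma Gc_ut s : Gc s = p0 s * ut s.
Proof.
rewrite /Gc /p0 /cutoff; case: ifP => [/andP[s0 sb]|_]; last by rewrite !mul0r.
by rewrite /ut clampE// (ltW s0) ltW.
Qed.

Lemma p0_L2 : mfunC p0 /\ itg leb (fun s => norm1 (p0 s) ^+ 2).
Proof.
have [mq q2] := in_L2_cutoff q_L2.
pose l0 (s : RT) : R[i] := if 0 < s < b then lambda else 0.
have ml : mfunC l0.
  apply: mfunC_if; [|exact: mfunC_cst|exact: mfunC_cst].
  by measurable_tac.
have pE : p0 = fun s => cutoff b q s - l0 s.
  by apply/funext => s; rewrite /p0 /cutoff /l0; case: ifP => _ //; rewrite subr0.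
have mp : mfunC p0 by rewrite pE; exact: mfunCB.
split => //.
have il : itg leb (fun s => if 0 < s < b then norm1 lambda ^+ 2 else 0).
  exact: integrable_if (@cont_cst _ _).
apply: (le_itg (s := fun s : RT => 2 * norm1 (cutoff b q s) ^+ 2 + 2 * (if 0 < s < b then norm1 lambda ^+ 2 else 0))).
- by apply: measurable_funX; exact: mfunC_norm1.
- move=> s; rewrite ger0_norm ?sqr_ge0// pE.
  have hB := norm1B (cutoff b q s) (l0 s).
  have h0 := norm1_ge0 (cutoff b q s - l0 s).
  have -> : (if 0 < s < b then norm1 lambda ^+ 2 else 0) = norm1 (l0 s) ^+ 2.
    by rewrite /l0; case: ifP => _ //; rewrite norm1_0 expr0n.
  have a0 := norm1_ge0 (cutoff b q s); have b0 := norm1_ge0 (l0 s).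
  apply: (@le_trans _ _ ((norm1 (cutoff b q s) + norm1 (l0 s)) ^+ 2)).
    by rewrite ler_pXn2r// nnegrE// addr_ge0.
  rewrite (_ : 2 * norm1 (cutoff b q s) ^+ 2 + 2 * norm1 (l0 s) ^+ 2 =
    (norm1 (cutoff b q s) + norm1 (l0 s)) ^+ 2 +
    (norm1 (cutoff b q s) - norm1 (l0 s)) ^+ 2); last by ring.
  by rewrite lerDl sqr_ge0.
- by apply: itgD; exact: itgZ.
Qed.

Lemma Gc_itg : itgC leb Gc /\ itg leb (fun s => norm1 (Gc s) ^+ 2).
Proof.
have [mp p2] := p0_L2; have [A A0 uA] := ut_bounded.
have mG : mfunC Gc.
  by rewrite (_ : Gc = fun s => p0 s * ut s);
    [apply: mfunCM => //; exact: mfunC_ut|apply/funext => s; exact: Gc_ut].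
have i2 : itg leb (fun s => norm1 (Gc s) ^+ 2).
  apply: (le_itg (s := fun s : RT => A ^+ 2 * norm1 (p0 s) ^+ 2)); last exact: itgZ.
    by apply: measurable_funX; exact: mfunC_norm1.
  move=> s; rewrite ger0_norm ?sqr_ge0// -exprMn ler_pXn2r// ?nnegrE ?norm1_ge0//; last first.
    by rewrite mulr_ge0// norm1_ge0.
  by rewrite Gc_ut (le_trans (norm1M _ _))// mulrC ler_wpM2r// norm1_ge0.
split => //; apply: (itgC_dom (r := fun s : RT => (if 0 < s < b then 1 else 0) + norm1 (Gc s) ^+ 2)) => //.
  apply: itgD => //; exact: integrable_if (@cont_cst _ 1).
move=> s; case: ifP => sb.
  have := sqr_ge0 (norm1 (Gc s) - 1); rewrite sqrrB expr1n mulr1.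
  by have := norm1_ge0 (Gc s); lra.
by rewrite /Gc /p0 /cutoff sb mul0r norm1_0 expr0n addr0.
Qed.

Let G (s : RT) : R := pr (Gc s).

Lemma G_meas : measurable_fun setT G.
Proof. by have [/itgC_meas[m1 m2] _] := Gc_itg; apply: pr_meas. Qed.

Lemma G_itg : itg leb G /\ itg leb (fun s => G s ^+ 2).
Proof.
have [ic i2] := Gc_itg; split.
  apply: le_itg (itgC_norm1 ic) => [|s]; [exact: G_meas|exact: pr_le].
apply: le_itg i2 => [|s]; first by apply: measurable_funX; exact: G_meas.
rewrite ger0_norm ?sqr_ge0// -(real_normK (num_real (G s))).
by rewrite ler_pXn2r// ?nnegrE ?norm1_ge0// pr_le.
Qed.

Lemma G_supp (s : R) : ~~ (0 < s < b) -> G s = 0.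
Proof.
move=> /negbTE sb; rewrite /G /Gc /p0 /cutoff sb mul0r.
by have := prZ 0 0; rewrite mul0r mulr0.
Qed.

(** The weak second derivative is (q - lambda) u almost everywhere, hence can
    be replaced by it under the integral against a test function. *)
Lemma U_three k : (k <= N)%N -> forall p r th : R,
  x k < p -> p < r -> r < x k.+1 -> 0 <= th <= 1 ->
  th * U p - U (th * p + (1 - th) * r) + (1 - th) * U r =
  \int[leb]_s ((th * ramp (s - p) - ramp (s - (th * p + (1 - th) * r)) +
     (1 - th) * ramp (s - r)) * G s).
Proof.
move=> kN p r th xp pr' rx th01.
have [iG iG2] := G_itg.
have k0 : 0 <= x k by rewrite -x_0 (node_le x_incr)// (leq_trans kN).
have kb : x k.+1 <= b by rewrite -x_N1 (node_le x_incr)// ltnS kN leqnn.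
have [_ /(_ k kN)[u2 [u2L u2w u2ae]]] := u_sol.
have mI : measurable (`]x k, x k.+1[%classic : set RT) by exact: measurable_itv.
have [A A0 uA] := ut_bounded.
have mU : measurable_fun setT (fun s : RT => pr (ut s)).
  by have [m1 m2] := mfunC_ut; exact: pr_meas.
have in01 s : x k < s < x k.+1 -> 0 < s < b.
  by move=> /andP[s1 s2]; rewrite (le_lt_trans k0 s1) (lt_le_trans s2 kb).
have iU : itg leb (fun s => if x k < s < x k.+1 then U s else 0).
  apply: (le_itg (s := fun s : RT => if x k < s < x k.+1 then A else 0)).
  - rewrite (_ : (fun s => _) = (fun s : RT => if x k < s < x k.+1 then pr (ut s) else 0)).
      apply: measurable_fun_ifT => //.
      by measurable_tac.
    apply/funext => s; case: ifP => // /in01/andP[s1 s2].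
    by rewrite /ut clampE// (ltW s1) ltW.
  - move=> s; case: ifP => [/in01/andP[s1 s2]|]; last by rewrite normr0.
    rewrite (le_trans (pr_le _))//; have := uA s.
    by rewrite /ut clampE// (ltW s1) ltW.
  - exact: integrable_if (@cont_cst _ A).
have iV : itg leb (fun s => if x k < s < x k.+1 then G s else 0).
  apply: (le_itg (s := fun s : RT => `|G s|)); last exact: itg_norm.
    apply: measurable_fun_ifT; [|exact: G_meas|exact: measurable_cst].
    by measurable_tac.
  by move=> s; case: ifP => _ //; rewrite normr0.
have cU (z eta : R) : x k < z < x k.+1 -> 0 < eta -> exists2 dl : R, 0 < dl &
  forall s, `|s - z| < dl -> `|U s - U z| <= eta.
  move=> /in01/andP[z0 zb] e0; have [dl dl0 H] := U_modulus e0.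
  exists (Num.min dl (Num.min z (b - z))); first by rewrite !lt_min dl0 z0 subr_gt0.
  move=> s; rewrite !lt_min => /and3P[h1 h2 h3]; apply: H => //.
    by move: h2 h3; rewrite !ltr_norml => /andP[a1 a2] /andP[a3 a4]; apply/andP; split; lra.
  by rewrite (ltW z0) ltW.
have hw phi : test_function (x k) (x k.+1) phi ->
  \int[leb]_s (if x k < s < x k.+1 then U s * derive1n 2 phi s else 0) =
  \int[leb]_s (if x k < s < x k.+1 then G s * phi s else 0).
  move=> tphi; rewrite !Rint_if.
  have := congr1 pr (u2w phi tphi).
  rewrite sqrrN expr1n mul1r !pr_int => E.
  transitivity (\int[leb]_(y in `]x k, x k.+1[) pr (u y * ((derive1n 2 phi y)%:C))).
    by apply: eq_Rintegral => s _; rewrite prZ.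
  rewrite E; under eq_Rintegral do rewrite prZ.
  rewrite /Rintegral; congr fine.
  have mphi : measurable_fun setT (phi : RT -> R).
    apply: continuous_measurable_fun => s.
    have := tphi.1 0%N s; rewrite derive1n0 => /derivable1_diffP.
    exact: differentiable_continuous.
  apply: ae_eq_integral => //.
  - apply/measurable_EFinP; apply: measurable_funM; last exact: measurable_funTS.
    by have [m1 m2 _] := u2L; exact: pr_meas.
  - apply/measurable_EFinP; apply: measurable_funTS.
    by apply: measurable_funM => //; exact: G_meas.
  move: u2ae; apply: (@filterS _ _ (ae_filter_ringOfSetsType leb)) => s /= H sI; congr (_ * _)%:E.
  have sI' : s \in (`]x k, x k.+1[ : interval R) by move: sI; rewrite /= in_itv.
  have {}H : - u2 s + q s * u s = lambda * u s by apply: H; rewrite ?inE.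
  rewrite /G /Gc /p0 /cutoff in01; last by move: sI; rewrite /= in_itv.
  congr pr; rewrite mulrBl -H; ring.
rewrite (three_point iU iV cU hw xp pr' rx th01).
apply: eq_Rintegral => s _; rewrite mulrC; case: ifP => // sk.
set mid := th * p + (1 - th) * r.
have /andP[t0 t1] := th01.
have h1 : 0 <= (1 - th) * (r - p) by rewrite mulr_ge0// subr_ge0// ltW.
have h2 : 0 <= th * (r - p) by rewrite mulr_ge0// subr_ge0 ltW.
have pm : p <= mid by rewrite /mid; lra.
have mr : mid <= r by rewrite /mid; lra.
(* Outside the interval the second difference of the ramps vanishes, so the
   integral may be extended to the line. *)
move: sk => /negbT; rewrite negb_and -!leNgt => /orP[sk|sk].
  by rewrite !ramp_neg ?mulr0 ?subr0 ?addr0 ?mul0r//; lra.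
rewrite !ramp_pos; [|lra|lra|lra].
by rewrite [X in X * _](_ : _ = 0) ?mul0r// /mid; ring.
Qed.

Lemma component_ramp y : 0 <= y <= b ->
  U y = pr 1 + pr c * y + \int[leb]_s (ramp (y - s) * G s) +
    \sum_(j < N.+1) ramp (y - x j) * pr (al j * u (x j)).
Proof.
move=> yb; have [iG iG2] := G_itg.
apply: (ramp_representation (a := fun j => pr (al j * u (x j))) iG iG2 G_supp x_0 x_N1 x_incr U_modulus U_three) => //.
- move=> k kN; have [[_ _ /(_ k kN)[dp [dm [h1 h2 h3]]]] _] := u_sol.
  exists (pr dp), (pr dm); split.
  + by have := pr_cvg h1; under eq_fun do rewrite pr_der.
  + by have := pr_cvg h2; under eq_fun do rewrite pr_der.
  + by rewrite -prN -prD h3; case: k kN {h1 h2 h3}.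
- have := pr_cvg u_d0; under eq_fun do rewrite pr_der.
  by rewrite prD /= x_0 u_0 mulr1.
- by rewrite /U u_0.
Qed.
End component.

(** * Solutions coincide with the transform of the kernel *)

Section uniqueness.
Variable R : realType.
Local Notation RT := (measurableTypeR R).
Variables (b : R) (q : R -> R[i]) (N : nat) (x : nat -> R) (alpha : nat -> R[i])
  (h : R[i]).
Hypothesis b_gt0 : 0 < b.
Hypothesis q_L2 : in_L2 0 b q.
Hypothesis x_0 : x 0%N = 0.
Hypothesis x_N1 : x N.+1 = b.
Hypothesis x_incr : forall i j, (i < j <= N.+1)%N -> x i < x j.

(** The mass at x_0 = 0 carries h, whatever the value of alpha at 0. *)
Definition weights (k : nat) : R[i] := if k is 0%N then h else alpha k.

Lemma x_incr_inner i j : (i < j <= N)%N -> x i < x j.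
Proof. by move=> /andP[ij jN]; apply: x_incr; rewrite ij (leq_trans jN). Qed.

Lemma node_range k : (k <= N)%N -> 0 <= x k < b.
Proof.
move=> kN; rewrite -x_N1 x_incr ?ltnS ?kN ?leqnn// andbT -x_0.
by apply: (node_le x_incr); rewrite /= (leq_trans kN).
Qed.

Section solution.
Variables (lambda c : R[i]) (u : R -> R[i]).
Hypothesis u_sol : is_solution b q N x alpha lambda u.
Hypothesis u_0 : u 0 = 1.
Hypothesis u_d0 : cvgC (deriveC u) (0^'+) (c + h).

Let p0 (s : RT) : R[i] := cutoff b (fun s => q s - lambda) s.

Lemma intC_ext d (T : measurableType d) (mu : {measure set T -> \bar R}) (f g : T -> R[i]) :
  (forall s, f s = g s) -> intC mu f = intC mu g.
Proof. by move=> /funext ->. Qed.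

(** The two components of u satisfy the ramp equation separately, since the
    ramps are real. *)
Lemma solution_ramp y : 0 <= y <= b ->
  u y = 1 + c * y%:C +
    intC leb (fun s => p0 s * ((ramp (y - s))%:C * u s)) +
    \sum_(k < N.+1) weights k * ((ramp (y - x k))%:C * u (x k)).
Proof.
move=> yb.
have sumRe (f : 'I_N.+1 -> R[i]) : complex.Re (\sum_k f k) = \sum_k complex.Re (f k).
  by elim/big_rec2: _ => // i z w _ <-; rewrite reimE.
have sumIm (f : 'I_N.+1 -> R[i]) : complex.Im (\sum_k f k) = \sum_k complex.Im (f k).
  by elim/big_rec2: _ => // i z w _ <-; rewrite reimE.
have cR := @component_ramp R (@complex.Re R) (@RecD R) (@RecN R) _ (@Re_norm1 R)
  (fun _ _ => erefl) (fun _ _ => erefl) _ _ b q N x alpha lambda c h u b_gt0 q_L2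
  x_0 x_N1 x_incr u_sol u_0 u_d0 y yb.
have cI := @component_ramp R (@complex.Im R) (@ImcD R) (@ImcN R) _ (@Im_norm1 R)
  (fun _ _ => erefl) (fun _ _ => erefl) _ _ b q N x alpha lambda c h u b_gt0 q_L2
  x_0 x_N1 x_incr u_sol u_0 u_d0 y yb.
apply: complex_ext.
  rewrite cR; [|by move=> z r; rewrite reimE /= mulr0 subr0|by move=> f F l []|by []].
  rewrite !(RecD _ _) sumRe; congr (_ + _ + _ + _).
  - by rewrite reimE /= mulr0 subr0.
  - apply: eq_Rintegral => s _.
    rewrite (_ : p0 s * _ = (ramp (y - s))%:C * (p0 s * u s)); last by ring.
    by rewrite [RHS]RecM /= mul0r subr0.
  - apply: eq_bigr => k _.
    rewrite (_ : weights k * _ = (ramp (y - x k))%:C * (weights k * u (x k))); last by ring.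
    by rewrite [RHS]RecM /= mul0r subr0.
rewrite cI; [|by move=> z r; rewrite reimE /= mulr0 add0r|by move=> f F l []|by []].
rewrite !(ImcD _ _) sumIm; congr (_ + _ + _ + _).
- by rewrite reimE /= mulr0 add0r.
- apply: eq_Rintegral => s _.
  rewrite (_ : p0 s * _ = (ramp (y - s))%:C * (p0 s * u s)); last by ring.
  by rewrite [RHS]ImcM /= mul0r addr0.
- apply: eq_bigr => k _.
  rewrite (_ : weights k * _ = (ramp (y - x k))%:C * (weights k * u (x k))); last by ring.
  by rewrite [RHS]ImcM /= mul0r addr0.
Qed.

Lemma solution_regular : exists (v : RT -> R[i]) (A : R), [/\ mfunC v, 0 <= A,
  forall s, norm1 (v s) <= A & forall s : R, 0 <= s <= b -> v s = u s].
Proof.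
have m := mfunC_ut b_gt0 u_sol.
have [A A0 hA] := ut_bounded b_gt0 u_sol.
exists (fun s : RT => u (clamp b s)), A; split => //.
by move=> s sb; rewrite clampE.
Qed.

End solution.

Variables (K : RT * RT -> R[i]) (M : R).
Let Q := nodeQ N x weights (cutoff b q).
Hypothesis M0 : 0 <= M.
Hypothesis mK : mfunC K.
Hypothesis MK : forall p, norm1 (K p) <= M.
Hypothesis sK : forall s u : R, s <= `|u| -> K (s, u) = 0.
Hypothesis KE : forall y t : R, y <= b ->
  K (y, t) = intC (nodem N x) (fun s => Q s * inner K y t s).

Lemma cutoff_supp (f : R -> R[i]) (s : R) : ~~ (0 < s < b) -> cutoff b f s = 0.
Proof. by rewrite /cutoff => /negbTE ->. Qed.

(** Both sides satisfy the ramp equation: u with potential q - rho^2, and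
    [eker] with potential q and the further term c^2 = - rho^2. Their
    difference satisfies the homogeneous equation, so it vanishes by
    [gronwall]. *)
Lemma solution_eq_eker (rho : R[i]) (u : R -> R[i]) :
  is_solution b q N x alpha (rho ^+ 2) u -> u 0 = 1 ->
  cvgC (deriveC u) (0^'+) ('i%C * rho + h) ->
  forall y : R, 0 <= y <= b -> u y = eker K ('i%C * rho) y.
Proof.
move=> us u_0 ud0; set c := 'i%C * rho.
have c2 : c ^+ 2 = - rho ^+ 2 by rewrite exprMn sqr_i mulN1r.
have b0 := ltW b_gt0.
have [mq q2] := in_L2_cutoff q_L2.
have q_supp := @cutoff_supp q.
pose p0 (s : RT) : R[i] := cutoff b (fun s => q s - rho ^+ 2) s.
have [mp p2] : mfunC p0 /\ itg leb (fun s => norm1 (p0 s) ^+ 2) by exact: p0_L2.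
have p_supp := @cutoff_supp (fun s => q s - rho ^+ 2).
have [v [A [mv A0 vA vE]]] := solution_regular us.
have [B B0 EB] := @eker_bound R b K M M0 mK MK sK c.
have mE : mfunC (eker K c : RT -> R[i]) := mfunC_eker mK c.
have Qi : itgC (nodem N x) Q by exact: (itgC_nodeQ weights x_incr_inner mq q2 q_supp).
have Qs := nodeQ_supp weights node_range q_supp.
(* v is a measurable bounded version of u: nothing is known of u outside
   [0, b]. *)
pose d (s : RT) : R[i] := if 0 <= s <= b then v s - eker K c s else 0.
have md : mfunC d.
  apply: mfunC_if; [|exact: mfunCB|exact: mfunC_cst].
  by measurable_tac.
have dA (s : R) : 0 <= s <= b -> norm1 (d s) <= A + B.
  by move=> sb; rewrite /d sb (le_trans (norm1B _ _))// lerD// EB.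
have mr y : mfunC (fun s : RT => (ramp (y - s))%:C) by apply: mfunC_real; exact: mramp.
have rb (y s : R) : 0 <= y <= b -> 0 < s < b -> `|ramp (y - s)| <= b.
  move=> /andP[y0 yb] /andP[s0 sb].
  by rewrite /ramp ger0_norm ?le_max ?lexx// ge_max b0 /=; lra.
have io (r : RT -> R[i]) (g : RT -> R[i]) (C y : R) : mfunC r -> itg leb (fun s => norm1 (r s) ^+ 2) ->
   (forall s : R, ~~ (0 < s < b) -> r s = 0) -> mfunC g -> 0 <= C -> 0 <= y <= b ->
   (forall s : R, 0 <= s <= b -> norm1 (g s) <= C) ->
   itgC leb (fun s => r s * ((ramp (y - s))%:C * g s)).
  move=> hr1 hr2 hr3 mg C0 yb gC.
  apply: (itgC_qbd hr1 hr2 hr3 (A := b * C)); first exact: mfunCM.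
    exact: mulr_ge0.
  move=> s sb; rewrite norm1MC ler_pM ?norm1_ge0 ?rb// gC//.
  by move: sb => /andP[s0 s1]; rewrite (ltW s0) ltW.
have dE (y : R) : 0 <= y <= b -> d y = intC (nodem N x)
    (fun s => nodeQ N x weights p0 s * ((ramp (y - s))%:C * d s)).
  move=> yb; have /andP[y0 y1] := yb.
  have id := io p0 d _ y mp p2 p_supp md (addr_ge0 A0 B0) yb dA.
  rewrite (int_nodeQ weights x_incr_inner id).
  have iE := io p0 _ _ y mp p2 p_supp mE B0 yb EB.
  have iq := io (cutoff b q) _ _ y mq q2 q_supp mE B0 yb EB.
  have iv := io p0 _ _ y mp p2 p_supp mv A0 yb (fun s _ => vA s).
  have eE := eker_ramp b0 Qi Qs M0 mK MK sK KE c yb.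
  rewrite (int_nodeQ weights x_incr_inner iq) in eE.
  have il : itgC leb (fun r => if 0 < r < y then (y - r)%:C * eker K c r else 0).
    apply: (itgC_dom (r := fun r : RT => if 0 < r < y then b * B else 0)).
    - apply: mfunC_if; [|apply: mfunCM => //|exact: mfunC_cst].
        by measurable_tac.
      by apply: mfunC_real; measurable_tac.
    - exact: integrable_if (@cont_cst _ _).
    - move=> r; case: ifP => [/andP[r0 ry]|_]; last by rewrite norm1_0.
      rewrite norm1MC ler_pM ?norm1_ge0//; first by rewrite ger0_norm; lra.
      by apply: EB; rewrite (ltW r0) (le_trans (ltW ry)).
  have pE : intC leb (fun s => p0 s * ((ramp (y - s))%:C * eker K c s)) =
    intC leb (fun s => cutoff b q s * ((ramp (y - s))%:C * eker K c s)) +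
    c ^+ 2 * intC leb (fun r => if 0 < r < y then (y - r)%:C * eker K c r else 0).
    rewrite -intCZ// -intCD//; last exact: itgCZ.
    apply: intC_ext => s; rewrite /p0 /cutoff c2.
    case: ifP => [/andP[s0 sb]|/negbT].
      rewrite s0 /=; case: ltP => sy.
        by rewrite ramp_pos ?subr_ge0 ?(ltW sy)//; ring.
      by rewrite ramp_neg ?subr_le0// realC0 !mul0r !mulr0 addr0.
    rewrite negb_and -!leNgt => sb; rewrite ifF ?mulr0 ?mul0r ?addr0//.
    apply/negbTE; rewrite negb_and -!leNgt; case/orP: sb => s0; first by rewrite s0.
    by rewrite (le_trans y1 s0) orbT.
  have uE := solution_ramp us u_0 ud0 yb.
  have vI : intC leb (fun s => p0 s * ((ramp (y - s))%:C * u s)) =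
     intC leb (fun s => p0 s * ((ramp (y - s))%:C * v s)).
    apply: intC_ext => s; rewrite /p0 /cutoff; case: ifP => [/andP[s0 sb]|_]; last by rewrite !mul0r.
    by rewrite vE// (ltW s0) ltW.
  rewrite vI in uE.
  have -> : d y = u y - eker K c y by rewrite /d yb vE.
  rewrite [in LHS]uE [in LHS]eE.
  have -> : intC leb (fun s => p0 s * ((ramp (y - s))%:C * d s)) =
     intC leb (fun s => p0 s * ((ramp (y - s))%:C * v s)) -
     intC leb (fun s => p0 s * ((ramp (y - s))%:C * eker K c s)).
    rewrite -intCB//; apply: intC_ext => s; rewrite /p0 /cutoff.
    case: ifP => [/andP[s0 sb]|_]; last by rewrite !mul0r subr0.
    by rewrite /d (ltW s0) (ltW sb) /=; ring.
  have -> : \sum_(k < N.+1) weights k * ((ramp (y - x k))%:C * d (x k)) =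
    \sum_(k < N.+1) weights k * ((ramp (y - x k))%:C * u (x k)) -
    \sum_(k < N.+1) weights k * ((ramp (y - x k))%:C * eker K c (x k)).
    rewrite -sumrB; apply: eq_bigr => k _.
    have /andP[k0 kb] : 0 <= x k < b by apply: node_range; rewrite -ltnS.
    by rewrite /d k0 (ltW kb) /= vE ?k0 ?(ltW kb)//; ring.
  rewrite pE -/c; ring.
move=> y yb.
have := gronwall b_gt0 x_incr_inner node_range mp p2 p_supp md (addr_ge0 A0 B0) dA dE yb.
by rewrite /d yb vE// => /eqP; rewrite subr_eq0 => /eqP.
Qed.
End uniqueness.

(** * Regularity of the kernel *)

Section windows.
Variable R : realType.
Local Notation RT := (measurableTypeR R).

(** Moving the window of [wave] changes it only near its two ends. The bounds
    are padded by t' - t on each side to make all the end points interior. *)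
Lemma wave_diff (z t t' s : R) : t <= t' ->
  `|wave z (t' - s) - wave z (t - s)| <=
  (if t - z - (t' - t) < s < t' - z + (t' - t) then 1 else 0) +
  (if t + z - (t' - t) < s < t' + z + (t' - t) then 1 else 0).
Proof.
rewrite le_eqVlt => /predU1P[<-|tt'].
  by rewrite subrr normr0 addr_ge0//; case: ifP.
set i1 := (if _ then 1 else 0); set i2 := (if _ then 1 else 0).
have i10 : 0 <= i1 by rewrite /i1; case: ifP.
have i20 : 0 <= i2 by rewrite /i2; case: ifP.
have j1 : t - z <= s <= t' - z -> i1 = 1.
  by move=> /andP[a1 a2]; rewrite /i1 ifT//; apply/andP; split; lra.
have j2 : t + z <= s <= t' + z -> i2 = 1.
  by move=> /andP[a1 a2]; rewrite /i2 ifT//; apply/andP; split; lra.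
have wE a : wave z (a - s) = if (a - z < s) && (s < a + z) then 2^-1 else 0.
  by rewrite /wave; congr (if _ then _ else _); apply/andP/andP => -[h1 h2]; split; lra.
have n2 : `|2^-1 : R| = 2^-1 by rewrite ger0_norm// invr_ge0.
rewrite !wE; case: ltP => a1; case: ltP => a2; case: ltP => a3; case: ltP => a4 /=;
  rewrite ?subrr ?subr0 ?sub0r ?normrN ?normr0 ?n2 ?addr_ge0//;
  try (by rewrite j1 ?a1 ?a2 ?a3 ?a4 ?(ltW a1) ?(ltW a2) ?(ltW a3) ?(ltW a4)//; lra);
  try (by rewrite j2 ?a1 ?a2 ?a3 ?a4 ?(ltW a1) ?(ltW a2) ?(ltW a3) ?(ltW a4)//; lra);
  try (by exfalso; lra).
Qed.

Lemma int_win (a c : R) : a <= c -> \int[leb]_s (if a < s < c then 1 else 0) = c - a.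
Proof.
move=> ac; rewrite (FTC2R ac (fun s => is_derive_lin 1 s) (@cont_cst _ 1)); ring.
Qed.

(** Two windows of length 3 (t' - t) around the ends of the support of
    [wave]. *)
Lemma wconv_lip (f : RT -> R[i]) (M z t t' : R) : mfunC f -> 0 <= M ->
  (forall u, norm1 (f u) <= M) -> t <= t' ->
  norm1 (wconv f z t' - wconv f z t) <= 6 * M * (t' - t).
Proof.
move=> mf M0 fM tt'.
have [i1 _] := conv_bound z t' mf fM; have [i2 _] := conv_bound z t mf fM.
rewrite /wconv -intCB//.
pose w1 (s : R) : R := if t - z - (t' - t) < s < t' - z + (t' - t) then 1 else 0.
pose w2 (s : R) : R := if t + z - (t' - t) < s < t' + z + (t' - t) then 1 else 0.
have iw1 : itg leb w1 by exact: integrable_if (@cont_cst _ 1).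
have iw2 : itg leb w2 by exact: integrable_if (@cont_cst _ 1).
have iw : itg leb (fun s => M * (w1 s + w2 s)) by apply: itgZ; exact: itgD.
apply: (le_trans (norm1_intC (itgCB i1 i2) iw _)).
  move=> s; rewrite -mulrBl -realCB norm1MC mulrC.
  by rewrite ler_pM ?norm1_ge0//; exact: wave_diff.
rewrite RintegralZl//; last exact: itgD.
rewrite RintegralD// !int_win; [|lra|lra].
by rewrite le_eqVlt; apply/orP; left; apply/eqP; ring.
Qed.

Lemma int_halfopen (a c k : R) : a <= c ->
  itg leb (fun s => if a <= s < c then k else 0) /\
  \int[leb]_s (if a <= s < c then k else 0) = k * (c - a).
Proof.
move=> ac.
have E : (fun s => if a <= s < c then k else 0) =
    (fun s : R => (if a < s < c then k else 0) + (if s == a then (if a < c then k else 0) else 0)).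
  apply/funext => s; rewrite le_eqVlt (eq_sym a).
  have [->|sa] := eqVneq s a; first by rewrite ltxx /= add0r.
  by rewrite /= addr0.
have i1 : itg leb (fun s => if a < s < c then k else 0) by exact: integrable_if (@cont_cst _ k).
have [i2 I2] := itg_point a (if a < c then k else 0).
rewrite E; split; first exact: itgD.
rewrite RintegralD// I2 addr0.
by rewrite (FTC2R ac (fun s => is_derive_lin k s) (@cont_cst _ k)); ring.
Qed.

(** Open intervals that are disjoint remain so after their left ends are
    added, since two half-open intervals that meet share an open interval. *)
Lemma disjoint_halfopen n (s t : 'I_n -> R) (p : R) :
  classical_sets.trivIset setT (fun i => `]s i, t i[%classic) ->
  \sum_(i < n) (if s i <= p < t i then 1 else 0) <= 1 :> R.
Proof.
move=> tI.
have [[i hi]|no] := pselect (exists i, s i <= p < t i); last first.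
  by rewrite big1// => i _; case: ifP => // h; exfalso; apply: no; exists i.
rewrite (bigD1 i)//= hi big1 ?addr0// => j ji; rewrite ifF//; apply/negbTE/negP => hj.
move/eqP: ji; apply; apply: tI => //.
move: hi hj => /andP[i1 i2] /andP[j1 j2].
pose p' := (p + Num.min (t i) (t j)) / 2.
have : p < Num.min (t i) (t j) by rewrite lt_min i2.
have : Num.min (t i) (t j) <= t i by rewrite ge_min lexx.
have : Num.min (t i) (t j) <= t j by rewrite ge_min lexx orbT.
rewrite -/p' => h1 h2 h3; exists p'; split; rewrite /= in_itv /= /p'; apply/andP; split; lra.
Qed.
End windows.

Section kernel_ac.
Variable R : realType.
Local Notation RT := (measurableTypeR R).
Variables (b : R) (N : nat) (x : nat -> R) (al : nat -> R[i]) (q0 : RT -> R[i]).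
Variables (K : RT * RT -> R[i]) (M : R).
Let m := nodem N x.
Let Q := nodeQ N x al q0.
Hypothesis b_gt0 : 0 < b.
Hypothesis x_0 : x 0%N = 0.
Hypothesis x_N1 : x N.+1 = b.
Hypothesis x_incr : forall i j, (i < j <= N.+1)%N -> x i < x j.
Hypothesis mq : mfunC q0.
Hypothesis q2 : itg leb (fun s => norm1 (q0 s) ^+ 2).
Hypothesis qsupp : forall s : R, ~~ (0 < s < b) -> q0 s = 0.
Hypothesis M0 : 0 <= M.
Hypothesis mK : mfunC K.
Hypothesis MK : forall p, norm1 (K p) <= M.
Hypothesis KE : forall y t : R, y <= b ->
  K (y, t) = intC m (fun s => Q s * inner K y t s).

Let x_incrN : forall i j, (i < j <= N)%N -> x i < x j := x_incr_inner x_incr.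
Let xb : forall k, (k <= N)%N -> 0 <= x k < b := node_range x_0 x_N1 x_incr.
Let Qi : itgC m Q := itgC_nodeQ al x_incrN mq q2 qsupp.
Let Qs := nodeQ_supp al xb qsupp.
Let qi : itg leb (fun s => norm1 (q0 s)) := itg_q mq q2 qsupp.

(** Of the two conditions |t - s| < y - s, the one on the right reads t < y and
    the one on the left s < (y + t) / 2. *)
Lemma wave_half (y s t : R) : - y < t < y ->
  wave (y - s) (t - s) = if s < (y + t) / 2 then 2^-1 else 0.
Proof.
move=> /andP[t1 t2]; rewrite /wave; congr (if _ then _ else _).
apply/andP/idP => [[h1 h2]|h]; [lra|split; lra].
Qed.

(** The wave term changes only through the values of Q on a half-open window,
    which carries no mass when it contains no node; the other term is
    Lipschitz. *)
Lemma kernel_increment (y t t' : R) : 0 < y <= b -> - y < t -> t <= t' -> t' < y ->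
  (forall k, (k <= N)%N -> ~~ ((y + t) / 2 <= x k < (y + t') / 2)) ->
  norm1 (K (y, t') - K (y, t)) <=
  \int[leb]_s (if (y + t) / 2 <= s < (y + t') / 2 then norm1 (q0 s) else 0) +
  6 * M * (\int[m]_s norm1 (Q s)) * (t' - t).
Proof.
move=> /andP[y0 yb] ty tt' ty' nox.
have b0 := ltW b_gt0.
have iK r : itgC m (fun s => Q s * inner K y r s) by exact: (itgC_Qinner b0 Qi Qs r M0 mK MK yb).
rewrite !KE// -intCB//.
pose win (s : R) := (y + t) / 2 <= s < (y + t') / 2.
pose f (s : RT) : R[i] := if win s then 2^-1%:C else 0.
have mwin : measurable_fun setT (win : RT -> bool).
  by measurable_tac.
have mf : mfunC f by apply: mfunC_if => //; exact: mfunC_cst.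
have hb (s : R) : 0 <= s < b -> norm1 (f s) <= 1.
  move=> _; rewrite /f; case: ifP => _; last by rewrite norm1_0.
  by rewrite norm1C ger0_norm ?invr_ge0//; lra.
have i1 : itgC m (fun s => Q s * f s) by exact: (itgC_Qbd Qi Qs mf ler01 hb).
pose g (s : RT) : R[i] := wconv (fun u => K (s, u)) (y - s) t' - wconv (fun u => K (s, u)) (y - s) t.
have splitE s : Q s * inner K y t' s - Q s * inner K y t s = Q s * f s + Q s * g s.
  rewrite -mulrDr -mulrBr.
  have [/andP[s0 sb]|sb] := boolP (0 <= s < b); last by rewrite [Q s](Qs sb) !mul0r.
  congr (_ * _); rewrite /inner /g opprD addrACA; congr (_ + _).
  rewrite -realCB wave_half ?wave_half; last 2 first.
  - by apply/andP; split => //; exact: le_lt_trans tt' ty'.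
  - by apply/andP; split => //; exact: lt_le_trans ty tt'.
  rewrite /f /win; case: (ltP s ((y + t') / 2)) => s1; case: (ltP s ((y + t) / 2)) => s2 /=;
    rewrite ?subrr ?subr0 ?sub0r//.
  by exfalso; lra.
have ig : itgC m (fun s => Q s * g s).
  have := itgCB (itgCB (iK t') (iK t)) i1.
  by congr itgC; apply/funext => s; rewrite splitE addrC addKr.
rewrite (intC_ext _ splitE) intCD//.
apply: (le_trans (norm1D _ _)); apply: lerD.
  have iq : itgC leb (fun s => q0 s * f s).
    by apply: (itgC_qbd mq q2 qsupp mf ler01) => s /andP[s0 sb]; apply: hb; rewrite (ltW s0).
  rewrite (int_nodeQ al x_incrN iq) big1 ?addr0; last first.
    move=> k _; rewrite /f ifF ?mulr0//; apply/negbTE; apply: nox.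
    by rewrite -ltnS.
  have iw : itg leb (fun s => if win s then norm1 (q0 s) else 0).
    apply: (le_itg (s := fun s : RT => norm1 (q0 s))) => //.
      apply: measurable_fun_ifT => //; exact: mfunC_norm1.
    by move=> s; case: ifP => _; [rewrite ger0_norm//|rewrite normr0]; exact: norm1_ge0.
  apply: norm1_intC => // s; rewrite /f -/(win s); case: ifP => _; last by rewrite mulr0 norm1_0.
  rewrite (le_trans (norm1M _ _))// ler_piMr ?norm1_ge0// norm1C ger0_norm ?invr_ge0//; lra.
have Qn := itgC_norm1 Qi.
apply: (le_trans (norm1_intC ig (itgZ (6 * M * (t' - t)) Qn) _)).
  move=> s; rewrite (le_trans (norm1M _ _))// mulrC ler_wpM2r ?norm1_ge0//.
  by apply: wconv_lip => //; exact: mfunC_sec.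
by rewrite RintegralZl// le_eqVlt; apply/orP; left; apply/eqP; ring.
Qed.

(** Sum [kernel_increment] over disjoint intervals. The windows in s are
    disjoint too, so the inequality 2 n k <= n^2 + k^2 for n = |q0| bounds their
    total contribution by a multiple of the L_2 norm, made small by the choice
    of k, plus a multiple of their total length. *)
Lemma kernel_ac_interval (y t0 t1 : R) : 0 < y <= b -> - y <= t0 -> t1 <= y ->
  (forall k, (k <= N)%N -> ~~ ((y + t0) / 2 < x k < (y + t1) / 2)) ->
  abs_cont `]t0, t1[ (fun t => K (y, t)).
Proof.
move=> yb yt0 yt1 nox eps e0.
pose J := \int[leb]_s (norm1 (q0 s) ^+ 2).
have J0 : 0 <= J by apply: Rintegral_ge0 => s _; exact: sqr_ge0.
pose L := \int[m]_s norm1 (Q s).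
have L0 : 0 <= L by apply: Rintegral_ge0 => s _; exact: norm1_ge0.
have J1 : 0 < J + 1 by rewrite ltr_wpDl.
pose C := (J + 1) / eps + 6 * M * L + 1.
have C0 : 0 < C.
  by rewrite /C ltr_wpDl// addr_ge0 ?divr_ge0 ?mulr_ge0// ltW.
exists (eps / 2 / C); first by rewrite !divr_gt0.
move=> n s t sub tI sum.
pose win (i : 'I_n) (p : R) := (y + s i) / 2 <= p < (y + t i) / 2.
have st i : s i <= t i by have [] := sub i.
have inI i : t0 < s i /\ t i < t1.
  have [sti sI] := sub i; split.
    by have /= := sI (s i); rewrite !in_itv /= lexx sti => /(_ isT)/andP[].
  by have /= := sI (t i); rewrite !in_itv /= lexx sti => /(_ isT)/andP[].
have inc i : norm1 (K (y, t i) - K (y, s i)) <=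
    \int[leb]_p (if win i p then norm1 (q0 p) else 0) + 6 * M * L * (t i - s i).
  have [si ti] := inI i; apply: kernel_increment => //.
  - exact: le_lt_trans si.
  - exact: lt_le_trans yt1.
  - move=> k kN; apply: contra (nox k kN) => /andP[h1 h2].
    by apply/andP; split; lra.
apply: (@le_lt_trans _ _ (\sum_(i < n) (\int[leb]_p (if win i p then norm1 (q0 p) else 0) + 6 * M * L * (t i - s i)))).
  by apply: ler_sum => i _; rewrite (le_trans (normc_norm1 _)).
rewrite big_split /= -mulr_sumr.
pose k := (J + 1) / eps; pose S := \sum_(i < n) (t i - s i).
have k0 : 0 < k by rewrite divr_gt0.
have mwin i : measurable_fun setT (win i : RT -> bool).
  by measurable_tac.
have iwq i : itg leb (fun p => if win i p then norm1 (q0 p) else 0).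
  apply: (le_itg (s := fun s : RT => norm1 (q0 s))) => //.
    by apply: measurable_fun_ifT => //; exact: mfunC_norm1.
  by move=> p; case: ifP => _; [rewrite ger0_norm//|rewrite normr0]; exact: norm1_ge0.
have wle i : (y + s i) / 2 <= (y + t i) / 2 by have := st i; lra.
have iwk i := int_halfopen k (wle i).
have sumI (F : 'I_n -> RT -> R) : (forall i, itg leb (F i)) ->
   itg leb (fun p => \sum_(i < n) F i p) /\
   \int[leb]_p (\sum_(i < n) F i p) = \sum_(i < n) \int[leb]_p F i p.
  move=> hF; elim: (index_enum _) => [|i r [h1 h2]].
    under eq_fun do rewrite big_nil.
    by rewrite big_nil; split; [exact: integrable0|rewrite /Rintegral integral0].
  under eq_fun do rewrite big_cons.
  by rewrite big_cons; split; [exact: itgD|rewrite RintegralD// h2].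
have [is1 Is1] := sumI _ iwq.
have [is2 Is2] := sumI (fun i p => if win i p then k else 0) (fun i => (iwk i).1).
have main : \sum_(i < n) \int[leb]_p (if win i p then norm1 (q0 p) else 0) <=
    eps / (2 * (J + 1)) * J + k / 2 * (S / 2).
  rewrite -Is1.
  have i3 : itg leb (fun p => eps / (2 * (J + 1)) * norm1 (q0 p) ^+ 2 +
     2^-1 * \sum_(i < n) (if win i p then k else 0)) by apply: itgD; exact: itgZ.
  apply: (@le_trans _ _ (\int[leb]_p (eps / (2 * (J + 1)) * norm1 (q0 p) ^+ 2 +
     2^-1 * \sum_(i < n) (if win i p then k else 0)))).
    apply: le_Rintegral => // p _.
    (* At most one window contains p, because p in the window of i means that
       2 p - y lies between s i and t i. *)
    pose Z : R := \sum_(i < n) (if win i p then 1 else 0).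
    have Z1 : Z <= 1.
      have := disjoint_halfopen (2 * p - y) tI; apply: le_trans.
      rewrite /Z le_eqVlt; apply/orP; left; apply/eqP; apply: eq_bigr => i _.
      by congr (if _ then _ else _); apply/andP/andP => -[h1 h2]; split; lra.
    have Z0 : 0 <= Z by apply: sumr_ge0 => i _; case: ifP.
    have z1 (a : R) : \sum_(i < n) (if win i p then a else 0) = a * Z.
      by rewrite /Z mulr_sumr; apply: eq_bigr => i _; case: ifP => _; rewrite ?mulr1 ?mulr0.
    rewrite !z1; have n0 := norm1_ge0 (q0 p).
    set nn := norm1 (q0 p) in n0 *.
    have -> : eps / (2 * (J + 1)) = k^-1 / 2.
      by rewrite /k; field; rewrite !lt0r_neq0.
    have h : nn <= k^-1 / 2 * nn ^+ 2 + k / 2.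
      have ki : 0 < k^-1 by rewrite invr_gt0.
      by have := young nn 1 ki; rewrite mulr1 expr1n mulr1 invrK.
    have h2 : Z * nn <= Z * (k^-1 / 2 * nn ^+ 2 + k / 2) by rewrite ler_wpM2l.
    have h3 : Z * (k^-1 / 2 * nn ^+ 2) <= k^-1 / 2 * nn ^+ 2.
      by rewrite ler_piMl// mulr_ge0 ?sqr_ge0// divr_ge0// invr_ge0 ltW.
    lra.
  rewrite RintegralD//; [|exact: itgZ|exact: itgZ].
  rewrite !RintegralZl// Is2 -/J lerD2l.
  rewrite (eq_bigr (fun i => k * ((t i - s i) / 2))); last first.
    by move=> i _; rewrite (iwk i).2; congr (_ * _); lra.
  rewrite -mulr_sumr -mulr_suml -/S le_eqVlt; apply/orP; left; apply/eqP; ring.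
have S0 : 0 <= S by apply: sumr_ge0 => i _; rewrite subr_ge0.
have h1 : eps / (2 * (J + 1)) * J <= eps / 2.
  have -> : eps / (2 * (J + 1)) * J = eps / 2 * (J / (J + 1)).
    by field; exact: lt0r_neq0.
  by rewrite ler_piMr ?divr_ge0 ?(ltW e0)// ler_pdivrMr// mul1r lerDl.
have h2 : S * C < eps / 2 by rewrite -ltr_pdivlMr.
have h3 : k / 2 * (S / 2) + 6 * M * L * S <= S * C.
  have := mulr_ge0 (ltW k0) S0.
  by rewrite /C -/k; lra.
apply: (@le_lt_trans _ _ (eps / 2 + S * C)); last by lra.
apply: (le_trans (lerD main (lexx _))).
by rewrite -/S -addrA; apply: lerD.
Qed.

(** The backward front of the wave emitted at the node x_i is at t = 2 x_i - y
    at time y; these points, for the nodes below y, are the only possible jumps. *)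
Lemma kernel_piecewise_ac (y : R) : 0 < y <= b ->
  piecewise_abs_cont (- y) y (fun t => K (y, t)).
Proof.
move=> yb; have /andP[y0 y1] := yb.
have ex : exists n, y <= x n by exists N.+1; rewrite x_N1.
case: (ex_minnP ex) => n yn Hn.
have nN : (n <= N.+1)%N by apply: Hn; rewrite x_N1.
have n0 : (0 < n)%N by case: n yn {Hn nN} => //; rewrite x_0 leNgt y0.
have lty i : (i < n)%N -> x i < y.
  by move=> i_n; rewrite ltNge; apply/negP => /Hn; rewrite leqNgt i_n.
exists n, (fun i => if (i < n)%N then 2 * x i - y else y); split.
- by rewrite n0 x_0 mulr0 sub0r.
- by rewrite ltnn.
move=> i i_n; rewrite i_n.
have xi := lty _ i_n.
have xi0 : 0 <= x i by have /andP[] := xb (leq_trans i_n nN : (i <= N)%N).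
have gap k z : (k <= N)%N -> z <= x i.+1 -> ~~ ((y + (2 * x i - y)) / 2 < x k < z).
  move=> kN zx; apply/negP => /andP[h1 h2].
  have {}h1 : x i < x k by lra.
  have ki : (i < k)%N.
    rewrite ltnNge; apply/negP => ki.
    have := node_le x_incr (i := k) (j := i).
    by rewrite ki (leq_trans (ltnW i_n) nN) => /(_ isT); rewrite leNgt h1.
  have := node_le x_incr (i := i.+1) (j := k).
  by rewrite ki (leqW kN) => /(_ isT) => h3; have := lt_le_trans h2 zx; rewrite ltNge h3.
have [i1n|] := ltnP i.+1 n.
  have xii : x i < x i.+1 by apply: x_incr; rewrite ltnSn (leq_trans (ltnW i1n) nN).
  have xi1 := lty _ i1n.
  split; first lra.
  apply: kernel_ac_interval => //; [lra|lra|].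
  by move=> k kN; apply: gap => //; lra.
move=> ni; have en : n = i.+1 by apply/eqP; rewrite eqn_leq ni i_n.
split; first lra.
apply: kernel_ac_interval => //; [lra|].
by move=> k kN; apply: gap => //; rewrite -en; lra.
Qed.

Lemma kernel_in_L2 (y : R) : in_L2 (- y) y (fun t => K (y, t)).
Proof.
have mS : mfunC (fun t : RT => K (y, t)) := mfunC_sec y mK.
have [m1 m2] := mS.
split; [exact: measurable_funTS|exact: measurable_funTS|].
pose f (t : RT) : R := ((fun t => Normc.normc (K (y, t))) \_ `]- y, y[) t.
have fE t : f t = if - y < t < y then Normc.normc (K (y, t)) else 0.
  by rewrite /f patchE mem_setE in_itv.
have mfn : measurable_fun setT f.
  rewrite (_ : f = fun t => if - y < t < y then Normc.normc (K (y, t)) else 0); last exact/funext.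
  apply: measurable_fun_ifT; [|exact: measurable_normc|exact: measurable_cst].
  by measurable_tac.
have nc0 (z : R[i]) : 0 <= Normc.normc z by case: z => a c /=; exact: sqrtr_ge0.
have i2 : itg leb (fun t => f t ^+ 2).
  apply: (le_itg (s := fun t : RT => if - y < t < y then M ^+ 2 else 0)).
  - exact: measurable_funX.
  - move=> t; rewrite ger0_norm ?sqr_ge0// fE; case: ifP => _; last by rewrite expr0n.
    by rewrite ler_pXn2r// ?nnegrE// (le_trans (normc_norm1 _)).
  - exact: integrable_if (@cont_cst _ _).
rewrite /finite_norm unlock /=.
rewrite (_ : (\int[_]_x _)%E = (\int[leb]_t (f t ^+ 2)%:E)%E); last first.
  apply: eq_integral => t _ /=; rewrite -/(f t); congr _%:E.
  by rewrite powR_mulrn// real_normK// num_real.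
by rewrite -(fineK (itg_fin_num i2)) poweR_EFin ltry.
Qed.

Lemma kernel_in_Loo : in_Lp (lebesgue_measure \x lebesgue_measure)%E +oo%E
          [set p : R * R | 0 < p.1 < b /\ `|p.2| < p.1]
          (fun p => K (p.1, p.2)).
Proof.
have mS : mfunC (fun p : RT * RT => K (p.1, p.2)) by apply: mfunC_comp mK _; measurable_tac.
have [m1 m2] := mS.
split; [exact: measurable_funTS|exact: measurable_funTS|].
rewrite /finite_norm unlock /=; case: ifP => _; last exact: ltry.
apply: (@le_lt_trans _ _ M%:E); last exact: ltry.
apply/ess_supP; apply: aeW => p /=.
rewrite lee_fin patchE; case: ifP => _; last by rewrite normr0.
rewrite ger0_norm; first by rewrite (le_trans (normc_norm1 _)).
by case: (K _) => a c /=; exact: sqrtr_ge0.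
Qed.
End kernel_ac.

(** * Representation of the solutions *)

Lemma nodes_increasing (R : realType) (N : nat) (x : nat -> R) :
  (forall k, (k <= N)%N -> x k < x k.+1) ->
  forall i j, (i < j <= N.+1)%N -> x i < x j.
Proof.
move=> x_lt i; elim=> // j IH /andP[]; rewrite ltnS leq_eqVlt => /predU1P[->|ij] jN.
  exact: x_lt.
by apply: (lt_trans (IH _) (x_lt _ jN)); rewrite ij ltnW.
Qed.

Lemma intC_support (R : realType) (D : set R) (f : R -> R[i]) :
  (forall t, t \notin D -> f t = 0) -> intC leb f = integralC D f.
Proof.
move=> f0; rewrite /integralC /intC [in RHS]Rintegral_mkcond [X in _ = _ +i* X]Rintegral_mkcond.
congr (_ +i* _); apply: eq_Rintegral => t _; rewrite patchE;
  by case: ifPn => // tD; rewrite f0.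
Qed.

Theorem theorem10 (R : realType) (b : R) (q : R -> R[i]) (N : nat)
    (x : nat -> R) (alpha : nat -> R[i]) (h : R[i]) (e : R[i] -> R -> R[i])
    (b_gt0 : 0 < b)
    (q_L2 : in_L2 0 b q)
    (x_0 : x 0%N = 0)
    (x_N1 : x N.+1 = b)
    (x_lt : forall k, (k <= N)%N -> x k < x k.+1)
    (alpha_neq0 : forall k, (0 < k <= N)%N -> alpha k != 0)
    (e_sol : forall rho : R[i], is_solution b q N x alpha (rho ^+ 2) (e rho))
    (e_0 : forall rho : R[i], e rho 0 = 1)
    (e_d0 : forall rho : R[i], cvgC (deriveC (e rho)) (0^'+) ('i%C * rho + h)) :
  exists K : R -> R -> R[i],
    [/\ (forall (rho : R[i]) (y : R), 0 < y <= b ->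
           e rho y = expC ('i%C * rho * y%:C) +
             integralC `[- y, y] (fun t => K y t * expC ('i%C * rho * t%:C))),
        (forall y : R, 0 < y <= b ->
           piecewise_abs_cont (- y) y (K y) /\ in_L2 (- y) y (K y)) &
        in_Lp (lebesgue_measure \x lebesgue_measure)%E +oo%E
          [set p : R * R | 0 < p.1 < b /\ `|p.2| < p.1]
          (fun p => K p.1 p.2)].
Proof.
have x_incr := nodes_increasing x_lt.
have [mq q2] := in_L2_cutoff q_L2.
have qs := @cutoff_supp _ b q.
have xb := node_range x_0 x_N1 x_incr.
have Qi := itgC_nodeQ (weights alpha h) (x_incr_inner x_incr) mq q2 qs.
have Qs := nodeQ_supp (weights alpha h) xb qs.
have [w [Wm [mw w1 wM wQ]]] :=
  weight_exists (weights alpha h) b_gt0 (x_incr_inner x_incr) xb mq q2 qs (ltW b_gt0).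
have [M [K [M0 mK MK K0 KE]]] := kernel_exists (ltW b_gt0) Qi Qs mw w1 wM wQ.
exists (fun y t => K (y, t)); split.
- move=> rho y /andP[y0 yb].
  rewrite (solution_eq_eker b_gt0 q_L2 x_0 x_N1 x_incr M0 mK MK K0 KE (e_sol rho) (e_0 rho)) ?(ltW y0)//.
  rewrite /eker; congr (_ + _); apply: intC_support => t.
  rewrite mem_setE in_itv /= -ler_norml -ltNge => yt.
  by rewrite K0 ?mul0r// ltW.
- move=> y yb; split.
    exact: (kernel_piecewise_ac b_gt0 x_0 x_N1 x_incr mq q2 qs M0 mK MK KE).
  exact: (kernel_in_L2 M0 mK MK).
- exact: (@kernel_in_Loo _ b K M M0 mK MK).
Qed.
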